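(* The pairing $\langle\!\langle\cdot,\cdot\rangle\!\rangle$ induces a perfect pairing between $\mathscr{Lie}_2(n)$ and $\mathscr{Eil}_2(n)$.
   Context: Let $R$ be a commutative ring with unit, $X=\{x_1<\dots<x_n\}$. $\mathscr{Lie}_2(n)$ is the multilinear part (span of bracket monomials containing each $x_i$ exactly once) of the free $R$-algebra on $X$ with two bilinear brackets $[\cdot,\cdot]$, $\langle\cdot,\cdot\rangle$ subject only to: $[x,y]+[y,x]=0$; $\langle x,y\rangle+\langle y,x\rangle=0$; $[x,[y,z]]+[y,[z,x]]+[z,[x,y]]=0$; $\langle x,\langle y,z\rangle\rangle+\langle y,\langle z,x\rangle\rangle+\langle z,\langle x,y\rangle\rangle=0$; $[x,\langle y,z\rangle]+[y,\langle z,x\rangle]+[z,\langle x,y\rangle]+\langle x,[y,z]\rangle+\langle y,[z,x]\rangle+\langle z,[x,y]\rangle=0$. A formal monomial is identified with a planar binary tree whose leaves are bijectively labeled by $X$ and whose internal vertices are red (for $[\cdot,\cdot]$) or blue (for $\langle\cdot,\cdot\rangle$), the root of $\{m_1,m_2\}$ having left subtree $m_1$ and right subtree $m_2$; $\Theta_n$ is the free $R$-module on these trees, so $\mathscr{Lie}_2(n)$ is a quotient of $\Theta_n$. An oriented two-colored graph on $X$ is a directed multigraph on vertex set $X$ whose edges are colored red or blue; $\Gamma_n$ is the free $R$-module on them. For such $H$ and a colored directed edge $e$ write $H+e$ for $H$ with $e$ added. $I_n\subseteq\Gamma_n$ is generated by: (a) $(H+(i\to j))+(H+(j\to i))$, both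 added edges of the same color; (b) $\sum_{(a,b,c)}(H+(a\to b)+(b\to c))$ over cyclic rotations $(a,b,c)$ of distinct $(i,j,k)$, all added edges of one color; (c) $\sum_{(a,b,c)}[(H+(a\to b)_{\mathrm{blue}}+(b\to c)_{\mathrm{red}})+(H+(a\to b)_{\mathrm{red}}+(b\to c)_{\mathrm{blue}})]$; (d) graphs with multiple edges between two vertices; (e) disconnected graphs. $\mathscr{Eil}_2(n)=\Gamma_n/I_n$. For a tree $T$ and graph $G$, send each edge $i\to j$ of $G$ to the nadir (vertex closest to the root) of the path between leaves $i$ and $j$ in $T$; call this map $\beta_{G,T}$. Let $N$ be the number of edges $i\to j$ for which leaf $i$ is below the right child and leaf $j$ below the left child of the nadir. Set $\langle\!\langle G,T\rangle\!\rangle=(-1)^N$ if $\beta_{G,T}$ is a bijection onto the internal vertices of $T$ and preserves colors, and $0$ otherwise; extend bilinearly to $\Gamma_n\times\Theta_n$. This bilinear form vanishes on the kernel of $\Theta_n\to\mathscr{Lie}_2(n)$ and on $I_n$, hence induces a bilinear pairing $\mathscr{Eil}_2(n)\times\mathscr{Lie}_2(n)\to R$, again denoted $\langle\!\langle\cdot,\cdot\rangle\!\rangle$. Perfect means that the induced maps from each module to the $R$-dual of the other are isomorphisms. *)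

(* Defs.v *)
From HB Require Import structures.
From mathcomp Require Import all_boot all_algebra.
From mathcomp Require Import finmap monalg boolp.

Set Implicit Arguments.
Unset Strict Implicit.
Unset Printing Implicit Defensive.

Import GRing.Theory.
Local Open Scope ring_scope.
Local Open Scope quotient_scope.

Section FreeModule.
Variables (R : comPzRingType) (K : choiceType).

(* {malg R[K]} is an lmodType only over nonzero rings; this alias carries the
   module structure over any commutative ring, the zero ring included. *)
Definition freemod : Type := {malg R[K]}.

HB.instance Definition _ := GRing.Zmodule.on freemod.

Implicit Types g h : {malg R[K]}.

Definition freemod_scale (c : R) g : {malg R[K]} :=
  \sum_(k <- msupp g) << c * g@_k *g k >>.

Lemma freemod_scaleE c g k : (freemod_scale c g)@_k = c * g@_k.
Proof.
rewrite /freemod_scale raddf_sum /=.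
rewrite [in RHS](monalgE g) raddf_sum /= mulr_sumr.
by apply/eq_bigr=> i _; rewrite !mcoeffU mulrnAr.
Qed.

Fact freemod_scaleA c d g :
  freemod_scale c (freemod_scale d g) = freemod_scale (c * d) g.
Proof. by apply/malgP=> k; rewrite !freemod_scaleE mulrA. Qed.

Fact freemod_scale1 : left_id 1 freemod_scale.
Proof. by move=> g; apply/malgP=> k; rewrite freemod_scaleE mul1r. Qed.

Fact freemod_scaleDr : right_distributive freemod_scale +%R.
Proof.
move=> c g h; apply/malgP=> k.
by rewrite freemod_scaleE !mcoeffD !freemod_scaleE mulrDr.
Qed.

Fact freemod_scaleDl g : {morph freemod_scale^~ g : a b / a + b}.
Proof.
move=> a b; apply/malgP=> k.
by rewrite freemod_scaleE mcoeffD !freemod_scaleE mulrDl.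
Qed.

HB.instance Definition _ := GRing.Zmodule_isLmodule.Build R freemod
  freemod_scaleA freemod_scale1 freemod_scaleDr freemod_scaleDl.

Definition gen (k : K) : freemod := << (1 : R) *g k >>.

(* linear extension of a function defined on the basis *)
Definition linext (V : lmodType R) (f : K -> V) (g : freemod) : V :=
  \sum_(k <- msupp g) g@_k *: f k.

End FreeModule.

Definition bilinext (R : comPzRingType) (K L : choiceType) (V : lmodType R)
    (f : K -> L -> V) (g : freemod R K) (h : freemod R L) : V :=
  linext (fun k => linext (f k) h) g.

Section Span.
Variables (R : comPzRingType) (V : lmodType R) (S : V -> Prop).

Inductive in_span : V -> Prop :=
| in_span0 : in_span 0
| in_spanP a u v : S u -> in_span v -> in_span (a *: u + v).

Definition span : {pred V} := fun v => `[< in_span v >].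

Fact span_submod_closed : submod_closed span.
Proof.
split=> [|a u v /asboolP hu /asboolP hv]; apply/asboolP; first exact: in_span0.
elim: hu => [|b w u' hw _ ih]; first by rewrite scaler0 add0r.
by rewrite scalerDr scalerA -addrA; apply: in_spanP.
Qed.

HB.instance Definition _ := GRing.isSubmodClosed.Build R V span
  span_submod_closed.

End Span.

Section QuotientModule.
Variables (R : comPzRingType) (V : lmodType R) (S : submodClosed V).

(* submodClosed does not provide closure under opposite, which Quotient.quot
   needs *)
Definition submod_zpred : {pred V} := S.

Fact submod_zpred_closed : zmod_closed submod_zpred.
Proof.
have [S0 SP] := submodClosedP S; split=> // u v Su Sv.
by rewrite addrC -scaleN1r; apply: SP.
Qed.

HB.instance Definition _ := GRing.isZmodClosed.Build V submod_zpred
  submod_zpred_closed.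

Definition quotmod : Type := Quotient.quot submod_zpred.

HB.instance Definition _ := GRing.Zmodule.on quotmod.

Definition quotmod_pi (v : V) : quotmod := \pi_(Quotient.quot submod_zpred) v.

Lemma quotmod_piP u v : reflect (quotmod_pi u = quotmod_pi v) (u - v \in S).
Proof.
rewrite -[u - v \in S]/(u - v \in submod_zpred) Quotient.idealrBE.
exact: eqP.
Qed.

Lemma quotmod_piB : zmod_morphism quotmod_pi.
Proof. by move=> u v; rewrite /quotmod_pi !piE. Qed.

HB.instance Definition _ :=
  GRing.isZmodMorphism.Build V quotmod quotmod_pi quotmod_piB.

Definition quotmod_scale (a : R) (x : quotmod) : quotmod :=
  quotmod_pi (a *: repr (x : Quotient.quot submod_zpred)).

Lemma quotmod_reprK (x : quotmod) : 
  quotmod_pi (repr (x : Quotient.quot submod_zpred)) = x.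
Proof. exact: reprK. Qed.

Fact quotmod_scale_pi a v :
  quotmod_scale a (quotmod_pi v) = quotmod_pi (a *: v).
Proof.
apply/quotmod_piP; rewrite -scalerBr; apply/rpredZ/quotmod_piP.
exact: quotmod_reprK.
Qed.

Fact quotmod_scaleA a b x :
  quotmod_scale a (quotmod_scale b x) = quotmod_scale (a * b) x.
Proof. by rewrite -[x]quotmod_reprK !quotmod_scale_pi scalerA. Qed.

Fact quotmod_scale1 : left_id 1 quotmod_scale.
Proof. by move=> x; rewrite -[x]quotmod_reprK quotmod_scale_pi scale1r. Qed.

Fact quotmod_scaleDr : right_distributive quotmod_scale +%R.
Proof.
move=> a x y; rewrite -[x]quotmod_reprK -[y]quotmod_reprK.
by rewrite -raddfD !quotmod_scale_pi scalerDr raddfD.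
Qed.

Fact quotmod_scaleDl x : {morph quotmod_scale^~ x : a b / a + b}.
Proof.
move=> a b; rewrite -[x]quotmod_reprK !quotmod_scale_pi.
by rewrite scalerDl raddfD.
Qed.

HB.instance Definition _ := GRing.Zmodule_isLmodule.Build R quotmod
  quotmod_scaleA quotmod_scale1 quotmod_scaleDr quotmod_scaleDl.

Fact quotmod_piZ : scalable quotmod_pi.
Proof. by move=> a v; rewrite -quotmod_scale_pi. Qed.

HB.instance Definition _ :=
  GRing.isScalable.Build R V quotmod *:%R quotmod_pi quotmod_piZ.

End QuotientModule.

Section Dual.
Variables (R : comPzRingType) (V : lmodType R).

Definition dual : Type := {linear V -> R^o}.

Definition dual_fun (f : dual) : V -> R := (f : {linear V -> R^o}).

Lemma dualP (f g : dual) : dual_fun f =1 dual_fun g -> f = g.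
Proof.
case: f g => [f [[hf] [kf]]] [g [[hg] [kg]]] /= /funext fg.
rewrite /dual_fun /= in fg; case: _ / fg in hg kg *.
by rewrite (Prop_irrelevance hf hg) (Prop_irrelevance kf kg).
Qed.

HB.instance Definition _ := gen_eqMixin dual.
HB.instance Definition _ := gen_choiceMixin dual.

Definition dual_zero : dual := \0 : {linear V -> R^o}.
Definition dual_opp (f : dual) : dual := \- (f : {linear V -> R^o}).
Definition dual_add (f g : dual) : dual :=
  (f : {linear V -> R^o}) \+ (g : {linear V -> R^o}).
Definition dual_scale (a : R) (f : dual) : dual := a \*: (f : {linear V -> R^o}).

Fact dual_addA : associative dual_add.
Proof. by move=> f g h; apply: dualP => v; apply: addrA. Qed.

Fact dual_addC : commutative dual_add.
Proof. by move=> f g; apply: dualP => v; apply: addrC. Qed.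

Fact dual_add0 : left_id dual_zero dual_add.
Proof. by move=> f; apply: dualP => v; apply: add0r. Qed.

Fact dual_addN : left_inverse dual_zero dual_opp dual_add.
Proof. by move=> f; apply: dualP => v; apply: addNr. Qed.

HB.instance Definition _ := GRing.isZmodule.Build dual
  dual_addA dual_addC dual_add0 dual_addN.

Fact dual_scaleA a b f : dual_scale a (dual_scale b f) = dual_scale (a * b) f.
Proof. by apply: dualP => v; apply: mulrA. Qed.

Fact dual_scale1 : left_id 1 dual_scale.
Proof. by move=> f; apply: dualP => v; apply: mul1r. Qed.

Fact dual_scaleDr : right_distributive dual_scale +%R.
Proof. by move=> a f g; apply: dualP => v; apply: mulrDr. Qed.

Fact dual_scaleDl f : {morph dual_scale^~ f : a b / a + b}.
Proof. by move=> a b; apply: dualP => v; apply: mulrDl. Qed.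

HB.instance Definition _ := GRing.Zmodule_isLmodule.Build R dual
  dual_scaleA dual_scale1 dual_scaleDr dual_scaleDl.

End Dual.

Section Pairing.
Variables (R : comPzRingType) (U V : lmodType R).

Record bilinear_pairing := BilinearPairing {
  pairing_fun :> U -> V -> R;
  pairing_linl : forall v, linear (pairing_fun^~ v : U -> R^o);
  pairing_linr : forall u, linear (pairing_fun u : V -> R^o)
}.

Variable p : bilinear_pairing.

Definition to_dualr (u : U) : dual V :=
  HB.pack (p u : V -> R^o)
    (GRing.isLinear.Build R V R^o *:%R (p u) (@pairing_linr p u)).

Definition to_duall (v : V) : dual U :=
  HB.pack (p^~ v : U -> R^o)
    (GRing.isLinear.Build R U R^o *:%R (p^~ v) (@pairing_linl p v)).

Definition linear_iso (M N : lmodType R) (f : M -> N) : Prop :=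
  linear f /\ bijective f.

Definition perfect : Prop := linear_iso to_dualr /\ linear_iso to_duall.

End Pairing.

Notation color := bool.
Definition red : color := false.
Definition blue : color := true.

Section Trees.
Variable n : nat.

(* x_(i+1) is represented by i : 'I_n *)
Inductive tree : Type := Leaf of 'I_n | Node of color & tree & tree.

Fixpoint tree_encode (t : tree) : GenTree.tree 'I_n :=
  match t with
  | Leaf i => GenTree.Leaf i
  | Node c l r => GenTree.Node (nat_of_bool c) [:: tree_encode l; tree_encode r]
  end.

Fixpoint tree_decode (t : GenTree.tree 'I_n) : option tree :=
  match t with
  | GenTree.Leaf i => Some (Leaf i)
  | GenTree.Node k [:: l; r] =>
      if tree_decode l is Some l' then
        if tree_decode r is Some r' then Some (Node (k == 1)%N l' r') else None
      else None
  | _ => None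
  end.

Lemma tree_encodeK : pcancel tree_encode tree_decode.
Proof. by elim=> //= c l -> r ->; case: c. Qed.

HB.instance Definition _ := Countable.copy tree (pcan_type tree_encodeK).

Fixpoint leaves (t : tree) : seq 'I_n :=
  match t with
  | Leaf i => [:: i]
  | Node _ l r => leaves l ++ leaves r
  end.

Record mltree : Type := MLTree {
  mltree_val :> tree;
  _ : perm_eq (leaves mltree_val) (enum 'I_n)
}.

HB.instance Definition _ := [isSub for mltree_val].
HB.instance Definition _ := [Countable of mltree by <:].

(* A vertex of a tree is the sequence of left (false) / right (true) turns
   leading to it from the root. *)
Definition vertex := seq bool.

Fixpoint internal (t : tree) : seq vertex :=
  match t with
  | Leaf _ => [::]
  | Node _ l r =>
      [::] :: map (cons false) (internal l) ++ map (cons true) (internal r)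
  end.

Fixpoint vcolor (t : tree) (v : vertex) : option color :=
  match t, v with
  | Leaf _, _ => None
  | Node c _ _, [::] => Some c
  | Node _ l r, b :: v' => vcolor (if b then r else l) v'
  end.

(* meaningful when i occurs exactly once in t *)
Fixpoint leaf_vertex (t : tree) (i : 'I_n) : vertex :=
  match t with
  | Leaf _ => [::]
  | Node _ l r =>
      if i \in leaves l then false :: leaf_vertex l i
      else true :: leaf_vertex r i
  end.

Fixpoint lcp (u v : vertex) : vertex :=
  match u, v with
  | a :: u', b :: v' => if a == b then a :: lcp u' v' else [::]
  | _, _ => [::]
  end.

(* The path between two leaves climbs from one of them to their deepest common
   ancestor and then descends to the other. *)
Definition nadir (t : tree) (i j : 'I_n) : vertex :=
  lcp (leaf_vertex t i) (leaf_vertex t j).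

End Trees.

Section Graphs.
Variable n : nat.

(* Loops are excluded: a loop is sent by beta to a leaf, so it pairs to 0 with
   every tree, while the relations below do not kill it. *)
Definition arc : finType := {a : 'I_n * 'I_n | a.1 != a.2}.
Definition edge : finType := (color * arc)%type.

Definition ecolor (e : edge) : color := e.1.
Definition src (e : edge) : 'I_n := (val e.2).1.
Definition tgt (e : edge) : 'I_n := (val e.2).2.

Definition arrow (c : color) (i j : 'I_n) (ij : i != j) : edge :=
  (c, exist (fun a : 'I_n * 'I_n => a.1 != a.2) (i, j) ij).

(* a multigraph, given by the multiplicity of every possible edge *)
Definition graph : choiceType := {ffun edge -> nat}.

Definition add_edge (H : graph) (e : edge) : graph :=
  [ffun f => (H f + (f == e))%N].

Definition edges (G : graph) : seq edge :=
  flatten [seq nseq (G e) e | e <- enum edge].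

Definition joins (e : edge) (i j : 'I_n) : bool :=
  ((src e, tgt e) == (i, j)) || ((src e, tgt e) == (j, i)).

Definition adjacent (G : graph) : rel 'I_n :=
  fun i j => has (fun e => joins e i j) (edges G).

(* exactly one connected component; so the graph with no vertices (n = 0)
   is disconnected *)
Definition connected (G : graph) : bool := n_comp (adjacent G) predT == 1%N.

Definition has_multiple_edge (G : graph) : bool :=
  [exists i, exists j, (1 < count (fun e => joins e i j) (edges G))%N].

End Graphs.

Arguments arrow {n} c {i j} ij.

Local Notation "H +e e" := (add_edge H e) (at level 50, left associativity).

Section Lie2.
Variables (R : comPzRingType) (n : nat).

(* the free R-algebra on n generators with two bilinear operations *)
Definition free2 : Type := freemod R (tree n).
HB.instance Definition _ := GRing.Lmodule.on free2.

Definition bracket (c : color) : free2 -> free2 -> free2 :=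
  bilinext (fun s t => gen R (Node c s t)).

Definition cyc3 (c d : color) (x y z : free2) : free2 :=
  bracket c x (bracket d y z) + bracket c y (bracket d z x)
  + bracket c z (bracket d x y).

(* the two-sided ideal generated by the defining relations *)
Inductive in_lie2_ideal : free2 -> Prop :=
| lie2_anti c x y : in_lie2_ideal (bracket c x y + bracket c y x)
| lie2_jacobi c x y z : in_lie2_ideal (cyc3 c c x y z)
| lie2_compat x y z : in_lie2_ideal (cyc3 red blue x y z + cyc3 blue red x y z)
| lie2_ideal0 : in_lie2_ideal 0
| lie2_idealP a u v :
    in_lie2_ideal u -> in_lie2_ideal v -> in_lie2_ideal (a *: u + v)
| lie2_ideall c u v : in_lie2_ideal u -> in_lie2_ideal (bracket c u v)
| lie2_idealr c u v : in_lie2_ideal v -> in_lie2_ideal (bracket c u v).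

Definition lie2_ideal : {pred free2} := fun u => `[< in_lie2_ideal u >].

Fact lie2_ideal_submod_closed : submod_closed lie2_ideal.
Proof.
split=> [|a u v /asboolP hu /asboolP hv]; apply/asboolP.
  exact: lie2_ideal0.
exact: lie2_idealP.
Qed.

HB.instance Definition _ := GRing.isSubmodClosed.Build R free2 lie2_ideal
  lie2_ideal_submod_closed.

Definition lie2_alg : Type := quotmod lie2_ideal.
HB.instance Definition _ := GRing.Lmodule.on lie2_alg.

Definition lie2_monomial (t : tree n) : lie2_alg :=
  quotmod_pi lie2_ideal (gen R t).

Definition multilinear : {pred lie2_alg} :=
  span (fun u => exists t : mltree n, u = lie2_monomial t).
HB.instance Definition _ := GRing.SubmodClosed.on multilinear.

Record Lie2 : Type := MkLie2 {
  Lie2_val :> lie2_alg;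
  _ : Lie2_val \in multilinear
}.

HB.instance Definition _ := [isSub for Lie2_val].
HB.instance Definition _ := [Choice of Lie2 by <:].
HB.instance Definition _ := [SubChoice_isSubLmodule of Lie2 by <:].

Fact lie2_monomial_multilinear (t : mltree n) : lie2_monomial t \in multilinear.
Proof.
apply/asboolP; rewrite -[lie2_monomial t]scale1r -[_ *: _]addr0.
by apply: in_spanP; [exists t | apply: in_span0].
Qed.

Definition Theta : Type := freemod R (mltree n).
HB.instance Definition _ := GRing.Lmodule.on Theta.

Definition Lie2_proj : Theta -> Lie2 :=
  linext (fun t => MkLie2 (lie2_monomial_multilinear t)).

End Lie2.

Section Eil2.
Variables (R : comPzRingType) (n : nat).

Definition Gamma : Type := freemod R (graph n).
HB.instance Definition _ := GRing.Lmodule.on Gamma.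

Local Notation "<[ G ]>" := (gen R (G : graph n) : Gamma).

Inductive eil2_relation : Gamma -> Prop :=
| eil2_flip (H : graph n) c i j (ij : i != j) (ji : j != i) :
    eil2_relation (<[ H +e arrow c ij ]> + <[ H +e arrow c ji ]>)
| eil2_arnold (H : graph n) c i j k (ij : i != j) (jk : j != k) (ki : k != i) :
    eil2_relation
      (<[ H +e arrow c ij +e arrow c jk ]>
       + <[ H +e arrow c jk +e arrow c ki ]>
       + <[ H +e arrow c ki +e arrow c ij ]>)
| eil2_mixed (H : graph n) i j k (ij : i != j) (jk : j != k) (ki : k != i) :
    eil2_relation
      ((<[ H +e arrow blue ij +e arrow red jk ]>
        + <[ H +e arrow red ij +e arrow blue jk ]>)
       + (<[ H +e arrow blue jk +e arrow red ki ]>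
          + <[ H +e arrow red jk +e arrow blue ki ]>)
       + (<[ H +e arrow blue ki +e arrow red ij ]>
          + <[ H +e arrow red ki +e arrow blue ij ]>))
| eil2_multiple (G : graph n) : has_multiple_edge G -> eil2_relation <[ G ]>
| eil2_disconnected (G : graph n) : ~~ connected G -> eil2_relation <[ G ]>.

Definition Eil2 : Type := quotmod (span eil2_relation).
HB.instance Definition _ := GRing.Lmodule.on Eil2.

Definition Eil2_proj : Gamma -> Eil2 := quotmod_pi (span eil2_relation).

End Eil2.

Section GraphTreePairing.
Variables (R : comPzRingType) (n : nat).

Definition beta (G : graph n) (T : mltree n) : seq vertex :=
  [seq nadir T (src e) (tgt e) | e <- edges G].

(* [internal T] has no repetition, so the list of the images of all the edges,
   counted with multiplicity, is a permutation of it exactly when beta_(G,T)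
   is a bijection onto the internal vertices. *)
Definition beta_bijective (G : graph n) (T : mltree n) : bool :=
  perm_eq (beta G T) (internal T).

Definition beta_color (G : graph n) (T : mltree n) : bool :=
  all (fun e => vcolor T (nadir T (src e) (tgt e)) == Some (ecolor e)) (edges G).

Definition reversed (T : mltree n) (e : edge n) : bool :=
  let v := nadir T (src e) (tgt e) in
  prefix (rcons v true) (leaf_vertex T (src e))
  && prefix (rcons v false) (leaf_vertex T (tgt e)).

Definition graph_tree_pairing (G : graph n) (T : mltree n) : R :=
  if beta_bijective G T && beta_color G T
  then (-1) ^+ count (reversed T) (edges G) else 0.

Definition pairing_form : Gamma R n -> Theta R n -> R :=
  bilinext (graph_tree_pairing : graph n -> mltree n -> R^o).

End GraphTreePairing.

(* Main.v *)
Require Import Defs.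
From HB Require Import structures.
From mathcomp Require Import all_boot all_algebra.
From mathcomp Require Import finmap monalg boolp zify.

(* Color the edge from a parent p to its child x in a rooted tree on X red if
   p < x and blue if x < p. Read as graphs, these rooted trees span Eil_2(n).
   Cutting a rooted tree at its largest label again and again turns it into a
   bracket monomial, and these monomials span Lie_2(n). For a suitable order on
   the rooted trees the matrix of the pairing between the two families is
   triangular with diagonal entries 1 and -1, hence invertible over R; two
   finite spanning families with an invertible pairing matrix are dual bases up
   to a change of basis, so the pairing is perfect.

   The pairing with a graph G descends to Lie_2(n) because it is evaluation of
   monomials in an algebra of functions on the subsets of X, whose two brackets
   are dual to cutting one red or one blue edge of G. *)

(** Everything turns on the largest label v. An edge from v to a child is blue and the edge to its
    parent is red, so the color alone tells on which side of v an edge leads. The cut at v is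
    therefore forced: the red edge above v if v is not the root, otherwise the blue edge to the
    branch with the largest remaining label. A graph pairs nontrivially with a monomial only if each
    bracket is crossed by exactly one edge, of the color of the bracket. When two first cuts have
    the same color, this makes the part cut off by one tree lie inside the part cut off by the
    other; the order compares the sizes of these parts first. The obstacle on both sides is the
    two-color relation: with six terms it is usable only where five of them are already under
    control. Moreover $I_n$ contains double edges but no longer cycles among its generators, so
    two-colored cycles have to be reduced separately. Independence of either family is never shown
    directly; it follows from the invertible matrix, so no property of R enters and the zero ring is
    included. *)

Set Implicit Arguments.
Unset Strict Implicit.
Unset Printing Implicit Defensive.

Import GRing.Theory.
Local Open Scope ring_scope.

Local Notation span := Defs.span.

(** * Free modules and spans *)

Section FreeModuleTheory.
Variables (R : comPzRingType) (K : choiceType).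
Implicit Types (g h : freemod R K).

Lemma freemod_coefZ a g k : (a *: g)@_k = a * g@_k.
Proof. exact: freemod_scaleE. Qed.

Lemma gen_coef (k l : K) : (gen R k : freemod R K)@_l = (k == l)%:R.
Proof. by rewrite /gen mcoeffU. Qed.

Lemma freemod_genE g : g = \sum_(k <- msupp g) g@_k *: gen R k.
Proof.
apply/malgP => l; rewrite [in LHS](monalgE g).
rewrite !raddf_sum; apply: eq_bigr => k _.
by rewrite /= freemod_coefZ gen_coef mcoeffU mulr_natr.
Qed.

Lemma freemod_ind (P : freemod R K -> Prop) :
  P 0 -> (forall a k g, P g -> P (a *: gen R k + g)) -> forall g, P g.
Proof.
move=> P0 PS g; rewrite (freemod_genE g).
by elim: (enum_fset _) => [|k s ih]; rewrite ?big_nil ?big_cons //; apply: PS.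
Qed.

Variable V : lmodType R.

Lemma linext_wide (f : K -> V) g (d : {fset K}) :
  (msupp g `<=` d)%fset -> linext f g = \sum_(k <- d) g@_k *: f k.
Proof.
move=> sub; rewrite /linext; apply: big_fset_incl => // k _ kg.
by rewrite mcoeff_outdom // scale0r.
Qed.

Lemma linext_linear (f : K -> V) : linear (linext f).
Proof.
move=> a g h; pose d := (msupp g `|` msupp h `|` msupp (a *: g + h))%fset.
have sub3 (s1 s2 s3 : {fset K}) : [/\ (s1 `<=` s1 `|` s2 `|` s3)%fset,
    (s2 `<=` s1 `|` s2 `|` s3)%fset & (s3 `<=` s1 `|` s2 `|` s3)%fset].
  by split; apply/fsubsetP => k; rewrite !inE => ->; rewrite ?orbT.
have [s1 s2 s3] := sub3 (msupp g) (msupp h) (msupp (a *: g + h)).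
rewrite (linext_wide _ s1) (linext_wide _ s2) (linext_wide _ s3).
rewrite scaler_sumr -big_split /=; apply: eq_bigr => k _.
by rewrite mcoeffD freemod_coefZ scalerDl scalerA.
Qed.

HB.instance Definition _ (f : K -> V) :=
  GRing.isLinear.Build R (freemod R K) V *:%R (linext f) (linext_linear f).

Lemma linext0 (f : K -> V) : linext f 0 = 0.
Proof. exact: (linear0 (linext f)). Qed.

Lemma linextD (f : K -> V) g h : linext f (g + h) = linext f g + linext f h.
Proof. exact: (linearD (linext f)). Qed.

Lemma linextZ (f : K -> V) a g : linext f (a *: g) = a *: linext f g.
Proof. exact: (linearZ_LR (linext f)). Qed.

Lemma linext_linr (W : lmodType R) (f : K -> W -> V) g :
  (forall k, linear (f k)) -> linear (fun w => linext (f^~ w) g).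
Proof.
move=> fP a u v; rewrite /linext scaler_sumr -big_split.
by apply: eq_bigr => k _ /=; rewrite fP scalerDr !scalerA mulrC.
Qed.

Lemma linext_gen (f : K -> V) k : linext f (gen R k) = f k.
Proof.
rewrite (@linext_wide _ _ [fset k]%fset) ?msuppU_le //.
by rewrite big_seq_fset1 gen_coef eqxx scale1r.
Qed.

Lemma linext_uniq (f : K -> V) (L : freemod R K -> V) :
  linear L -> (forall k, L (gen R k) = f k) -> linext f =1 L.
Proof.
move=> LP Lf; elim/freemod_ind => [|a k g ih].
  by rewrite linext0; have := LP (-1) 0 0; rewrite !scaleN1r !addNr.
by rewrite linextD linextZ ih linext_gen LP Lf.
Qed.

End FreeModuleTheory.

Section Bilinext.
Variables (R : comPzRingType) (K L : choiceType) (V : lmodType R).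
Variable f : K -> L -> V.

Lemma bilinext_linl h : linear (fun g => bilinext f g h).
Proof. exact: linext_linear. Qed.

Lemma bilinext_linr g : linear (bilinext f g).
Proof.
by apply: linext_linr => k; apply: linext_linear.
Qed.

Lemma bilinext_gen k l : bilinext f (gen R k) (gen R l) = f k l.
Proof. by rewrite /bilinext !linext_gen. Qed.

HB.instance Definition _ g :=
  GRing.isLinear.Build R (freemod R L) V *:%R (bilinext f g) (bilinext_linr g).
Definition bilinext_l h g := bilinext f g h.
HB.instance Definition _ h :=
  GRing.isLinear.Build R (freemod R K) V *:%R (bilinext_l h)
    (bilinext_linl h).

End Bilinext.

Lemma bilinear_morph_ext (R : comPzRingType) (K : choiceType) (V : lmodType R)
    (br : freemod R K -> freemod R K -> freemod R K) (B : V -> V -> V)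
    (e : freemod R K -> V) :
  linear e ->
  (forall v, linear (br^~ v)) -> (forall u, linear (br u)) ->
  (forall y, linear (B^~ y)) -> (forall x, linear (B x)) ->
  (forall k l, e (br (gen R k) (gen R l)) = B (e (gen R k)) (e (gen R l))) ->
  forall u v, e (br u v) = B (e u) (e v).
Proof.
move=> e_lin brl brr Bl Br egen.
have lin0 (U W : lmodType R) (f : U -> W) : linear f -> f 0 = 0.
  by move=> fl; rewrite -[0](subrr 0) -scaleN1r addrC fl scaleN1r addNr.
elim/freemod_ind => [v|b k u ih v].
  by rewrite [br 0 v](lin0 _ _ _ (brl v)) (lin0 _ _ _ e_lin) [RHS](lin0 _ _ _ (Bl _)).
rewrite [br _ v]brl !e_lin ih [RHS]Bl; congr (_ *: _ + _).
elim/freemod_ind: v {ih} => [|d l v ih].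
  by rewrite [br _ 0](lin0 _ _ _ (brr _)) (lin0 _ _ _ e_lin) [RHS](lin0 _ _ _ (Br _)).
by rewrite [br _ _]brr !e_lin ih egen [RHS]Br.
Qed.

Section SpanTheory.
Variables (R : comPzRingType) (V : lmodType R).
Implicit Types (S : V -> Prop) (u v : V).

Lemma mem_span S u : S u -> u \in span S.
Proof.
move=> Su; apply/asboolP; rewrite -[u]scale1r -[_ *: _]addr0.
by apply: in_spanP => //; apply: in_span0.
Qed.

Lemma spanN S u : (- u \in span S) = (u \in span S).
Proof.
have h w : w \in span S -> - w \in span S.
  by move=> hw; rewrite -scaleN1r; apply: rpredZ.
by apply/idP/idP => /h; rewrite ?opprK.
Qed.

Lemma span_linear S (W : lmodType R) (K : submodClosed W) (f : V -> W) u :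
  linear f -> (forall v, S v -> f v \in K) -> u \in span S -> f u \in K.
Proof.
move=> fP Sf /asboolP; elim=> [|a v w Sv _ ih]; last first.
  by rewrite fP rpredD // rpredZ // Sf.
have -> : f 0 = 0; last exact: rpred0.
by have := fP (-1) 0 0; rewrite !scaleN1r !addNr.
Qed.

Lemma span_trans S (K : submodClosed V) u :
  (forall v, S v -> v \in K) -> u \in span S -> u \in K.
Proof. exact: (@span_linear S V K idfun u (fun _ _ _ => erefl)). Qed.

Lemma span_linear0 S (W : lmodType R) (f : V -> W) u :
  linear f -> (forall v, S v -> f v = 0) -> u \in span S -> f u = 0.
Proof.
move=> fP Sf /asboolP; elim=> [|a v w Sv _ ih].
  by have := fP (-1) 0 0; rewrite !scaleN1r !addNr.
by rewrite fP Sf // ih scaler0 addr0.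
Qed.

End SpanTheory.

(** * Algebras with two compatible Lie brackets *)

Section TwoLie.
Variable R : comPzRingType.

Section Bracket.
Variable n : nat.
Implicit Types u v : free2 R n.

Lemma bracketPl c a u u' v :
  bracket c (a *: u + u') v = a *: bracket c u v + bracket c u' v.
Proof. exact: bilinext_linl. Qed.

Lemma bracketPr c u a v v' :
  bracket c u (a *: v + v') = a *: bracket c u v + bracket c u v'.
Proof. exact: bilinext_linr. Qed.

Lemma bracket_gen c (s t : tree n) :
  bracket c (gen R s) (gen R t) = gen R (Node c s t).
Proof. exact: bilinext_gen. Qed.

Lemma bracketBl c u u' v : bracket c (u - u') v = bracket c u v - bracket c u' v.
Proof. exact: (linearB (bilinext_l _ v)). Qed.

Lemma bracketBr c u v v' : bracket c u (v - v') = bracket c u v - bracket c u v'.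
Proof. exact: (linearB (bilinext _ u)). Qed.

(** Changing one argument at a time: each summand has one of the differences as an argument, so it
    stays in the ideal when they do. The factor [1 *:] matches the shape of [lie2_idealP]. *)
Lemma bracketBB c u u' v v' : bracket c u v - bracket c u' v' =
  1 *: bracket c (u - u') v + bracket c u' (v - v').
Proof.
move: (bracketBl c u u' v) (bracketBr c u' v v').
move: (@bracket R n) => br -> ->.
by move: (br c u v) (br c u' v) => x y; rewrite scale1r addrA subrK.
Qed.

End Bracket.

Record two_lie (V : lmodType R) := TwoLie {
  brk :> color -> V -> V -> V;
  brk_linl : forall c y, linear (fun x => brk c x y);
  brk_linr : forall c x, linear (brk c x);
  brk_anti : forall c x y, brk c x y + brk c y x = 0;
  brk_jacobi : forall c x y z,
    brk c x (brk c y z) + brk c y (brk c z x) + brk c z (brk c x y) = 0;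
  brk_compat : forall x y z,
    brk red x (brk blue y z) + brk red y (brk blue z x)
    + brk red z (brk blue x y)
    + (brk blue x (brk red y z) + brk blue y (brk red z x)
       + brk blue z (brk red x y)) = 0
}.

Section Brk.
Variables (V : lmodType R) (B : two_lie V).

Lemma brkDl c x x' y : B c (x + x') y = B c x y + B c x' y.
Proof. by have := brk_linl B c y 1 x x'; rewrite !scale1r. Qed.

Lemma brk0l c y : B c 0 y = 0.
Proof. by apply: (addrI (B c 0 y)); rewrite -brkDl !addr0. Qed.

Lemma brkZl c a x y : B c (a *: x) y = a *: B c x y.
Proof. by have := brk_linl B c y a x 0; rewrite brk0l !addr0. Qed.

Lemma brkC c x y : B c x y = - B c y x.
Proof. by apply/eqP; rewrite -addr_eq0 brk_anti. Qed.

Lemma brk0r c x : B c x 0 = 0.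
Proof. by rewrite brkC brk0l oppr0. Qed.

Lemma brkZr c a x y : B c x (a *: y) = a *: B c x y.
Proof. by rewrite brkC brkZl -scalerN -brkC. Qed.

Lemma brkNr c x y : B c x (- y) = - B c x y.
Proof. by rewrite -scaleN1r brkZr scaleN1r. Qed.

Lemma brk_derivation c x y z : B c (B c x y) z = B c x (B c y z) - B c y (B c x z).
Proof.
have /eqP := brk_jacobi B c x y z; rewrite (brkC c z x) brkNr addr_eq0 => /eqP ->.
by rewrite (brkC c z) opprK.
Qed.

(** The compatibility relation solved for one term. Unlike [brk_derivation] it leaves a term whose
    first argument is still a bracket, but there the outer bracket is blue, a case that is settled
    earlier. *)
Lemma brk_derivation2 x y z :
  B red (B blue x y) z = - B blue (B red x y) z
    + B red x (B blue y z) - B red y (B blue x z)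
    + B blue x (B red y z) - B blue y (B red x z).
Proof.
have := brk_compat B x y z.
rewrite (brkC blue z x) (brkC red z x) !brkNr.
rewrite (brkC red z) (brkC blue z (B red x y)).
set a := B red x _; set b := B red y _; set d := B red _ z.
set e := B blue x _; set f := B blue y _; set g := B blue _ z => /eqP.
rewrite addrAC subr_eq0 => /eqP <-.
by rewrite -!addrA (addrC (- g)) -!addrA; do !congr (_ + _); rewrite addrC.
Qed.

Variables (n : nat) (a : 'I_n -> V).

Fixpoint tree_eval (t : tree n) : V :=
  match t with
  | Leaf i => a i
  | Node c l r => B c (tree_eval l) (tree_eval r)
  end.

Variable e : free2 R n -> V.
Hypothesis e_lin : linear e.
Hypothesis e_gen : forall t, e (gen R t) = tree_eval t.

Lemma eval_bracket c u v : e (bracket c u v) = B c (e u) (e v).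
Proof.
apply: (bilinear_morph_ext (e := e)) => [|y|x|y|x|k l].
- exact: e_lin.
- by move=> ? ? ?; apply: bracketPl.
- by move=> ? ? ?; apply: bracketPr.
- exact: brk_linl.
- exact: brk_linr.
rewrite (e_gen k) (e_gen l).
exact: (etrans (congr1 e (bracket_gen _ _ _)) (e_gen _)).
Qed.

Lemma eval_lie2_ideal u : in_lie2_ideal u -> e u = 0.
Proof.
have eD x y : e (x + y) = e x + e y by have := e_lin 1 x y; rewrite !scale1r.
have e0 : e 0 = 0 by apply: (addrI (e 0)); rewrite -eD !addr0.
have eb := eval_bracket.
elim=> [c x y|c x y z|x y z||b x y _ hx _ hy|c x y _ hx|c x y _ hy].
- by move: eb; rewrite /cyc3; move: (@bracket R n) => br eb; rewrite eD !eb brk_anti.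
- by move: eb; rewrite /cyc3; move: (@bracket R n) => br eb; rewrite !eD !eb brk_jacobi.
- by move: eb; rewrite /cyc3; move: (@bracket R n) => br eb; rewrite !eD !eb brk_compat.
- exact: e0.
- by rewrite e_lin hx hy scaler0 addr0.
- by rewrite (eb c x y) hx brk0l.
- by rewrite (eb c x y) hy brk0r.
Qed.

End Brk.

Section TwoLieQuotient.
Variables (U L : lmodType R) (p : U -> L).
Variables (b : color -> U -> U -> U) (br : color -> L -> L -> L).
Hypothesis p_surj : forall x, exists u, x = p u.
Hypothesis pP : forall a u v, p (a *: u + v) = a *: p u + p v.
Hypothesis pb : forall c u v, p (b c u v) = br c (p u) (p v).
Hypothesis bPl : forall c a u u' v,
  b c (a *: u + u') v = a *: b c u v + b c u' v.
Hypothesis bPr : forall c u a v v',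
  b c u (a *: v + v') = a *: b c u v + b c u v'.
Hypothesis p_anti : forall c u v, p (b c u v + b c v u) = 0.
Hypothesis p_jacobi : forall c u v w,
  p (b c u (b c v w) + b c v (b c w u) + b c w (b c u v)) = 0.
Hypothesis p_compat : forall u v w,
  p (b red u (b blue v w) + b red v (b blue w u) + b red w (b blue u v)
     + (b blue u (b red v w) + b blue v (b red w u) + b blue w (b red u v))) = 0.

Let pD u v : p (u + v) = p u + p v.
Proof. by have := pP 1 u v; rewrite !scale1r. Qed.

Fact quotient_linl c y : linear (fun x => br c x y).
Proof.
move=> a x x'; have [v ->] := p_surj y.
have [u ->] := p_surj x; have [u' ->] := p_surj x'.
by rewrite -pP -!pb bPl pP.
Qed.

Fact quotient_linr c x : linear (br c x).
Proof.
move=> a y y'; have [u ->] := p_surj x.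
have [v ->] := p_surj y; have [v' ->] := p_surj y'.
by rewrite -pP -!pb bPr pP.
Qed.

Fact quotient_anti c x y : br c x y + br c y x = 0.
Proof.
by have [u ->] := p_surj x; have [v ->] := p_surj y; rewrite -!pb -pD.
Qed.

Fact quotient_jacobi c x y z :
  br c x (br c y z) + br c y (br c z x) + br c z (br c x y) = 0.
Proof.
have [u ->] := p_surj x; have [v ->] := p_surj y; have [w ->] := p_surj z.
by rewrite -!pb -!pD.
Qed.

Fact quotient_compat x y z :
  br red x (br blue y z) + br red y (br blue z x) + br red z (br blue x y)
  + (br blue x (br red y z) + br blue y (br red z x) + br blue z (br red x y))
  = 0.
Proof.
have [u ->] := p_surj x; have [v ->] := p_surj y; have [w ->] := p_surj z.
by rewrite -!pb -!pD.
Qed.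

Definition two_lie_quotient : two_lie L :=
  TwoLie quotient_linl quotient_linr quotient_anti quotient_jacobi
    quotient_compat.

End TwoLieQuotient.

Section FreeTwoLie.
Variable n : nat.
Local Notation L := (lie2_alg R n).

Definition lie2_pi (u : free2 R n) : L := quotmod_pi (@lie2_ideal R n) u.

Definition lie2_repr (x : L) : free2 R n := repr (x : quotmod (@lie2_ideal R n)).

Lemma lie2_reprK x : lie2_pi (lie2_repr x) = x.
Proof. exact: quotmod_reprK. Qed.

Lemma lie2_piP a u v : lie2_pi (a *: u + v) = a *: lie2_pi u + lie2_pi v.
Proof. exact: linearP. Qed.

Lemma lie2_pi_eqP u v : reflect (in_lie2_ideal (u - v)) (lie2_pi u == lie2_pi v).
Proof.
apply: (iffP eqP) => [/quotmod_piP/asboolP//|h].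
by apply/quotmod_piP/asboolP.
Qed.

Lemma lie2_pi_ideal u : in_lie2_ideal u -> lie2_pi u = 0.
Proof.
move=> hu; rewrite -[RHS](raddf0 (@quotmod_pi R (free2 R n) (@lie2_ideal R n))).
by apply/eqP/lie2_pi_eqP; rewrite subr0.
Qed.

Lemma lie2_pi_surj x : exists u, x = lie2_pi u.
Proof. by exists (lie2_repr x); rewrite lie2_reprK. Qed.

Definition lie2_brk (c : color) (x y : L) : L :=
  lie2_pi (bracket c (lie2_repr x) (lie2_repr y)).

Lemma lie2_pi_bracket c u v :
  lie2_pi (bracket c u v) = lie2_brk c (lie2_pi u) (lie2_pi v).
Proof.
have reprP w : in_lie2_ideal (w - lie2_repr (lie2_pi w)).
  by apply/lie2_pi_eqP; rewrite lie2_reprK.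
apply/eqP/lie2_pi_eqP; have := reprP u; have := reprP v.
move: (lie2_repr _) (lie2_repr _) => u' v' hv hu.
apply: (eq_ind_r (@in_lie2_ideal R n) _ (bracketBB c u u' v v')).
by apply: lie2_idealP; [apply: lie2_ideall | apply: lie2_idealr].
Qed.

Definition lie2_alg_two_lie : two_lie L :=
  two_lie_quotient lie2_pi_surj lie2_piP lie2_pi_bracket
    (@bracketPl n) (@bracketPr n)
    (fun c u v => lie2_pi_ideal (lie2_anti c u v))
    (fun c u v w => lie2_pi_ideal (lie2_jacobi c u v w))
    (fun u v w => lie2_pi_ideal (lie2_compat u v w)).

Lemma lie2_monomialN c l r : lie2_monomial R (Node c l r) =
  lie2_alg_two_lie c (lie2_monomial R l) (lie2_monomial R r).
Proof.
rewrite /= -[lie2_monomial R l]/(lie2_pi (gen R l)).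
rewrite -[lie2_monomial R r]/(lie2_pi (gen R r)) -lie2_pi_bracket.
exact: (congr1 lie2_pi (esym (bracket_gen c l r))).
Qed.

(** Universal property of the free algebra. It yields both the functional on monomials attached to a
    graph and the substitution of a bracket for a generator. *)
Lemma lie2_subst (V : lmodType R) (B : two_lie V) (a : 'I_n -> V) :
  exists f : {linear L -> V}, forall t, f (lie2_monomial R t) = tree_eval B a t.
Proof.
have [e [e_lin e_gen]] : exists e : free2 R n -> V,
    linear e /\ forall t, e (gen R t) = tree_eval B a t.
  exists (linext (tree_eval B a)); split; first exact: linext_linear.
  by move=> t; apply: linext_gen.
have eP := eval_lie2_ideal e_lin e_gen.
have eB u v : e (u - v) = e u - e v.
  by rewrite [u - v]addrC -[- v]scaleN1r e_lin scaleN1r addrC.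
pose f (x : L) : V := e (lie2_repr x).
have f_pi u : f (lie2_pi u) = e u.
  apply/eqP; rewrite -subr_eq0 -eB; apply/eqP/eP/lie2_pi_eqP.
  by rewrite lie2_reprK.
have f_lin : linear f.
  move=> b x y; have [u ->] := lie2_pi_surj x; have [v ->] := lie2_pi_surj y.
  by rewrite -lie2_piP !f_pi e_lin.
pose F : {linear L -> V} :=
  HB.pack f (GRing.isLinear.Build R L V *:%R f f_lin).
by exists F => t; rewrite -e_gen -f_pi.
Qed.

End FreeTwoLie.
End TwoLie.

(** * The pairing as a homomorphism of compatible Lie algebras *)

Section TreePairing.
Variables (R : comPzRingType) (n : nat).

(* Unlike the edges of a graph, a rawedge may be a loop. *)
Definition rawedge : Type := (color * 'I_n * 'I_n)%type.
HB.instance Definition _ := Choice.on rawedge.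

Implicit Types (A B C D : {set 'I_n}) (e : rawedge) (E : seq rawedge).

Definition crosses A B e :=
  (e.1.2 \in A) && (e.2 \in B) || (e.1.2 \in B) && (e.2 \in A).
Definition within A e := (e.1.2 \in A) && (e.2 \in A).

Definition esgn (c : color) A e : R :=
  if e.1.1 == c then (if e.1.2 \in A then 1 else - 1) else 0.

Definition only_esgn c A (s : seq rawedge) : R :=
  if s is [:: e] then esgn c A e else 0.

Definition cross_sgn E c A B : R :=
  only_esgn c A [seq e <- E | crosses A B e].

Definition lset (t : tree n) : {set 'I_n} := [set i | i \in leaves t].

(** Recursive form of the pairing: an edge has its nadir at the root exactly when it joins the two
    subtrees, so each internal vertex asks for a single crossing edge of its color, with sign -1 if
    that edge starts on the right. *)
Fixpoint tree_sgn E (t : tree n) : R :=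
  match t with
  | Leaf _ => 1
  | Node c l r =>
      cross_sgn E c (lset l) (lset r) * tree_sgn E l * tree_sgn E r
  end.

Lemma crossesC A B e : crosses A B e = crosses B A e.
Proof. by rewrite /crosses orbC. Qed.

Lemma esgnC c A B e : [disjoint A & B] -> crosses A B e ->
  esgn c B e = - esgn c A e.
Proof.
move=> dAB; rewrite /esgn /crosses; case: (_ == c); last by rewrite oppr0.
case eA: (e.1.2 \in A) => /=; first by rewrite (disjointFr dAB eA).
by move=> /andP[-> _]; rewrite opprK.
Qed.

Lemma cross_sgnC E c A B : [disjoint A & B] ->
  cross_sgn E c B A = - cross_sgn E c A B.
Proof.
move=> dAB; rewrite /cross_sgn (eq_filter (crossesC B A)).
case eqs: (filter _ E) => [|e [|e' s]] /=; rewrite ?oppr0 //.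
apply: esgnC => //; have: e \in [seq e <- E | crosses A B e] by rewrite eqs mem_head.
by rewrite mem_filter => /andP[].
Qed.

Section Triple.
Variables (E : seq rawedge) (B C D : {set 'I_n}).
Hypotheses (dBC : [disjoint B & C]) (dCD : [disjoint C & D]) (dDB : [disjoint D & B]).

Let K c d B C D := cross_sgn E c B (C :|: D) * cross_sgn E d C D.

(** An edge leaving A ends in only one of the two parts, so a single crossing edge leaves one part
    without any. The second filter is written with [crosses A2 A] so that rotating the three sets
    permutes the lists involved. *)
Lemma cross_sgnU c A A1 A2 : [disjoint A & A1] -> [disjoint A1 & A2] ->
    [disjoint A2 & A] ->
  cross_sgn E c A (A1 :|: A2) =
    if [seq e <- E | crosses A A1 e] is [::] then cross_sgn E c A A2 else
    if [seq e <- E | crosses A2 A e] is [::] then cross_sgn E c A A1 else 0.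
Proof.
move=> d1 d2 d3; rewrite /cross_sgn (eq_filter (crossesC A2 A)).
have d1' e : crosses A A1 e -> crosses A A2 e = false.
  rewrite /crosses; case/orP => /andP[x y].
    by rewrite (disjointFr d2 y) (disjointFl d3 x) andbF.
  by rewrite (disjointFr d2 x) (disjointFl d3 y) andbF.
have splitU e : crosses A (A1 :|: A2) e = crosses A A1 e || crosses A A2 e.
  rewrite /crosses !inE.
  by do 6!case: (_ \in _).
rewrite (eq_filter splitU).
have pU : perm_eq [seq e <- E | crosses A A1 e || crosses A A2 e]
    ([seq e <- E | crosses A A1 e] ++ [seq e <- E | crosses A A2 e]).
  apply/permP => p; rewrite count_cat !count_filter -count_predUI.
  rewrite [X in (_ + X)%N](@eq_count _ _ pred0) ?count_pred0 ?addn0.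
    by apply: eq_count => e /=; case: (p e); rewrite //= orbC; case: (crosses A A1 e).
  by move=> e /=; case h: (crosses A A1 e); rewrite ?andbF // d1' // !andbF.
move: pU; case: [seq e <- E | crosses A A1 e] => [|x s].
  move=> pU; rewrite /only_esgn; case: [seq e <- E | crosses A A2 e] pU => [|y [|y' s']].
  - by move/perm_nilP ->.
  - by move/perm_small_eq => ->.
  - by move/perm_size; case: (filter _ E) => [|? [|? ?]].
case: [seq e <- E | crosses A A2 e] => [|y s'].
  rewrite cats0; case: s => [|x' s]; first by move/perm_small_eq => ->.
  by move/perm_size; case: (filter _ E) => [|? [|? ?]].
by move/perm_size; rewrite /= size_cat addnS; case: (filter _ E) => [|? [|? ?]].
Qed.

(** The sum vanishes unless two of the three pairs of parts are joined by a single edge each and the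
    third by none. Then two terms survive; they cut the two edges in opposite orders and have
    opposite signs, whence a 2 by 2 determinant in the colors. With c = d it is 0, which is Jacobi;
    summed over both color orders it cancels, which is compatibility. *)
Lemma cross_sgn_cyc : exists u v : color -> R, forall c d,
  K c d B C D + K c d C D B + K c d D B C = u c * v d - u d * v c.
Proof.
pose q (c : color) A (s t : seq rawedge) :=
  if s is [::] then only_esgn c A t else
  if t is [::] then only_esgn c A s else 0.
suff main x y z : all (crosses B C) x -> all (crosses C D) y ->
    all (crosses D B) z -> exists u v : color -> R, forall c d,
    q c B x z * only_esgn d C y + q c C y x * only_esgn d D z
      + q c D z y * only_esgn d B x = u c * v d - u d * v c.
  have [u [v uvP]] := main _ _ _ (filter_all (crosses B C) E)
    (filter_all (crosses C D) E) (filter_all (crosses D B) E).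
  exists u, v => c d; rewrite -uvP /K.
  rewrite (cross_sgnU _ dBC dCD dDB) (cross_sgnU _ dCD dDB dBC).
  rewrite (cross_sgnU _ dDB dBC dCD) /cross_sgn /q.
  by rewrite (eq_filter (crossesC C B)) (eq_filter (crossesC D C))
    (eq_filter (crossesC B D)).
have zero (a : R) : a = 0 -> a = 0 * 0 - 0 * 0 by rewrite mul0r subrr.
case: x => [|x [|x' xs]]; case: y => [|y [|y' ys]]; case: z => [|z [|z' zs]];
  rewrite /= ?andbT => hx hy hz;
  try by (exists (fun _ => 0), (fun _ => 0) => c d; apply: zero;
    rewrite ?(mul0r, mulr0, addr0, add0r)).
- exists (fun c => esgn c B z), (fun c => esgn c C y) => c d.
  rewrite -[esgn d D z]opprK -(esgnC d dDB hz) ?(mul0r, addr0, add0r).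
  by rewrite mulrN [esgn c C y * _]mulrC.
- exists (fun c => esgn c D z), (fun c => esgn c B x) => c d.
  by rewrite (esgnC c dBC hx) ?(mul0r, addr0, add0r) addrC mulNr [esgn c B x * _]mulrC.
- exists (fun c => esgn c B x), (fun c => esgn c C y) => c d.
  by rewrite (esgnC c dCD hy) ?(mul0r, addr0, add0r) mulNr [esgn c C y * _]mulrC.
Qed.

End Triple.
Section GraphAlgebra.
Variable E : seq rawedge.
Local Notation V := {ffun {set 'I_n} -> R^o}.

(* The functions on vertex sets that dualize the cobracket "cut an edge". *)
Definition cut_brk (c : color) (f g : V) : V :=
  [ffun A : {set 'I_n} => (\sum_(B : {set 'I_n} | B \subset A)
     cross_sgn E c B (A :\: B) * f B * g (A :\: B) : R^o)].

(** Ordered partitions of A into three possibly empty parts, in the asymmetric form that two nested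
    cuts produce. *)
Let P A B C D := [&& B \subset A, C \subset A :\: B & D == A :\: B :\: C].

Lemma split3P A B C D : P A B C D ->
  [/\ [disjoint B & C], [disjoint C & D], [disjoint D & B] & A :\: B = C :|: D].
Proof.
case/and3P => BA CAB /eqP ->; split.
- by rewrite disjoint_sym disjoints_subset (subset_trans CAB) // subsetDr.
- by rewrite disjoint_sym disjoints_subset subsetDr.
- by rewrite disjoints_subset (subset_trans (subsetDl _ _)) // subsetDr.
- by apply/setP => x; rewrite !inE; move/subsetP/(_ x): CAB; rewrite !inE;
    case: (x \in C) => //= ->.
Qed.

Lemma split3_rot A B C D : P A B C D = P A C D B.
Proof.
suff imp X Y Z : P A X Y Z -> P A Y Z X.
  by apply/idP/idP => [/imp|/imp/imp].
case/and3P => /subsetP XA /subsetP YAX /eqP ->; apply/and3P; split.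
- by apply/subsetP => x /YAX; rewrite inE => /andP[].
- apply/subsetP => x; rewrite !inE; case/and3P => -> _ ->; exact: isT.
- apply/eqP/setP => x; rewrite !inE.
  have := XA x; have := YAX x; rewrite !inE.
  case: (x \in X) (x \in Y) (x \in A) => [] [] [] //= h1 h2.
  - by have := h1 isT.
  - by have := h1 isT.
  by have := h2 isT.
Qed.

Let sum3 A (F : {set 'I_n} -> {set 'I_n} -> {set 'I_n} -> R) :=
  \sum_B \sum_C \sum_(D | P A B C D) F B C D.

Lemma sum3_rot A F : sum3 A (fun B C D => F C D B) = sum3 A F.
Proof.
rewrite /sum3 exchange_big; apply: eq_bigr => C _ /=.
rewrite (exchange_big_dep predT) //=; apply: eq_bigr => D _.
by apply: eq_bigl => B; rewrite split3_rot.
Qed.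

Lemma cut_brk2 c d f g h A : cut_brk c f (cut_brk d g h) A =
  sum3 A (fun B C D => cross_sgn E c B (C :|: D) * cross_sgn E d C D
                       * (f B * g C * h D)).
Proof.
rewrite ffunE /sum3 big_mkcond; apply: eq_bigr => B _.
case: ifP => BA; last first.
  by rewrite big1 // => C _; rewrite big_pred0 // => D; rewrite /P BA.
rewrite ffunE mulr_sumr big_mkcond; apply: eq_bigr => C _.
case: ifP => CA; last by rewrite big_pred0 // => D; rewrite /P CA andbF.
rewrite (big_pred1 (A :\: B :\: C)) => [|D]; last by rewrite /P BA CA.
have /split3P[_ _ _ <-] : P A B C (A :\: B :\: C) by rewrite /P BA CA /=.
rewrite -!mulrA; congr (_ * _).
by rewrite mulrCA; congr (_ * _); rewrite mulrCA.
Qed.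

Lemma cut_brk_cyc c d f g h A :
  cut_brk c f (cut_brk d g h) A + cut_brk c g (cut_brk d h f) A
    + cut_brk c h (cut_brk d f g) A =
  sum3 A (fun B C D =>
    (cross_sgn E c B (C :|: D) * cross_sgn E d C D
     + cross_sgn E c C (D :|: B) * cross_sgn E d D B
     + cross_sgn E c D (B :|: C) * cross_sgn E d B C) * (f B * g C * h D)).
Proof.
(* The second sum is rotated once and the third twice, so that f, g, h are evaluated at B, C, D in
   all three. *)
rewrite !cut_brk2 -(sum3_rot A (fun B C D => _ * (g B * h C * f D))).
rewrite -(sum3_rot A (fun B C D => _ * (h B * f C * g D))).
rewrite -(sum3_rot A (fun B C D => _ * (h C * f D * g B))).
rewrite /sum3 -!big_split; apply: eq_bigr => B _.
rewrite -!big_split; apply: eq_bigr => C _.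
rewrite -!big_split; apply: eq_bigr => D _ /=.
rewrite !mulrDl; congr (_ + _ * _ + _ * _).
- by rewrite mulrC mulrA.
- by rewrite -mulrA mulrC.
Qed.

Lemma ffunDE (f g : V) A : (f + g) A = f A + g A.
Proof. by rewrite ffunE. Qed.

Fact cut_brk_linl c g : linear (fun f => cut_brk c f g).
Proof.
move=> a f f'; apply/ffunP => A; rewrite !ffunE scaler_sumr -big_split.
apply: eq_bigr => B _; rewrite !ffunE /= mulrDr mulrDl; congr (_ + _).
by rewrite /GRing.scale /= mulrCA !mulrA.
Qed.

Fact cut_brk_linr c f : linear (cut_brk c f).
Proof.
move=> a g g'; apply/ffunP => A; rewrite !ffunE scaler_sumr -big_split.
apply: eq_bigr => B _; rewrite !ffunE /= mulrDr; congr (_ + _).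
by rewrite /GRing.scale /= mulrCA.
Qed.

Fact cut_brk_anti c f g : cut_brk c f g + cut_brk c g f = 0.
Proof.
apply/ffunP => A; rewrite !ffunE.
have AK B : B \subset A -> A :\: (A :\: B) = B.
  by move=> BA; rewrite setDDr setDv set0U; apply/setIidPr.
rewrite [X in _ + X](reindex_onto (setD A) (setD A)) => [|B] /=; last exact: AK.
rewrite [X in _ + X](eq_bigl (fun B => B \subset A)) => [|B]; last first.
  apply/andP/idP => [[_ /eqP <-]|BA]; first exact: subsetDl.
  by rewrite subsetDl AK.
rewrite -big_split big1 //= => B BA; rewrite AK // cross_sgnC; last first.
  by rewrite disjoints_subset subsetDr.
by rewrite !mulNr mulrAC addNr.
Qed.

Fact cut_brk_jacobi c f g h :
  cut_brk c f (cut_brk c g h) + cut_brk c g (cut_brk c h f)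
    + cut_brk c h (cut_brk c f g) = 0.
Proof.
apply/ffunP => A; rewrite !ffunDE cut_brk_cyc [RHS]ffunE.
rewrite /sum3 big1 // => B _; rewrite big1 // => C _; rewrite big1 // => D.
case/split3P => dBC dCD dDB _.
by have [u [v ->]] := cross_sgn_cyc E dBC dCD dDB; rewrite subrr mul0r.
Qed.

Fact cut_brk_compat f g h :
  cut_brk red f (cut_brk blue g h) + cut_brk red g (cut_brk blue h f)
    + cut_brk red h (cut_brk blue f g)
  + (cut_brk blue f (cut_brk red g h) + cut_brk blue g (cut_brk red h f)
    + cut_brk blue h (cut_brk red f g)) = 0.
Proof.
apply/ffunP => A; rewrite !ffunDE !cut_brk_cyc [RHS]ffunE.
rewrite /sum3 -big_split big1 //= => B _.
rewrite -big_split big1 //= => C _; rewrite -big_split big1 //= => D.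
case/split3P => dBC dCD dDB _.
have [u [v uv]] := cross_sgn_cyc E dBC dCD dDB.
by rewrite -mulrDl !uv -opprB addNr mul0r.
Qed.

Definition cut_two_lie : two_lie V :=
  TwoLie cut_brk_linl cut_brk_linr cut_brk_anti cut_brk_jacobi cut_brk_compat.

Definition cut_leaf (i : 'I_n) : V := [ffun A => (A == [set i])%:R].

Lemma lset_node c l r : lset (Node c l r) = lset l :|: lset r.
Proof. by apply/setP => i; rewrite !inE mem_cat. Qed.

Lemma uniq_disjoint c l r : uniq (leaves (Node c l r)) ->
  [/\ uniq (leaves l), uniq (leaves r) & [disjoint lset l & lset r]].
Proof.
rewrite /= cat_uniq => /and3P[-> /hasPn lr ->]; split=> //.
rewrite disjoint_sym; apply/pred0Pn => [[i]] /andP[]; rewrite /= !inE => /lr.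
by move/negP.
Qed.

(** The values of the two subtrees are concentrated at their own label sets, so at most one
    splitting of A contributes; with a repeated leaf these sets are not complementary and none
    does. *)
Lemma cut_eval t A : tree_eval cut_two_lie cut_leaf t A =
  if uniq (leaves t) && (A == lset t) then tree_sgn E t else 0.
Proof.
elim: t A => [i|c l ihl r ihr] A.
  rewrite ffunE /=; have -> : lset (Leaf i) = [set i].
    by apply/setP => j; rewrite !inE.
  by case: eqP.
rewrite [LHS]ffunE; under eq_bigr => B _ do rewrite ihl ihr.
case: ifP => [/andP[/uniq_disjoint[ul ur d] /eqP ->]|].
  have AB : lset (Node c l r) :\: lset l = lset r.
    rewrite lset_node setDUl setDv set0U; apply/setDidPl.
    by rewrite disjoint_sym.
  rewrite (bigD1 (lset l)) /= ?lset_node ?subsetUl // -(lset_node c) AB.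
  rewrite ul ur !eqxx /= big1 ?addr0 // => B /andP[_ /negPf ->].
  by rewrite ?andbF /= mulr0 mul0r.
move=> bad; rewrite big1 // => B BA; case: ifP => [/andP[ul /eqP eB]|]; last first.
  by rewrite mulr0 mul0r.
case: ifP => [/andP[ur /eqP eC]|]; last by rewrite mulr0.
case/negP: (negbT bad); rewrite /= cat_uniq ul ur andbT /=.
rewrite lset_node -eB -eC; apply/andP; split.
  apply/hasPn => i ir; apply/negP => il.
  have: i \in A :\: B by rewrite eC inE.
  by rewrite eB !inE il.
by apply/eqP; rewrite -{1}(setID A B) (setIidPr BA).
Qed.

End GraphAlgebra.

End TreePairing.

(** * The support of the pairing *)

Section Compatible.
Variable n : nat.
Implicit Types (A B C : {set 'I_n}) (e : rawedge n) (E : seq (rawedge n)).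

Definition cross_one E (c : color) A B : bool :=
  if [seq e <- E | crosses A B e] is [:: e] then e.1.1 == c else false.

(** Ring-independent support of [tree_sgn]. The triangularity argument runs on this boolean, so it
    is not disturbed when 1 = 0 in R. *)
Fixpoint compat E (t : tree n) : bool :=
  match t with
  | Leaf _ => true
  | Node c l r => [&& cross_one E c (lset l) (lset r), compat E l & compat E r]
  end.

Lemma crosses_within A B C e : A \subset C -> B \subset C ->
  crosses A B e -> within C e.
Proof.
move=> /subsetP AC /subsetP BC; rewrite /crosses /within.
by case/orP => /andP[] => [/AC -> /BC ->|/BC -> /AC ->].
Qed.

Lemma filter_crosses A B C E : A \subset C -> B \subset C ->
  [seq e <- E | crosses A B e] = [seq e <- [seq e <- E | within C e] | crosses A B e].
Proof.
move=> AC BC; rewrite -filter_predI; apply: eq_filter => e /=.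
by case h: (crosses A B e); rewrite // (crosses_within AC BC h).
Qed.

Lemma cross_one_perm E E' c A B C : A \subset C -> B \subset C ->
    perm_eq [seq e <- E | within C e] [seq e <- E' | within C e] ->
  cross_one E c A B = cross_one E' c A B.
Proof.
move=> AC BC /(perm_filter (crosses A B)).
rewrite -!(filter_crosses _ AC BC) /cross_one.
case: [seq e <- E' | _] => [|y [|y' s]].
- by move/perm_nilP => ->.
- by move/perm_small_eq => ->.
- by move/perm_size; case: (filter _ E) => [|? [|? ?]].
Qed.

Lemma subset_nodel c (l r : tree n) : lset l \subset lset (Node c l r).
Proof. by rewrite lset_node subsetUl. Qed.

Lemma subset_noder c (l r : tree n) : lset r \subset lset (Node c l r).
Proof. by rewrite lset_node subsetUr. Qed.

Lemma perm_within A B E E' : A \subset B ->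
    perm_eq [seq e <- E | within B e] [seq e <- E' | within B e] ->
  perm_eq [seq e <- E | within A e] [seq e <- E' | within A e].
Proof.
move=> /subsetP AB /(perm_filter (within A)); rewrite -!filter_predI.
rewrite -!(@eq_filter _ (within A) (predI (within A) (within B))) // => e;
  by rewrite /= /within; case: andP => //= -[/AB -> /AB ->].
Qed.

(** Every crossing edge at a vertex of t has both ends among the leaves of t. This lets the graph of
    a composite rooted tree be replaced by that of one part. *)
Lemma compat_perm E E' t :
    perm_eq [seq e <- E | within (lset t) e] [seq e <- E' | within (lset t) e] ->
  compat E t = compat E' t.
Proof.
elim: t => //= c l ihl r ihr EE'.
rewrite (cross_one_perm c (subset_nodel c l r) (subset_noder c l r) EE').
by rewrite ihl ?ihr // (perm_within _ EE') ?subset_nodel ?subset_noder.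
Qed.

Lemma cross_oneP E c A B : cross_one E c A B ->
  exists2 e, e \in E & crosses A B e /\ e.1.1 = c.
Proof.
rewrite /cross_one; case eqs: [seq e <- E | _] => [|e [|e' s]] // /eqP ec.
have: e \in [seq e <- E | crosses A B e] by rewrite eqs mem_head.
by rewrite mem_filter => /andP[? ?]; exists e.
Qed.

(** The crossing edges, one for each internal vertex, connect all leaves of t. A predicate in place
    of a connectivity relation serves both uses: S as a component of the whole graph, and S as the
    label set of one part of a rooted tree. *)
Lemma compat_closed E t (S : pred 'I_n) : compat E t ->
    (forall e, e \in E -> within (lset t) e -> S e.1.2 = S e.2) ->
  {in lset t &, forall i j, S i = S j}.
Proof.
elim: t => [k|c l ihl r ihr] /=.
  by move=> _ _ i j; rewrite !inE => /eqP-> /eqP->.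
case/and3P => /cross_oneP[e eE [ecr _]] /ihl{}ihl /ihr{}ihr cl.
have subw A : A \subset lset (Node c l r) -> forall e, e \in E ->
    within A e -> S e.1.2 = S e.2.
  move=> /subsetP AC f fE /andP[f1 f2]; apply: cl => //.
  by rewrite /within !AC.
have {}ihl := ihl (subw _ (subset_nodel c l r)).
have {}ihr := ihr (subw _ (subset_noder c l r)).
have lr i j : i \in lset l -> j \in lset r -> S i = S j.
  move=> il jr; have Se : S e.1.2 = S e.2.
    apply: cl => //.
    exact: crosses_within (subset_nodel c l r) (subset_noder c l r) ecr.
  case/orP: ecr => /andP[e1 e2].
    by rewrite (ihl _ _ il e1) Se (ihr _ _ e2 jr).
  by rewrite (ihl _ _ il e2) -Se (ihr _ _ e1 jr).
move=> i j; rewrite lset_node !in_setU => /orP[il|ir] /orP[jl|jr].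
- exact: ihl.
- exact: lr.
- by symmetry; apply: lr.
- exact: ihr.
Qed.

Section Values.
Variable R : comPzRingType.

Lemma cross_sgn_one E c A B : cross_one E c A B = false -> cross_sgn R E c A B = 0.
Proof.
rewrite /cross_one /cross_sgn; case: [seq e <- E | _] => [|x [|y s]] //=.
by rewrite /esgn => ->.
Qed.

Lemma cross_sgn_unit E c A B : cross_one E c A B ->
  cross_sgn R E c A B = 1 \/ cross_sgn R E c A B = -1.
Proof.
rewrite /cross_one /cross_sgn; case: [seq e <- E | _] => [|x [|y s]] //=.
by rewrite /esgn => ->; case: ifP; [left | right].
Qed.

Lemma tree_sgn_compat0 E t : compat E t = false -> tree_sgn R E t = 0.
Proof.
elim: t => //= c l ihl r ihr.
case: (cross_one _ _ _ _) (@cross_sgn_one E c (lset l) (lset r)) => /= [_|-> //].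
  case: (compat E l) ihl => /= [_ /ihr ->|-> //]; first by rewrite mulr0.
  by rewrite mulr0 mul0r.
by rewrite !mul0r.
Qed.

Lemma tree_sgn_unit E t : compat E t -> tree_sgn R E t = 1 \/ tree_sgn R E t = -1.
Proof.
elim: t => [|c l ihl r ihr] /=; first by left.
case/and3P => /cross_sgn_unit[] -> /ihl[] -> /ihr[] ->;
  by rewrite ?(mulr1, mul1r, mulrN1, mulN1r, opprK); (by left) || (by right).
Qed.

Lemma cross_sgn_perm E E' c A B C : A \subset C -> B \subset C ->
    perm_eq [seq e <- E | within C e] [seq e <- E' | within C e] ->
  cross_sgn R E c A B = cross_sgn R E' c A B.
Proof.
move=> AC BC /(perm_filter (crosses A B)).
rewrite -!(filter_crosses _ AC BC) /cross_sgn.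
case: [seq e <- E' | _] => [|y [|y' s]].
- by move/perm_nilP => ->.
- by move/perm_small_eq => ->.
- by move/perm_size; case: (filter _ E) => [|? [|? ?]].
Qed.

Lemma tree_sgn_perm E E' t :
    perm_eq [seq e <- E | within (lset t) e] [seq e <- E' | within (lset t) e] ->
  tree_sgn R E t = tree_sgn R E' t.
Proof.
elim: t => //= c l ihl r ihr EE'.
rewrite (cross_sgn_perm c (subset_nodel c l r) (subset_noder c l r) EE').
by rewrite ihl ?ihr // (perm_within _ EE') ?subset_nodel ?subset_noder.
Qed.

Lemma perm_tree_sgn E E' t : perm_eq E E' -> tree_sgn R E t = tree_sgn R E' t.
Proof. by move=> EE'; apply/tree_sgn_perm/perm_filter. Qed.

Lemma tree_sgn_cons e E t : ~~ within (lset t) e ->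
  tree_sgn R (e :: E) t = tree_sgn R E t.
Proof. by move=> /negPf we; apply: tree_sgn_perm; rewrite /= we. Qed.

Lemma cross_sgn_cons e E c A B : ~~ crosses A B e ->
  cross_sgn R (e :: E) c A B = cross_sgn R E c A B.
Proof. by move=> /negPf we; rewrite /cross_sgn /= we. Qed.

End Values.
End Compatible.

(** * The graph relations annihilate trees *)

Section Relations.
Variables (R : comPzRingType) (n : nat).
Implicit Types (A B C : {set 'I_n}) (e f : rawedge n) (E : seq (rawedge n)).
Implicit Types (t l r : tree n) (i j k : 'I_n) (c d : color).
Local Notation sg := (tree_sgn R).

Lemma within_ncrosses A B e : [disjoint A & B] -> within A e -> ~~ crosses A B e.
Proof.
move=> AB /andP[e1 e2]; rewrite /crosses (disjointFr AB e1) (disjointFr AB e2).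
by rewrite !andbF.
Qed.

Lemma crosses_nwithin A B e : [disjoint A & B] -> crosses A B e -> ~~ within A e.
Proof. by move=> AB; apply: contraL; apply: within_ncrosses. Qed.

Lemma within_disjoint A B e : [disjoint A & B] -> within A e -> ~~ within B e.
Proof. by move=> AB /andP[e1 e2]; rewrite /within (disjointFr AB e1). Qed.

Lemma tree_sgn_skip e f E t : ~~ within (lset t) f ->
  sg (e :: f :: E) t = sg (e :: E) t.
Proof. by move=> /negPf wf; apply: tree_sgn_perm; rewrite /= wf. Qed.

Lemma tree_sgnC E c l r : uniq (leaves (Node c l r)) ->
  sg E (Node c r l) = - sg E (Node c l r).
Proof.
case/uniq_disjoint => _ _ d; rewrite /= cross_sgnC //.
by rewrite !mulNr mulrAC.
Qed.

Lemma uniq_nodeC c l r : uniq (leaves (Node c l r)) = uniq (leaves (Node c r l)).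
Proof. by rewrite /= uniq_catC. Qed.

Lemma cross_sgn_head e E c A B : crosses A B e -> cross_sgn R (e :: E) c A B =
  if [seq e <- E | crosses A B e] is [::] then esgn R c A e else 0.
Proof. by rewrite /cross_sgn /= => ->; case: (filter _ E). Qed.

Section Node.
Variables (c : color) (l r : tree n).
Hypothesis uT : uniq (leaves (Node c l r)).

Let dlr : [disjoint lset l & lset r]. Proof. by case: (uniq_disjoint uT). Qed.
Let drl : [disjoint lset r & lset l]. Proof. by rewrite disjoint_sym. Qed.

Lemma tree_sgn_within e E : within (lset l) e -> sg (e :: E) (Node c l r) =
  cross_sgn R E c (lset l) (lset r) * sg (e :: E) l * sg E r.
Proof.
move=> we; rewrite /= cross_sgn_cons ?within_ncrosses //.
by rewrite [sg _ r]tree_sgn_cons // (within_disjoint dlr).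
Qed.

Lemma tree_sgn_cross e E : crosses (lset l) (lset r) e ->
  sg (e :: E) (Node c l r) =
  (if [seq e <- E | crosses (lset l) (lset r) e] is [::]
   then esgn R c (lset l) e else 0) * sg E l * sg E r.
Proof.
move=> ce; rewrite /= cross_sgn_head // !tree_sgn_cons //.
  by rewrite (crosses_nwithin drl) // crossesC.
exact: crosses_nwithin ce.
Qed.

End Node.

Lemma tree_sgn_flip E t c i j : uniq (leaves t) -> i != j ->
    i \in lset t -> j \in lset t ->
  sg ((c, i, j) :: E) t = - sg ((c, j, i) :: E) t.
Proof.
elim: t => [k|c0 l ihl r ihr] ut ij.
  by rewrite !inE => /eqP ei /eqP ej; rewrite ei ej eqxx in ij.
have [ul ur dlr] := uniq_disjoint ut.
have ut' : uniq (leaves (Node c0 r l)) by rewrite uniq_nodeC.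
have cross l' r' : uniq (leaves (Node c0 l' r')) -> i \in lset l' ->
    j \in lset r' ->
    sg ((c, i, j) :: E) (Node c0 l' r') = - sg ((c, j, i) :: E) (Node c0 l' r').
  move=> u il jr; have [_ _ d] := uniq_disjoint u.
  rewrite !tree_sgn_cross /crosses /= ?il ?jr ?orbT //.
  case: (filter _ E) => [|? ?]; last by rewrite !mul0r oppr0.
  rewrite /esgn /= il (disjointFl d jr).
  by case: eqP; rewrite ?(mul1r, mulN1r, mulNr, opprK, mul0r, oppr0).
rewrite lset_node !in_setU => /orP[il|ir] /orP[jl|jr].
- by rewrite !tree_sgn_within ?/within /= ?il ?jl // ihl // mulrN mulNr.
- exact: cross.
- by rewrite !(tree_sgnC _ ut') (cross _ _ ut').
- rewrite !(tree_sgnC _ ut') !tree_sgn_within ?/within /= ?ir ?jr // ihr //.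
  by rewrite mulrN mulNr.
Qed.

Definition cyc_sgn E t i j k c d : R :=
  sg ((c, i, j) :: (d, j, k) :: E) t + sg ((c, j, k) :: (d, k, i) :: E) t
  + sg ((c, k, i) :: (d, i, j) :: E) t.

(* One witness X yields both the one-color relation (d = c) and, after
   symmetrizing in c and d, the two-color relation. *)
Definition cyc_antisym E t i j k : Prop :=
  exists X : color -> color -> R, forall c d, cyc_sgn E t i j k c d = X c d - X d c.

Lemma cyc_antisym_rot E t i j k :
  cyc_antisym E t i j k -> cyc_antisym E t j k i.
Proof.
case=> X XP; exists X => c d; rewrite -XP /cyc_sgn.
by rewrite [LHS]addrC addrA.
Qed.

Lemma cyc_antisymC E c l r i j k : uniq (leaves (Node c l r)) ->
  cyc_antisym E (Node c l r) i j k -> cyc_antisym E (Node c r l) i j k.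
Proof.
move=> ut [X XP]; exists (fun c d => - X c d) => c' d.
by rewrite /cyc_sgn !(tree_sgnC _ ut) -!opprD -XP.
Qed.

(** The middle term has two crossing edges and vanishes. In the other two the edge ij counts inside
    l, while the crossing edge leaves l at j in one and enters it at i in the other: they are
    opposite after exchanging the colors. *)
Lemma cyc_antisym_split E c0 l r i j k : uniq (leaves (Node c0 l r)) ->
    i \in lset l -> j \in lset l -> k \in lset r ->
  cyc_antisym E (Node c0 l r) i j k.
Proof.
move=> ut il jl kr; have [_ _ d] := uniq_disjoint ut.
have kl := disjointFl d kr; have ir := disjointFr d il.
exists (fun c d => cross_sgn R ((d, j, k) :: E) c0 (lset l) (lset r)
  * sg ((c, i, j) :: E) l * sg E r) => c d'.
have wij b : within (lset l) (b, i, j) by rewrite /within /= il jl.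
have xjk b : crosses (lset l) (lset r) (b, j, k) by rewrite /crosses /= jl kr.
have xki b : crosses (lset l) (lset r) (b, k, i).
  by rewrite /crosses /= il kr orbT.
have njk b : ~~ within (lset l) (b, j, k) by rewrite /within /= kl andbF.
have nki b : ~~ within (lset l) (b, k, i) by rewrite /within /= kl.
have njkr b : ~~ within (lset r) (b, j, k) by rewrite /within /= (disjointFr d jl).
have nkir b : ~~ within (lset r) (b, k, i) by rewrite /within /= ir andbF.
have nij b : ~~ crosses (lset l) (lset r) (b, i, j).
  exact: within_ncrosses d (wij b).
have r3 : sg ((c, k, i) :: (d', i, j) :: E) (Node c0 l r) =
    sg ((d', i, j) :: (c, k, i) :: E) (Node c0 l r).
  by apply: perm_tree_sgn; apply/permP => p /=; rewrite addnCA.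
rewrite /cyc_sgn r3 !(tree_sgn_within ut _ (wij _)) (tree_sgn_cross ut _ (xjk c)) //=.
rewrite xki !mul0r addr0 (tree_sgn_skip _ _ (njk _)) (tree_sgn_skip _ _ (nki _)).
rewrite (tree_sgn_cons _ _ (njkr _)) (tree_sgn_cons _ _ (nkir _)).
congr (_ + _); rewrite -!mulNr; congr (_ * _ * _).
rewrite !cross_sgn_head //; case: (filter _ E) => [|? ?]; last by rewrite oppr0.
rewrite /esgn /= kl jl; case: eqP; rewrite ?oppr0 //.
Qed.

Lemma cyc_antisymP E t i j k : uniq (leaves t) ->
    i \in lset t -> j \in lset t -> k \in lset t ->
    i != j -> j != k -> k != i -> cyc_antisym E t i j k.
Proof.
elim: t E => [x|c l ihl r ihr] E ut.
  by rewrite !inE => /eqP-> /eqP-> _; rewrite eqxx.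
have [ul ur dlr] := uniq_disjoint ut.
have ut' : uniq (leaves (Node c r l)) by rewrite uniq_nodeC.
have inl l' r' : uniq (leaves (Node c l' r')) -> i \in lset l' ->
    j \in lset l' -> k \in lset l' -> cyc_antisym E l' i j k ->
    cyc_antisym E (Node c l' r') i j k.
  move=> u il jl kl [X XP].
  exists (fun b b' => cross_sgn R E c (lset l') (lset r') * X b b' * sg E r').
  move=> b b'; have [_ _ d] := uniq_disjoint u.
  have w x y b0 : x \in lset l' -> y \in lset l' -> within (lset l') (b0, x, y).
    by move=> xl yl; rewrite /within /= xl yl.
  have nr x y b0 : x \in lset l' -> ~~ within (lset r') (b0, x, y).
    by move=> xl; rewrite /within /= (disjointFr d xl).
  rewrite /cyc_sgn !tree_sgn_within ?w // !cross_sgn_cons ?within_ncrosses ?w //.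
  rewrite !(tree_sgn_cons _ _ (nr i _ _ il)) !(tree_sgn_cons _ _ (nr j _ _ jl)).
  rewrite !(tree_sgn_cons _ _ (nr k _ _ kl)).
  by rewrite -!mulrDl -!mulrDr -mulrBl -mulrBr -XP.
(* If all three labels lie on one side, induction applies; the six mixed distributions reduce to
   [cyc_antisym_split] by rotating the labels and exchanging the children. *)
rewrite lset_node !in_setU => /orP[i1|i1] /orP[j1|j1] /orP[k1|k1] ij jk ki.
- by apply: inl => //; apply: ihl.
- exact: cyc_antisym_split.
- by apply: cyc_antisym_rot; apply: cyc_antisym_split.
- apply: cyc_antisymC => //; do 2!apply: cyc_antisym_rot.
  exact: cyc_antisym_split.
- by do 2!apply: cyc_antisym_rot; apply: cyc_antisym_split.
- by apply: cyc_antisymC => //; apply: cyc_antisym_rot; apply: cyc_antisym_split.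
- by apply: cyc_antisymC => //; apply: cyc_antisym_split.
- by apply: cyc_antisymC => //; apply: inl => //; apply: ihr.
Qed.

End Relations.

(** * Comparison with the pairing by nadirs *)

Section RawGraphs.
Variable n : nat.
Implicit Types (G H : graph n) (e f : edge n) (t l r : tree n) (v w : vertex).
Implicit Types (i j k : 'I_n) (c d : color).

Definition raw e : rawedge n := (ecolor e, src e, tgt e).
Definition raw_edges G : seq (rawedge n) := [seq raw e | e <- edges G].

Lemma raw_inj : injective raw.
Proof.
case=> c [[i j] ij] [d [[k l] kl]]; rewrite /raw /ecolor /src /tgt /= => -[-> ik jl].
by congr (_, _); apply: val_inj; rewrite /= ik jl.
Qed.

Lemma raw_arrow c i j (ij : i != j) : raw (arrow c ij) = (c, i, j).
Proof. by []. Qed.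

Lemma edge_loopless e : src e != tgt e.
Proof. exact: (valP e.2). Qed.

Lemma count_edges G e : count_mem e (edges G) = G e.
Proof.
rewrite /edges count_flatten -map_comp.
have: uniq (enum (edge n)) by apply: enum_uniq.
have: e \in enum (edge n) by rewrite mem_enum.
elim: (enum _) => //= f s ih; rewrite inE count_nseq /= => /orP[/eqP <-|es].
  move=> /andP[ns _]; rewrite eqxx mul1n -[RHS]addn0; congr (_ + _)%N.
  elim: s ns {ih} => //= g s ih; rewrite inE negb_or => /andP[eg /ih ->].
  by rewrite count_nseq /= eq_sym (negPf eg).
move=> /andP[fs us]; rewrite ih // [f == e](_ : _ = false) //.
by apply/negbTE; apply: contraNneq fs => ->.
Qed.

Lemma perm_edges G (s : seq (edge n)) :
  (forall e, G e = count_mem e s) -> perm_eq (edges G) s.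
Proof.
move=> Gs; apply/allP => e _ /=; rewrite count_edges Gs; exact: eqxx.
Qed.

Lemma perm_add_edge H e : perm_eq (edges (add_edge H e)) (e :: edges H).
Proof.
by apply: perm_edges => f; rewrite ffunE /= count_edges addnC eq_sym.
Qed.

Lemma perm_raw_add H e : perm_eq (raw_edges (add_edge H e)) (raw e :: raw_edges H).
Proof. exact: (perm_map raw (perm_add_edge H e)). Qed.

(** The first turn separates the root from the vertices on the left and on the right, so counting
    with a predicate on that turn splits bijectivity of $\beta$ into the three conditions of the
    recursive form. *)
Lemma perm_vertices m (a b a' b' : seq vertex) :
  perm_eq (nseq m [::] ++ map (cons false) a ++ map (cons true) b)
          ([::] :: map (cons false) a' ++ map (cons true) b')
  = [&& m == 1%N, perm_eq a a' & perm_eq b b'].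
Proof.
apply/idP/and3P => [/permP h|[/eqP -> aa bb]]; last first.
  by rewrite perm_cons perm_cat // perm_map.
split.
- have := h (pred1 [::]); rewrite !count_cat /= !count_cat !count_map count_nseq.
  rewrite mul1n !(@eq_count _ _ pred0) //.
  by rewrite !count_pred0 !addn0 => ->.
- apply/permP => p; have := h (fun v => if v is false :: w then p w else false).
  rewrite !count_cat /= !count_cat !count_map count_nseq mul0n add0n.
  by rewrite ![count (preim (cons true) _) _](@eq_count _ _ pred0) // !count_pred0 !addn0.
- apply/permP => p; have := h (fun v => if v is true :: w then p w else false).
  rewrite !count_cat /= !count_cat !count_map count_nseq mul0n add0n.
  by rewrite ![count (preim (cons false) _) _](@eq_count _ _ pred0) // !count_pred0 !add0n.
Qed.

(** The induction passes to subtrees, which carry only part of the labels and so are not of type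
    [mltree]; the ingredients of the pairing are restated for them. *)
Definition nadirs t (s : seq (edge n)) := [seq nadir t (src e) (tgt e) | e <- s].
Definition colored t (s : seq (edge n)) :=
  all (fun e => vcolor t (nadir t (src e) (tgt e)) == Some (ecolor e)) s.
Definition reversed_in t e : bool :=
  let v := nadir t (src e) (tgt e) in
  prefix (rcons v true) (leaf_vertex t (src e))
  && prefix (rcons v false) (leaf_vertex t (tgt e)).

Section NodeNadir.
Variables (c : color) (l r : tree n) (e : edge n).
Hypothesis uT : uniq (leaves (Node c l r)).
Let dlr : [disjoint lset l & lset r]. Proof. by case: (uniq_disjoint uT). Qed.

Lemma leaf_vertexl i : i \in lset l ->
  leaf_vertex (Node c l r) i = false :: leaf_vertex l i.
Proof. by rewrite inE /= => ->. Qed.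

Lemma leaf_vertexr i : i \in lset r ->
  leaf_vertex (Node c l r) i = true :: leaf_vertex r i.
Proof. by move=> ir /=; have := disjointFl dlr ir; rewrite inE => ->. Qed.

Lemma nadir_l : within (lset l) (raw e) ->
  nadir (Node c l r) (src e) (tgt e) = false :: nadir l (src e) (tgt e).
Proof. by case/andP=> e1 e2; rewrite /nadir !leaf_vertexl. Qed.

Lemma nadir_r : within (lset r) (raw e) ->
  nadir (Node c l r) (src e) (tgt e) = true :: nadir r (src e) (tgt e).
Proof. by case/andP=> e1 e2; rewrite /nadir !leaf_vertexr. Qed.

Lemma nadir_cross : crosses (lset l) (lset r) (raw e) ->
  nadir (Node c l r) (src e) (tgt e) = [::].
Proof.
case/orP=> /andP[e1 e2]; rewrite /nadir.
  by rewrite (leaf_vertexl e1) (leaf_vertexr e2).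
by rewrite (leaf_vertexr e1) (leaf_vertexl e2).
Qed.

Lemma reversed_l : within (lset l) (raw e) ->
  reversed_in (Node c l r) e = reversed_in l e.
Proof.
move=> we; rewrite /reversed_in nadir_l //; case/andP: we => e1 e2.
by rewrite !leaf_vertexl.
Qed.

Lemma reversed_r : within (lset r) (raw e) ->
  reversed_in (Node c l r) e = reversed_in r e.
Proof.
move=> we; rewrite /reversed_in nadir_r //; case/andP: we => e1 e2.
by rewrite !leaf_vertexr.
Qed.

Lemma reversed_cross : crosses (lset l) (lset r) (raw e) ->
  reversed_in (Node c l r) e = (src e \notin lset l).
Proof.
move=> ce; rewrite /reversed_in nadir_cross //.
case/orP: ce => /andP[e1 e2]; rewrite -[src e \notin _]/((raw e).1.2 \notin _).
  by rewrite e1 (leaf_vertexl e1) (leaf_vertexr e2).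
by rewrite (disjointFl dlr e1) (leaf_vertexr e1) (leaf_vertexl e2) /= !prefix0s.
Qed.

End NodeNadir.

Lemma filter_node c l r (s : seq (edge n)) : uniq (leaves (Node c l r)) ->
    all (fun e => within (lset (Node c l r)) (raw e)) s ->
  perm_eq s ([seq e <- s | crosses (lset l) (lset r) (raw e)]
    ++ [seq e <- s | within (lset l) (raw e)]
    ++ [seq e <- s | within (lset r) (raw e)]).
Proof.
case/uniq_disjoint=> _ _ d; elim: s => //= e s ih /andP[we /ih{}ih].
have h : ((crosses (lset l) (lset r) (raw e) : nat) + within (lset l) (raw e)
    + within (lset r) (raw e) = 1)%N.
  move: we; rewrite /crosses /within lset_node !in_setU.
  case l1: ((raw e).1.2 \in lset l); case l2: ((raw e).2 \in lset l);
    rewrite ?(disjointFr d l1) ?(disjointFr d l2) //=;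
    by move: (src e \in lset r) (tgt e \in lset r) => [] [].
move/permP: ih => ih; apply/permP => p; rewrite /= ih !count_cat.
move: h; case: (crosses _ _ _); case: (within (lset l) _);
  case: (within (lset r) _) => //= _; lia.
Qed.

Lemma filter_map_raw (p : pred (rawedge n)) (s : seq (edge n)) :
  [seq e <- map raw s | p e] = map raw [seq e <- s | p (raw e)].
Proof. by rewrite filter_map. Qed.

Variable R : comPzRingType.

(** The edges of s are sorted into those crossing at the root and those inside either child.
    Bijectivity, colors and the reversal count split accordingly; at the root, bijectivity leaves
    exactly one crossing edge. *)
Lemma nadir_tree_sgn t (s : seq (edge n)) : uniq (leaves t) ->
    all (fun e => within (lset t) (raw e)) s ->
  (if perm_eq (nadirs t s) (internal t) && colored t s
   then (-1) ^+ count (reversed_in t) s else 0) = tree_sgn R (map raw s) t.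
Proof.
elim: t s => [i|c l ihl r ihr] s ut ws.
  case: s ws => [|e s] //= /andP[]; rewrite /within !inE => /andP[/eqP e1 /eqP e2].
  by have := edge_loopless e; rewrite -[src e]/((raw e).1.2) e1 -[tgt e]/(raw e).2 e2 eqxx.
have [ul ur d] := uniq_disjoint ut.
have ps := filter_node ut ws.
set X := [seq e <- s | crosses _ _ _] in ps.
set sl := [seq e <- s | within (lset l) (raw e)] in ps.
set sr := [seq e <- s | within (lset r) (raw e)] in ps.
have wl : all (fun e => within (lset l) (raw e)) sl by apply: filter_all.
have wr : all (fun e => within (lset r) (raw e)) sr by apply: filter_all.
have wX : all (fun e => crosses (lset l) (lset r) (raw e)) X by apply: filter_all.
have nps : perm_eq (nadirs (Node c l r) s) (nseq (size X) [::]
    ++ map (cons false) (nadirs l sl) ++ map (cons true) (nadirs r sr)).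
  rewrite (permPl (perm_map _ ps)) !map_cat -!/(nadirs _ _).
  have -> : nadirs (Node c l r) X = nseq (size X) [::].
    elim: X wX {ps} => //= e X ih /andP[eX /ih ->].
    by rewrite (nadir_cross ut eX).
  have -> : nadirs (Node c l r) sl = map (cons false) (nadirs l sl).
    by rewrite -map_comp; apply/eq_in_map => e /(allP wl) /nadir_l.
  have -> : nadirs (Node c l r) sr = map (cons true) (nadirs r sr) => //.
  by rewrite -map_comp; apply/eq_in_map => e /(allP wr) /(nadir_r ut).
have cs : colored (Node c l r) s =
    [&& all (fun e => ecolor e == c) X, colored l sl & colored r sr].
  rewrite /colored (perm_all _ ps) !all_cat; congr [&& _, _ & _].
  - apply: eq_in_all => e /(allP wX) ce.
    by rewrite (nadir_cross ut ce) /= eq_sym.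
  - by apply: eq_in_all => e /(allP wl) we; rewrite nadir_l.
  - by apply: eq_in_all => e /(allP wr) we; rewrite (nadir_r ut).
have rs : count (reversed_in (Node c l r)) s =
    (count (fun e => src e \notin lset l) X + count (reversed_in l) sl
     + count (reversed_in r) sr)%N.
  rewrite (permP ps) !count_cat addnA; congr (_ + _ + _)%N.
  - by apply: eq_in_count => e /(allP wX) ce; rewrite (reversed_cross ut ce).
  - by apply: eq_in_count => e /(allP wl) we; rewrite reversed_l.
  - by apply: eq_in_count => e /(allP wr) we; rewrite (reversed_r ut).
rewrite (permPl nps) perm_vertices cs rs.
have -> : tree_sgn R (map raw s) (Node c l r) =
    only_esgn R c (lset l) (map raw X) * tree_sgn R (map raw sl) l
    * tree_sgn R (map raw sr) r.
  have idem (A : {set 'I_n}) (u : seq (edge n)) :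
      perm_eq [seq e <- map raw u | within A e]
        [seq e <- map raw [seq e <- u | within A (raw e)] | within A e].
    by rewrite !filter_map_raw filter_id.
  rewrite /= /cross_sgn filter_map_raw.
  by rewrite (tree_sgn_perm _ (idem _ s)) [tree_sgn R _ r](tree_sgn_perm _ (idem _ s)).
rewrite -ihl // -ihr //; clear.
case: X => [|e [|e' X]]; rewrite /= ?mul0r //.
rewrite andbT /esgn /=; case: (ecolor e == c) => /=; last first.
  by rewrite andbF !mul0r.
case: (perm_eq _ (internal l)) => /=; last by rewrite mulr0 mul0r.
case: (perm_eq _ (internal r)); rewrite /= ?andbF ?mulr0 //.
case: (colored l sl) => /=; last by rewrite mulr0 mul0r.
case: (colored r sr); rewrite /= ?mulr0 // !exprD.
by case: (src e \in lset l); rewrite /= ?expr0 ?expr1 ?mulr1.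
Qed.

End RawGraphs.

(** * The pairing on the quotients *)

Section Descent.
Variables (R : comPzRingType) (U E W : lmodType R) (pr : U -> E).
Variable b : U -> W -> R^o.
Hypothesis pr_lin : linear pr.
Hypothesis pr_surj : forall e, exists u, e = pr u.
Hypothesis b_linl : forall w, linear (b^~ w).
Hypothesis b_linr : forall u, linear (b u).
Hypothesis pr_ker : forall u w, pr u = 0 -> b u w = 0.

(** Only the first variable needs a descent: in the second one the form is already given by
    functionals on the Lie algebra. *)
Lemma pairing_descent :
  exists p : bilinear_pairing E W, forall u w, p (pr u) w = b u w.
Proof.
pose rep e := sval (cid (pr_surj e)).
have repK e : pr (rep e) = e by rewrite /rep; case: (cid _).
have pB u v : pr (u - v) = pr u - pr v.
  by rewrite addrC -scaleN1r pr_lin scaleN1r addrC.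
have bB u v w : b (u - v) w = b u w - b v w.
  by rewrite addrC -scaleN1r b_linl scaleN1r addrC.
have b_rep u w : b (rep (pr u)) w = b u w.
  by apply/eqP; rewrite -subr_eq0 -bB pr_ker // pB repK subrr.
have pl w : linear (fun e => b (rep e) w).
  move=> a e e'; have [u ->] := pr_surj e; have [v ->] := pr_surj e'.
  by rewrite -pr_lin !b_rep b_linl.
by exists (@BilinearPairing _ _ _ (fun e w => b (rep e) w) pl (fun e => b_linr _)).
Qed.

End Descent.

Section FullTrees.
Variables (R : comPzRingType) (n : nat).

Lemma mltreeP (t : mltree n) : uniq (leaves t) /\ lset t = setT.
Proof.
case: t => t /= pt; split; first by rewrite (perm_uniq pt) enum_uniq.
by apply/setP => i; rewrite !inE (perm_mem pt) mem_enum.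
Qed.

Lemma all_within_full (t : tree n) (s : seq (edge n)) : lset t = setT ->
  all (fun e => within (lset t) (raw e)) s.
Proof. by move=> ->; apply/allP => e _; rewrite /within !inE. Qed.

Lemma graph_tree_pairingE (G : graph n) (t : mltree n) :
  graph_tree_pairing R G t = tree_sgn R (raw_edges G) t.
Proof.
have [ut ft] := mltreeP t.
by rewrite -(nadir_tree_sgn R ut (all_within_full _ ft)).
Qed.

(** All edges joining i and j, of either color and direction, cross at the same internal vertex. *)
Lemma compat_joins E (t : tree n) i j : uniq (leaves t) -> compat E t ->
    i != j -> i \in lset t -> j \in lset t ->
  (count (fun e : rawedge n => ((e.1.2, e.2) == (i, j)) || ((e.1.2, e.2) == (j, i))) E
   <= 1)%N.
Proof.
move=> + + ij; elim: t => [k|c l ihl r ihr] ut.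
  by move=> _; rewrite !inE => /eqP ei /eqP ej; rewrite ei ej eqxx in ij.
have [ul ur d] := uniq_disjoint ut.
case/and3P => cr cl cr'; rewrite lset_node !in_setU.
have cross : forall i j, i \in lset l -> j \in lset r ->
    (count (fun e : rawedge n =>
      ((e.1.2, e.2) == (i, j)) || ((e.1.2, e.2) == (j, i))) E <= 1)%N.
  move=> x y xl yr; apply: leq_trans (_ : size [seq e <- E | crosses (lset l) (lset r) e] <= 1)%N.
    rewrite size_filter; apply: sub_count => -[[b x'] y'] /=.
    by rewrite /crosses !xpair_eqE /= => /orP[] /andP[/eqP -> /eqP ->];
      rewrite xl yr ?orbT.
  by move: cr; rewrite /cross_one; case: (filter _ E) => [|? []].
case/orP => [il|ir] /orP[jl|jr].
- exact: ihl.
- exact: cross.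
- apply: leq_trans (cross j i jl ir).
  by rewrite (eq_count (fun e => orbC _ _)).
- exact: ihr.
Qed.

Lemma multiple_edge_sgn (G : graph n) (t : mltree n) :
  has_multiple_edge G -> tree_sgn R (raw_edges G) t = 0.
Proof.
have [ut ft] := mltreeP t.
case/existsP => i /existsP[j ij]; apply: tree_sgn_compat0; apply/negP => ct.
have neq : i != j.
  apply: contraTneq ij => ->; rewrite -leqNgt.
  rewrite (@eq_count _ _ pred0) ?count_pred0 // => e.
  rewrite /joins !xpair_eqE orbb; apply/negP => /andP[/eqP e1 /eqP e2].
  by have := edge_loopless e; rewrite e1 e2 eqxx.
have := compat_joins ut ct neq.
rewrite ft !inE => /(_ isT isT); rewrite leqNgt => /negP; apply.
by rewrite /raw_edges count_map.
Qed.

Lemma adjacent_sym (G : graph n) : symmetric (adjacent G).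
Proof. by move=> i j; apply: eq_has => e; rewrite /joins orbC. Qed.

Lemma adjacent_edge (G : graph n) e : e \in edges G -> adjacent G (src e) (tgt e).
Proof. by move=> eG; apply/hasP; exists e => //; rewrite /joins eqxx. Qed.

Lemma connect_adjacent_sym (G : graph n) : connect_sym (adjacent G).
Proof. exact/sym_connect_sym/adjacent_sym. Qed.

Lemma connectedP (G : graph n) (i : 'I_n) :
  (forall j, connect (adjacent G) i j) -> connected G.
Proof.
move=> conn; rewrite /connected -(eq_n_comp_r (a := connect (adjacent G) i)).
  by rewrite n_comp_connect //; apply: connect_adjacent_sym.
by move=> j; rewrite -!topredE /= conn.
Qed.

Lemma disconnected_sgn (G : graph n) (t : mltree n) :
  ~~ connected G -> tree_sgn R (raw_edges G) t = 0.
Proof.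
have [ut ft] := mltreeP t.
move=> /negP nc; apply: tree_sgn_compat0; apply/negP => ct; apply: nc.
have [i it] : exists i, i \in lset t.
  clear; elim: (mltree_val t) => [i|c l [i il] r _].
    by exists i; rewrite !inE.
  by exists i; rewrite lset_node in_setU il.
apply: (connectedP (i := i)) => j.
have := compat_closed (S := connect (adjacent G) i) ct _ it.
move/(_ _ j); rewrite connect0 => <- //; last by rewrite ft inE.
move=> _ /mapP[e eG ->] _ /=; apply/idP/idP => h; apply: connect_trans h _.
  exact/connect1/adjacent_edge.
by rewrite connect_adjacent_sym; apply/connect1/adjacent_edge.
Qed.

Lemma eil2_relation_sgn (t : mltree n) (u : Gamma R n) : eil2_relation u ->
  linext (fun G => tree_sgn R (raw_edges G) t : R^o) u = 0.
Proof.
have [ut ft] := mltreeP t; have it i : i \in lset t by rewrite ft inE.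
have add2 (H : graph n) e f :
    tree_sgn R (raw_edges (add_edge (add_edge H e) f)) t =
    tree_sgn R (raw e :: raw f :: raw_edges H) t.
  apply/perm_tree_sgn/permP => p; rewrite (permP (perm_raw_add _ _)) /=.
  by rewrite (permP (perm_raw_add _ _)) /= addnCA.
pose s (G : graph n) : R^o := tree_sgn R (raw_edges G) t.
rewrite -/s.
have eD (x y : Gamma R n) : linext s (x + y) = linext s x + linext s y by apply: linextD.
have e_gen G : linext s (gen R G) = s G by apply: linext_gen.
move: (linext s) eD e_gen => e eD e_gen.
have flip E c i j : i != j ->
    tree_sgn R ((c, i, j) :: E) t + tree_sgn R ((c, j, i) :: E) t = 0.
  by move=> ij; rewrite tree_sgn_flip // addNr.
have cyc (H : graph n) i j k : i != j -> j != k -> k != i ->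
    exists X : color -> color -> R, forall c d,
    cyc_sgn R (raw_edges H) t i j k c d = X c d - X d c.
  by move=> ij jk ki; apply: cyc_antisymP.
case=> [H c i j ij ji|H c i j k ij jk ki|H i j k ij jk ki|G mG|G dG].
- by rewrite eD !e_gen /s !(perm_tree_sgn R t (perm_raw_add _ _)) flip.
- rewrite !eD !e_gen /s !add2 !raw_arrow.
  by have [X XP] := cyc H i j k ij jk ki; have := XP c c; rewrite subrr.
- rewrite !eD !e_gen /s !add2 !raw_arrow.
  have [X XP] := cyc H i j k ij jk ki.
  (* The two color orders of the cyclic sum are opposite, since the same X serves for both. *)
  have := congr2 +%R (XP blue red) (XP red blue).
  rewrite -[X red blue - _]opprB subrr => <-; rewrite /cyc_sgn.
  by rewrite [in RHS]addrACA; congr (_ + _); rewrite addrACA.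
- by rewrite e_gen /s multiple_edge_sgn.
- by rewrite e_gen /s disconnected_sgn.
Qed.

Lemma eil2_relation_span (t : mltree n) (u : Gamma R n) :
  u \in span (@eil2_relation R n) ->
  linext (fun G => tree_sgn R (raw_edges G) t : R^o) u = 0.
Proof.
apply: (@span_linear0 _ _ _ _ (linext _)); first exact: linext_linear.
exact: eil2_relation_sgn.
Qed.

Lemma Eil2_projP : linear (@Eil2_proj R n).
Proof. exact: linearP. Qed.

Lemma Eil2_proj_surj (x : Eil2 R n) : exists u, x = Eil2_proj u.
Proof.
by exists (repr (x : quotmod (span (@eil2_relation R n)))); rewrite [RHS]quotmod_reprK.
Qed.

Lemma Eil2_proj_eq0 (u : Gamma R n) :
  Eil2_proj u = 0 -> u \in span (@eil2_relation R n).
Proof.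
rewrite -[X in _ = X](raddf0 (@quotmod_pi R (Gamma R n) (span (@eil2_relation R n)))).
by move/quotmod_piP; rewrite subr0.
Qed.

Lemma Lie2_projP : linear (@Lie2_proj R n).
Proof. exact: linext_linear. Qed.

Lemma Lie2_proj_gen (t : mltree n) :
  Lie2_val (Lie2_proj (gen R t)) = lie2_monomial R t.
Proof. by rewrite /Lie2_proj linext_gen. Qed.

Lemma Lie2_valP : linear (@Lie2_val R n).
Proof. exact: (linearP (val : Lie2 R n -> lie2_alg R n)). Qed.

Lemma tree_functional (G : graph n) : exists2 f : lie2_alg R n -> R^o, linear f &
  forall t : mltree n, f (lie2_monomial R t) = tree_sgn R (raw_edges G) t.
Proof.
have [F FE] := lie2_subst (cut_two_lie R (raw_edges G)) (@cut_leaf R n).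
exists (fun x => F x setT) => [a x y|t]; first by rewrite linearP !ffunE.
by have [ut ft] := mltreeP t; rewrite FE cut_eval ut ft eqxx.
Qed.

Lemma graph_tree_pairing_exists : exists p : bilinear_pairing (Eil2 R n) (Lie2 R n),
  forall u y, p (Eil2_proj u) (Lie2_proj y) = pairing_form u y.
Proof.
have phiP G := cid2 (tree_functional G).
pose phi G := sval (phiP G).
have phi_lin G : linear (phi G) by rewrite /phi; case: (phiP G).
have phi_mon G (t : mltree n) :
    phi G (lie2_monomial R t) = tree_sgn R (raw_edges G) t.
  by rewrite /phi; case: (phiP G).
pose b (u : Gamma R n) (y : Lie2 R n) : R^o :=
  linext (fun G => phi G (Lie2_val y)) u.
have bl y : linear (b^~ y) by apply: linext_linear.
have br u : linear (b u).
  by apply: linext_linr => G a y z; rewrite Lie2_valP phi_lin.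
have bk u y : Eil2_proj u = 0 -> b u y = 0.
  move/Eil2_proj_eq0 => uR; case: y => x xm; rewrite /b /=.
  (* A relation among graphs is only known to vanish on multilinear monomials; these span the second
     variable. *)
  apply: (@span_linear0 _ _ _ _ (fun x => linext (fun G => phi G x) u)) xm.
    exact: linext_linr.
  move=> _ [t ->].
  rewrite -(eil2_relation_span t uR) /linext; apply: eq_bigr => G _.
  by rewrite phi_mon.
have [p pE] := pairing_descent Eil2_projP Eil2_proj_surj bl br bk.
have phiE G y : phi G (Lie2_val (Lie2_proj y)) =
    linext (graph_tree_pairing R G : mltree n -> R^o) y.
  symmetry; move: y; apply: linext_uniq => [a y z|t].
    by rewrite Lie2_projP Lie2_valP phi_lin.
  by rewrite Lie2_proj_gen phi_mon graph_tree_pairingE.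
exists p => u y; rewrite pE /b /pairing_form /bilinext /linext.
by apply: eq_bigr => G _; rewrite phiE.
Qed.

End FullTrees.

(** * Pairings with a triangular matrix *)

Section Perfect.
Variables (R : comPzRingType) (U V : lmodType R) (p : bilinear_pairing U V).

Lemma span_sum (W : lmodType R) m (g : 'I_m -> W) u :
  u \in span (fun x => exists i, x = g i) ->
  exists a : 'I_m -> R, u = \sum_i a i *: g i.
Proof.
move/asboolP; elim=> [|a v w [i ->] _ [b ->]].
  by exists (fun=> 0); rewrite big1 // => i _; rewrite scale0r.
exists (fun j => a *+ (j == i) + b j).
under [RHS]eq_bigr do rewrite scalerDl; rewrite big_split /=; congr (_ + _).
rewrite (bigD1 i) //= eqxx mulr1n big1 ?addr0 // => j /negPf ->.
by rewrite mulr0n scale0r.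
Qed.

Section Invertible.
Variables (m : nat) (g : 'I_m -> U) (t : 'I_m -> V) (N : 'M[R]_m).
Hypothesis g_span : forall u, u \in span (fun x => exists i, x = g i).
Hypothesis t_span : forall v, v \in span (fun x => exists i, x = t i).
Let M : 'M[R]_m := \matrix_(i, j) p (g i) (t j).
Hypotheses (MN : M *m N = 1%:M) (NM : N *m M = 1%:M).

Let pDl u u' v : p (u + u') v = p u v + p u' v.
Proof. by have := pairing_linl p v 1 u u'; rewrite !scale1r. Qed.
Let p0l v : p 0 v = 0.
Proof. by apply: (addrI (p 0 v)); rewrite -pDl !addr0. Qed.
Let pZl a u v : p (a *: u) v = a * p u v.
Proof. by have := pairing_linl p v a u 0; rewrite p0l !addr0. Qed.
Let p_suml (a : 'I_m -> R) v : p (\sum_i a i *: g i) v = \sum_i a i * p (g i) v.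
Proof.
rewrite (big_morph (fun u => p u v) (fun u u' => pDl u u' v) (p0l v)).
by apply: eq_bigr => i _; rewrite pZl.
Qed.

Lemma dual_fun_sum (W : lmodType R) (f : 'I_m -> W) (x : dual W) a :
  dual_fun x (\sum_i a i *: f i) = \sum_i a i * dual_fun x (f i).
Proof. by rewrite /dual_fun linear_sum; apply: eq_bigr => i _; rewrite linearZ. Qed.

Lemma dual_eq_on (W : lmodType R) (f : 'I_m -> W) (x y : dual W) :
  (forall v, v \in span (fun x => exists i, x = f i)) ->
  (forall i, dual_fun x (f i) = dual_fun y (f i)) -> x = y.
Proof.
move=> fs xy; apply: dualP => v; have [a ->] := span_sum (fs v).
by rewrite !dual_fun_sum; apply: eq_bigr => i _; rewrite xy.
Qed.

Let MNE k i : \sum_j p (g k) (t j) * N j i = (k == i)%:R.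
Proof.
have /matrixP/(_ k i) := MN; rewrite !mxE => <-.
by apply: eq_bigr => j _; rewrite mxE.
Qed.

Let NME j k : \sum_i N j i * p (g i) (t k) = (j == k)%:R.
Proof.
have /matrixP/(_ j k) := NM; rewrite !mxE => <-.
by apply: eq_bigr => i _; rewrite mxE.
Qed.

Let sum_delta (a : 'I_m -> R) i : \sum_k a k * (k == i)%:R = a i.
Proof.
rewrite (bigD1 i) //= eqxx mulr1 big1 ?addr0 // => k /negPf ->.
by rewrite mulr0.
Qed.

(** If u has coordinates a in the family g, the values of u on the family t are a times M, and N
    recovers a. The same formula applied to any functional gives the inverse; injectivity needs no
    independence of g, as u itself is rebuilt. *)
Lemma to_dualr_iso : linear_iso (to_dualr p).
Proof.
split=> [a u u'|]; first by apply: dualP => v; rewrite /dual_fun /= pDl pZl.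
pose inv (f : dual V) : U := \sum_i (\sum_j dual_fun f (t j) * N j i) *: g i.
exists inv => [u|f].
  have [a ->] := span_sum (g_span u); apply: eq_bigr => i _; congr (_ *: _).
  rewrite /dual_fun /= -[RHS]sum_delta.
  under eq_bigr do rewrite p_suml mulr_suml.
  rewrite exchange_big /=; apply: eq_bigr => k _.
  by rewrite -MNE mulr_sumr; apply: eq_bigr => j _; rewrite mulrA.
apply: (dual_eq_on t_span) => k; rewrite [LHS]p_suml.
rewrite -[RHS](sum_delta (fun j => dual_fun f (t j))).
under eq_bigr do rewrite mulr_suml.
rewrite exchange_big /=; apply: eq_bigr => j _.
by rewrite -NME mulr_sumr; apply: eq_bigr => i _; rewrite mulrA.
Qed.

End Invertible.
End Perfect.

Section Flip.
Variables (R : comPzRingType) (U V : lmodType R) (p : bilinear_pairing U V).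

Definition flip_pairing : bilinear_pairing V U :=
  @BilinearPairing _ V U (fun v u => p u v) (pairing_linr p) (pairing_linl p).

Lemma to_duall_flip v : to_duall p v = to_dualr flip_pairing v.
Proof. exact: dualP. Qed.

Lemma perfect_invertible (m : nat) (g : 'I_m -> U) (t : 'I_m -> V) (N : 'M[R]_m) :
  (forall u, u \in span (fun x => exists i, x = g i)) ->
  (forall v, v \in span (fun x => exists i, x = t i)) ->
  (\matrix_(i, j) p (g i) (t j)) *m N = 1%:M ->
  N *m (\matrix_(i, j) p (g i) (t j)) = 1%:M -> perfect p.
Proof.
move=> gs ts MN NM; split; first exact: to_dualr_iso gs ts MN NM.
have := @to_dualr_iso _ _ _ flip_pairing m t g N^T ts gs.
rewrite (_ : \matrix_(i, j) _ = (\matrix_(i, j) p (g i) (t j))^T); last first.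
  by apply/matrixP => i j; rewrite !mxE.
rewrite -!trmx_mul MN NM trmx1 => /(_ erefl erefl) [lin [h hK Kh]].
split=> [a v v'|]; first by rewrite !to_duall_flip lin.
by exists h => x; rewrite to_duall_flip.
Qed.

(** Sorting the indices by [mu] makes the matrix lower triangular. Its determinant is a product of
    signs, hence its own inverse, and the determinant times the adjugate is a two-sided inverse over
    any commutative ring. *)
Lemma perfect_triangular (I : eqType) (s : seq I) (g : I -> U) (t : I -> V)
    (mu : I -> nat) :
  (forall u, u \in span (fun x => exists2 i, i \in s & x = g i)) ->
  (forall v, v \in span (fun x => exists2 i, i \in s & x = t i)) ->
  {in s, forall i, p (g i) (t i) = 1 \/ p (g i) (t i) = -1} ->
  {in s &, forall i j, i != j -> (mu i <= mu j)%N -> p (g i) (t j) = 0} ->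
  perfect p.
Proof.
move=> gs ts diag tri.
pose r := sort (relpre mu leq) (undup s).
have rs i : (i \in r) = (i \in s) by rewrite mem_sort mem_undup.
have ru : uniq r by rewrite sort_uniq undup_uniq.
have rsorted : sorted (relpre mu leq) r.
  by apply: sort_sorted => i j; apply: leq_total.
pose m := size r; pose x (i : 'I_m) := tnth (in_tuple r) i.
have xs i : x i \in s by rewrite -rs; apply: mem_tnth.
have span_x (W : lmodType R) (f : I -> W) w :
    w \in span (fun y => exists2 i, i \in s & y = f i) ->
    w \in span (fun y => exists i, y = f (x i)).
  apply: span_trans => v [i]; rewrite -rs => ir ->; apply: mem_span.
  have ilt : (index i r < m)%N by rewrite index_mem.
  exists (Ordinal ilt); congr f; rewrite /x (tnth_nth i) /=.
  by rewrite nth_index.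
pose M := \matrix_(i, j) p (g (x i)) (t (x j)).
have Mtrig : is_trig_mx M.
  apply/is_trig_mxP => i j ij; rewrite mxE; apply: tri => //.
    rewrite /x !(tnth_nth (x i)) /= nth_uniq ?ltn_ord //.
    by rewrite neq_ltn ij.
  rewrite /x !(tnth_nth (x i)) /=.
  have tr : transitive (relpre mu leq) by move=> ? ? ?; apply: leq_trans.
  by apply: (sorted_ltn_nth tr (x i) rsorted) => //; apply: ltn_ord.
have detM : \det M * \det M = 1.
  rewrite det_trig // -big_split big1 //= => i _; rewrite mxE.
  by case: (diag (x i) (xs i)) => ->; rewrite ?mulr1 ?mulrNN ?mulr1.
apply: (@perfect_invertible m (g \o x) (t \o x) (\det M *: \adj M)).
- by move=> u; apply: span_x.
- by move=> v; apply: span_x.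
- by rewrite -scalemxAr mul_mx_adj scale_scalar_mx detM.
- by rewrite -scalemxAl mul_adj_mx scale_scalar_mx detM.
Qed.

End Flip.

(** * Colored rooted trees and triangularity *)

Section RootedTrees.
Variable n : nat.
Implicit Types (E : seq (rawedge n)) (t s : tree n) (i j y : 'I_n).

(* RB T X hangs X below the root of T, which is the largest label, and
   RR Y y T hangs T, whose root is the largest label, below the vertex y of Y.
   A tree satisfying good is disassembled in only one way. *)
Inductive rtree : Type :=
  | RV of 'I_n
  | RB of rtree & rtree
  | RR of rtree & 'I_n & rtree.

HB.instance Definition _ := gen_eqMixin rtree.
Implicit Types T X Y W : rtree.

Fixpoint root T : 'I_n :=
  match T with RV v => v | RB T _ => root T | RR Y _ _ => root Y end.

Fixpoint labels T : seq 'I_n :=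
  match T with
  | RV v => [:: v]
  | RB T X => labels T ++ labels X
  | RR Y _ T => labels Y ++ labels T
  end.

Definition parent_edge (p x : 'I_n) : rawedge n := (~~ (p < x)%N, p, x).

Fixpoint rgraph T : seq (rawedge n) :=
  match T with
  | RV _ => [::]
  | RB T X => parent_edge (root T) (root X) :: rgraph T ++ rgraph X
  | RR Y y T => parent_edge y (root T) :: rgraph Y ++ rgraph T
  end.

Fixpoint graft t y s : tree n :=
  match t with
  | Leaf i => if i == y then Node red (Leaf y) s else Leaf i
  | Node c l r => Node c (graft l y s) (graft r y s)
  end.

(** A blue cut happens at the root of the rooted tree and gives the outermost bracket; a red cut
    happens at y, so the red bracket is inserted at the leaf y, deep inside the monomial of Y. *)
Fixpoint btree T : tree n :=
  match T with
  | RV v => Leaf v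
  | RB T X => Node blue (btree T) (btree X)
  | RR Y y T => graft (btree Y) y (btree T)
  end.

Definition root_max T := all (fun i => (i <= root T)%N) (labels T).

(** The last clause for [RB] says that X holds the largest label after the root, which fixes which
    branch is cut. In [RR] the root of T is the largest label of all, which fixes the red edge. *)
Fixpoint good T : bool :=
  match T with
  | RV _ => true
  | RB T X => [&& good T, good X, root_max T,
      all (fun i => (i < root T)%N) (labels X)
      & has (fun u : 'I_n => all (fun a : 'I_n => (a == root T) || (a < u)%N) (labels T))
          (labels X)]
  | RR Y y T => [&& good Y, good T, root_max T,
      all (fun i => (i < root T)%N) (labels Y) & y \in labels Y]
  end.

Definition normal T := good T && uniq (labels T).

Definition lab T : {set 'I_n} := [set i | i \in labels T].

Lemma root_in T : root T \in labels T.
Proof. by elim: T => [v|T ihT X _|Y ihY y T _] /=; rewrite ?mem_head ?mem_cat ?ihT ?ihY. Qed.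

Lemma normalB T X : normal (RB T X) ->
  [/\ normal T, normal X & [disjoint lab T & lab X]].
Proof.
rewrite /normal /= cat_uniq => /andP[/and5P[-> -> _ _ _] /and3P[-> d ->]].
split=> //; rewrite disjoint_sym; apply/pred0Pn => -[i /andP[]].
by rewrite /= !inE => iX iT; case/hasP: d; exists i.
Qed.

Lemma normalR Y y T : normal (RR Y y T) ->
  [/\ normal Y, normal T & [disjoint lab Y & lab T]].
Proof.
rewrite /normal /= cat_uniq => /andP[/and5P[-> -> _ _ _] /and3P[-> d ->]].
split=> //; rewrite disjoint_sym; apply/pred0Pn => -[i /andP[]].
by rewrite /= !inE => iX iT; case/hasP: d; exists i.
Qed.

Lemma graft_notin t y s : y \notin leaves t -> graft t y s = t.
Proof.
elim: t => [i|c l ihl r ihr] /=; first by rewrite inE eq_sym => /negPf ->.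
by rewrite mem_cat negb_or => /andP[/ihl -> /ihr ->].
Qed.

Lemma perm_leaves_graft t y s : uniq (leaves t) -> y \in leaves t ->
  perm_eq (leaves (graft t y s)) (leaves t ++ leaves s).
Proof.
elim: t => [i|c l ihl r ihr] /=; first by rewrite inE => _ /eqP ->; rewrite eqxx.
rewrite cat_uniq => /and3P[ul /hasPn lr ur]; rewrite mem_cat => /orP[yl|yr].
  have yr : y \notin leaves r by apply/negP => /lr /negP.
  rewrite (graft_notin _ yr) perm_sym -catA perm_sym.
  rewrite (permPl (perm_cat (ihl ul yl) (perm_refl _))) -catA perm_cat2l.
  by rewrite perm_catC.
by rewrite (graft_notin _ (lr _ yr)) -catA perm_cat2l ihr.
Qed.

Lemma perm_leaves_btree T : normal T -> perm_eq (leaves (btree T)) (labels T).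
Proof.
elim: T => [v|T ihT X ihX|Y ihY y T ihT] //.
  by case/normalB => /ihT pT /ihX pX _; apply: perm_cat.
move=> nT; case/normalR: (nT) => nY /ihT pT _; have pY := ihY nY.
have yY : y \in leaves (btree Y).
  by rewrite (perm_mem pY); case/andP: nT => /and5P[].
rewrite /= (permPl (perm_leaves_graft _ _ yY)); first exact: perm_cat.
by rewrite (perm_uniq pY); case/andP: nY.
Qed.

Lemma lset_btree T : normal T -> lset (btree T) = lab T.
Proof.
by move=> nT; apply/setP => i; rewrite !inE (perm_mem (perm_leaves_btree nT)).
Qed.

Lemma uniq_btree T : normal T -> uniq (leaves (btree T)).
Proof.
by move=> nT; rewrite (perm_uniq (perm_leaves_btree nT)); case/andP: nT.
Qed.

Lemma labB T X : lab (RB T X) = lab T :|: lab X.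
Proof. by apply/setP => i; rewrite !inE mem_cat. Qed.

Lemma labR Y y T : lab (RR Y y T) = lab Y :|: lab T.
Proof. by apply/setP => i; rewrite !inE mem_cat. Qed.

Lemma lset_graft t y s : uniq (leaves t) -> y \in leaves t ->
  lset (graft t y s) = lset t :|: lset s.
Proof.
move=> ut yt; apply/setP => i.
by rewrite !inE (perm_mem (perm_leaves_graft s ut yt)) mem_cat.
Qed.

Lemma rgraph_within T : normal T -> all (within (lab T)) (rgraph T).
Proof.
have mono (A B : {set 'I_n}) E : A \subset B -> all (within A) E -> all (within B) E.
  move=> /subsetP AB; apply: sub_all => e /andP[e1 e2].
  by rewrite /within !AB.
elim: T => [v|T ihT X ihX|Y ihY y T ihT] // nT.
  case/normalB: (nT) => /ihT hT /ihX hX _; rewrite labB /= all_cat.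
  rewrite (mono _ _ _ _ hT) ?subsetUl // (mono _ _ _ _ hX) ?subsetUr //.
  by rewrite /within /= !inE !root_in orbT.
case/normalR: (nT) => /ihY hY /ihT hT _; rewrite labR /= all_cat.
rewrite (mono _ _ _ _ hY) ?subsetUl // (mono _ _ _ _ hT) ?subsetUr //.
rewrite /within /= !inE !root_in orbT !andbT.
by case/andP: nT => /and5P[_ _ _ _ ->].
Qed.

Lemma normal_root_maxB T X : normal (RB T X) -> root_max (RB T X).
Proof.
case/andP => /and5P[_ _ rT rX _] _; rewrite /root_max /= all_cat [X in X && _]rT /=.
by apply: sub_all rX => i /ltnW.
Qed.

(** Together with [normal_root_maxB]: the position of the largest label determines the outermost
    constructor of a composite normal tree. *)
Lemma root_maxR Y y T : normal (RR Y y T) -> ~~ root_max (RR Y y T).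
Proof.
case/andP => /and5P[_ _ _ rY _] _; apply/negP => /allP/(_ (root T)).
rewrite mem_cat root_in orbT leqNgt => /(_ isT)/negP; apply.
exact: (allP rY _ (root_in Y)).
Qed.

Lemma cross_one_color E c (A B : {set 'I_n}) e : cross_one E c A B ->
  e \in E -> crosses A B e -> e.1.1 = c.
Proof.
rewrite /cross_one => + eE ce.
have: e \in [seq e <- E | crosses A B e] by rewrite mem_filter ce.
by case: (filter _ E) => [|x [|x' s]] //; rewrite inE => /eqP -> /eqP.
Qed.

(** When the root is the largest label, only blue cuts occur along the root, and [btree T] is a left
    comb of blue brackets starting at that leaf. Every vertex above the leaf is blue, so any edge at
    the root crosses at a blue vertex. *)
Lemma root_edge_blue E T e : normal T -> root_max T -> compat E (btree T) ->
    e \in E -> within (lab T) e -> e.1.2 != e.2 ->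
    (e.1.2 == root T) || (e.2 == root T) -> e.1.1 = blue.
Proof.
elim: T => [v|T ihT X ihX|Y ihY y T ihT] nT mT.
- by rewrite /within !inE => _ _ /andP[/eqP -> /eqP ->]; rewrite eqxx.
- case/normalB: (nT) => nT1 nX d; case/and3P => cr cT cX eE we ne hr.
  have mT1 : root_max T by case/andP: (nT) => /and5P[].
  case wT: (within (lab T) e); first exact: ihT.
  apply: (cross_one_color cr eE); rewrite !lset_btree //.
  have rT : root T \in lab T by rewrite inE root_in.
  move: we wT hr; rewrite labB /within /crosses !in_setU /=.
  by case/andP => + + + /orP[]/eqP eq; rewrite eq rT /=;
    case: (_ \in lab T) => //=; case: (_ \in lab X) => //= _ _; rewrite ?orbT ?andbT.
- by have := root_maxR nT; rewrite mT.
Qed.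

Lemma compat_graft_sub E t y s : y \in leaves t -> uniq (leaves t) ->
  compat E (graft t y s) -> cross_one E red [set y] (lset s) && compat E s.
Proof.
elim: t => [i|c l ihl r ihr] /=.
  rewrite inE => /eqP ->; rewrite eqxx /= => _.
  have -> : lset (Leaf i) = [set i] by apply/setP => j; rewrite !inE.
  by [].
rewrite mem_cat cat_uniq => yt /and3P[ul _ ur] /and3P[_ cl cr].
by case/orP: yt => [yl|yr]; [apply: ihl | apply: ihr].
Qed.

(** Edges between s and t end at y, so at a vertex of t above y the leaves of s add no new crossing
    edge: those at y were on that side before. *)
Lemma compat_graft E t y s : y \in leaves t -> uniq (leaves t) ->
    (forall e i j, e \in E -> (e.1.2, e.2) = (i, j) \/ (e.1.2, e.2) = (j, i) ->
       i \in lset s -> j \in lset t -> j = y) ->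
  compat E (graft t y s) =
  [&& compat E t, cross_one E red [set y] (lset s) & compat E s].
Proof.
elim: t => [i|c l ihl r ihr].
  rewrite inE => /eqP -> _ _; rewrite /= eqxx /=.
  have -> : lset (Leaf i) = [set i] by apply/setP => j; rewrite !inE.
  by [].
move=> yt ut; have [ul ur d] := uniq_disjoint ut => ys.
have noc (A B : {set 'I_n}) : A \subset lset (Node c l r) ->
    y \notin A -> {in E, forall e, crosses (lset s) A e = false}.
  move=> /subsetP At yA e eE; apply/negP => ce; case/negP: yA.
  case/orP: ce => /andP[e1 e2].
    by rewrite -(ys e _ _ eE (or_introl erefl) e1 (At _ e2)).
  by rewrite -(ys e _ _ eE (or_intror erefl) e2 (At _ e1)).
have crU A B C e : crosses (A :|: B) C e = crosses A C e || crosses B C e :> bool.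
  rewrite /crosses !in_setU.
  by case: (_ \in A); case: (_ \in B); case: (_ \in C); case: (_ \in A);
    case: (_ \in B); case: (_ \in C).
have ysl e i j : e \in E -> (e.1.2, e.2) = (i, j) \/ (e.1.2, e.2) = (j, i) ->
    i \in lset s -> j \in lset l -> j = y.
  by move=> eE eij is' jl; apply: ys eE eij is' _; rewrite lset_node in_setU jl.
have ysr e i j : e \in E -> (e.1.2, e.2) = (i, j) \/ (e.1.2, e.2) = (j, i) ->
    i \in lset s -> j \in lset r -> j = y.
  by move=> eE eij is' jr; apply: ys eE eij is' _; rewrite lset_node in_setU jr orbT.
move: yt; rewrite /= mem_cat => /orP[yl|yr].
  have yr : y \notin lset r by rewrite (disjointFr d) // inE.
  have yr' : y \notin leaves r by move: yr; rewrite inE.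
  rewrite (graft_notin _ yr') (ihl yl ul ysl) lset_graft //.
  rewrite /cross_one (@eq_in_filter _ _ (crosses (lset l) (lset r))); last first.
    by move=> e eE /=; rewrite crU (noc _ set0 (subset_noder _ _ _) yr e eE) orbF.
  rewrite -!andbA; do 2![congr (_ && _)].
  by rewrite andbA andbC.
have yl : y \notin lset l by rewrite (disjointFl d) // inE.
have yl' : y \notin leaves l by move: yl; rewrite inE.
rewrite (graft_notin _ yl') (ihr yr ur ysr) lset_graft //.
rewrite /cross_one (@eq_in_filter _ _ (crosses (lset l) (lset r))); last first.
  move=> e eE /=; rewrite crossesC crU [RHS]crossesC.
  by rewrite (noc _ set0 (subset_nodel _ _ _) yl e eE) orbF.
by rewrite -!andbA.
Qed.

End RootedTrees.

(** * Triangularity of the pairing matrix *)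

Section Triangular.
Variable n : nat.
Implicit Types (E : seq (rawedge n)) (t s : tree n) (i j y : 'I_n).
Implicit Types T X Y W : rtree n.

Lemma filter_within_disjoint (A B : {set 'I_n}) E : [disjoint A & B] ->
  all (within A) E -> [seq e <- E | within B e] = [::].
Proof.
move=> d /allP wE; apply/eqP; rewrite -size_eq0 size_filter -leqn0 leqNgt -has_count.
by apply/hasPn => e /wE; apply: within_disjoint.
Qed.

Lemma compat_node E c l r : compat E (Node c l r) ->
  [/\ cross_one E c (lset l) (lset r), compat E l & compat E r].
Proof. by case/and3P. Qed.

Lemma parent_edge_nwithin (A B : {set 'I_n}) p x : [disjoint A & B] ->
  p \in A -> x \in B -> ~~ within A (parent_edge p x) /\ ~~ within B (parent_edge p x).
Proof.
by move=> d pA xB; rewrite /within /= (disjointFr d pA) (disjointFl d xB) andbF.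
Qed.

Lemma rootE T : root T \in lab T. Proof. by rewrite inE root_in. Qed.

Section Restrict.
Variables (T X : rtree n) (e : rawedge n).
Hypotheses (nT : normal T) (nX : normal X) (d : [disjoint lab T & lab X]).
Hypotheses (eT : ~~ within (lab T) e) (eX : ~~ within (lab X) e).

Lemma compat_restrictl t : lset t = lab T ->
  compat (e :: rgraph T ++ rgraph X) t = compat (rgraph T) t.
Proof.
move=> tT; apply: compat_perm; rewrite tT /= (negPf eT) filter_cat.
by rewrite (filter_within_disjoint _ (rgraph_within nX)) ?cats0 // disjoint_sym.
Qed.

Lemma compat_restrictr t : lset t = lab X ->
  compat (e :: rgraph T ++ rgraph X) t = compat (rgraph X) t.
Proof.
move=> tX; apply: compat_perm; rewrite tX /= (negPf eX) filter_cat.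
by rewrite (filter_within_disjoint _ (rgraph_within nT)).
Qed.

Lemma cross_one_restrict c : crosses (lab T) (lab X) e ->
  cross_one (e :: rgraph T ++ rgraph X) c (lab T) (lab X) = (e.1.1 == c).
Proof.
move=> ce; rewrite /cross_one /= ce filter_cat.
have none (A B : {set 'I_n}) E : [disjoint A & B] -> all (within A) E ->
    [seq f <- E | crosses A B f] = [::].
  move=> dAB /allP wE; apply/eqP; rewrite -size_eq0 size_filter -leqn0 leqNgt -has_count.
  by apply/hasPn => f /wE; apply: within_ncrosses.
rewrite (none _ _ _ d (rgraph_within nT)) (eq_filter (crossesC _ _)) none //.
  by rewrite disjoint_sym.
exact: rgraph_within.
Qed.

End Restrict.

Lemma parent_edgeB T X : normal (RB T X) -> let e := parent_edge (root T) (root X) in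
  [/\ ~~ within (lab T) e, ~~ within (lab X) e, crosses (lab T) (lab X) e
    & e.1.1 = blue].
Proof.
move=> nT e; case/normalB: (nT) => _ _ d.
have [e1 e2] := parent_edge_nwithin d (rootE T) (rootE X).
split=> //; first by rewrite /crosses /= !rootE.
case/andP: nT => /and5P[_ _ _ /allP/(_ _ (root_in X)) lt _] _.
by rewrite /e /parent_edge /= -leqNgt ltnW.
Qed.

Lemma parent_edgeR Y y T : normal (RR Y y T) -> let e := parent_edge y (root T) in
  [/\ ~~ within (lab Y) e, ~~ within (lab T) e, crosses (lab Y) (lab T) e
    & e.1.1 = red].
Proof.
move=> nT e; case/normalR: (nT) => _ _ d.
case/andP: nT => /and5P[_ _ _ /allP lt yY] _.
have yY' : y \in lab Y by rewrite inE.
have [e1 e2] := parent_edge_nwithin d yY' (rootE T).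
split=> //; first by rewrite /crosses /= yY' !rootE.
by rewrite /e /parent_edge /= lt.
Qed.

Lemma compatBl T X t : normal (RB T X) -> lset t = lab T ->
  compat (rgraph (RB T X)) t = compat (rgraph T) t.
Proof.
move=> nT; have [nT1 nX d] := normalB nT; have [e1 e2 _ _] := parent_edgeB nT.
exact: compat_restrictl.
Qed.

Lemma compatBr T X t : normal (RB T X) -> lset t = lab X ->
  compat (rgraph (RB T X)) t = compat (rgraph X) t.
Proof.
move=> nT; have [nT1 nX d] := normalB nT; have [e1 e2 _ _] := parent_edgeB nT.
exact: compat_restrictr.
Qed.

Lemma compatRl Y y T t : normal (RR Y y T) -> lset t = lab Y ->
  compat (rgraph (RR Y y T)) t = compat (rgraph Y) t.
Proof.
move=> nT; have [nY nT1 d] := normalR nT; have [e1 e2 _ _] := parent_edgeR nT.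
exact: compat_restrictl.
Qed.

Lemma compatRr Y y T t : normal (RR Y y T) -> lset t = lab T ->
  compat (rgraph (RR Y y T)) t = compat (rgraph T) t.
Proof.
move=> nT; have [nY nT1 d] := normalR nT; have [e1 e2 _ _] := parent_edgeR nT.
exact: compat_restrictr.
Qed.

Lemma parent_edge_end Y y T : normal (RR Y y T) ->
  forall e i j, e \in rgraph (RR Y y T) ->
    (e.1.2, e.2) = (i, j) \/ (e.1.2, e.2) = (j, i) ->
    i \in lab T -> j \in lab Y -> j = y.
Proof.
move=> nT e i j; case/normalR: (nT) => nY nT1 d.
case/andP: nT => /and5P[_ _ _ _ yY] _.
have inn x (A B : {set 'I_n}) : [disjoint A & B] -> x \in A -> x \in B -> False.
  by move=> dAB xA; rewrite (disjointFr dAB xA).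
rewrite inE mem_cat => /or3P[/eqP ->|eY|eT].
- case=> -[<- <-] //=.
  by rewrite !inE => yT _; case: (inn y _ _ d); rewrite inE.
- case/andP: (allP (rgraph_within nY) e eY) => e1 e2.
  by case=> -[<- <-] iT _; [case: (inn _ _ _ d e1 iT)|case: (inn _ _ _ d e2 iT)].
- case/andP: (allP (rgraph_within nT1) e eT) => e1 e2.
  by case=> -[<- <-] _ jY; [case: (inn _ _ _ d jY e2)|case: (inn _ _ _ d jY e1)].
Qed.

Lemma compat_self T : normal T -> compat (rgraph T) (btree T).
Proof.
elim: T => [v|T ihT X ihX|Y ihY y T ihT] // nT.
  case/normalB: (nT) => nT1 nX d; have [e1 e2 e3 e4] := parent_edgeB nT.
  rewrite /= !lset_btree // cross_one_restrict // e4 eqxx /=.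
  by rewrite compat_restrictl ?compat_restrictr ?lset_btree // ihT ?ihX.
case/normalR: (nT) => nY nT1 d; have [e1 e2 e3 e4] := parent_edgeR nT.
have yY : y \in labels Y by case/andP: (nT) => /and5P[].
have yY' : y \in leaves (btree Y) by rewrite (perm_mem (perm_leaves_btree nY)).
rewrite [btree _]/= compat_graft ?uniq_btree //; last first.
  by rewrite !lset_btree //; apply: parent_edge_end.
rewrite compat_restrictl ?compat_restrictr ?lset_btree // ihY ?ihT // andbT /=.
have := cross_one_restrict nY nT1 d red e3; rewrite e4 eqxx.
rewrite /cross_one (@eq_in_filter _ _ (crosses [set y] (lab T))) //.
move=> e eE; apply/idP/idP.
  case/orP => /andP[f1 f2]; rewrite /crosses.
    by rewrite f2 (parent_edge_end nT eE (or_intror erefl) f2 f1) set11.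
  by rewrite f1 (parent_edge_end nT eE (or_introl erefl) f1 f2) set11 orbT.
have yY2 : y \in lab Y by rewrite inE.
rewrite /crosses !in_set1 => /orP[] /andP[].
  by move=> /eqP -> ->; rewrite yY2.
by move=> -> /eqP ->; rewrite yY2 orbT.
Qed.

(* The weights in mu make the first comparison in the triangularity proof, that
   of the sizes of the parts, dominate the contributions of the subtrees. *)
Definition scale_cst (m : nat) : nat := (4 ^ m * m`!)%N.

Definition size_lab T : nat := size (labels T).

(** The extra summand [size_lab T] in the blue case puts every blue cut above every red cut with the
    same number of labels. *)
Fixpoint mu T : nat :=
  match T with
  | RV _ => 0
  | RB T1 X =>
      ((size_lab T + size_lab X) * scale_cst (size_lab T) + (mu T1 + mu X))%N
  | RR Y _ T1 => (size_lab T1 * scale_cst (size_lab T) + (mu Y + mu T1))%N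
  end.

Lemma scale_cstS m : scale_cst m.+1 = (4 * m.+1 * scale_cst m)%N.
Proof. by rewrite /scale_cst expnS factS -!mulnA; congr (_ * _)%N; rewrite mulnCA. Qed.

(** Each summand is at most [2 * m.+1 * scale_cst m] with m.+1 = a + b, which accounts for the
    factor 4 m.+1 in the recursion. With [mu_bound], the weights of both parts add up to less than
    one unit of the leading coefficient. *)
Lemma scale_cst_sum a b : (0 < a)%N -> (0 < b)%N ->
  (2 * a * scale_cst a + 2 * b * scale_cst b <= scale_cst (a + b))%N.
Proof.
have mono p q : (p <= q)%N -> (scale_cst p <= scale_cst q)%N.
  move/subnK <-; elim: (q - p)%N => // k ih; rewrite addSn [leqRHS]scale_cstS.
  by apply: leq_trans ih _; rewrite leq_pmull.
case: a => // a _; case: b => // b _.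
rewrite addSn [leqRHS]scale_cstS.
have ha : (scale_cst a.+1 <= scale_cst (a + b.+1))%N by apply: mono; lia.
have hb : (scale_cst b.+1 <= scale_cst (a + b.+1))%N by apply: mono; lia.
have h1 : (2 * a.+1 * scale_cst a.+1 <= 2 * (a + b.+1).+1 * scale_cst (a + b.+1))%N.
  by apply: leq_mul; lia.
have h2 : (2 * b.+1 * scale_cst b.+1 <= 2 * (a + b.+1).+1 * scale_cst (a + b.+1))%N.
  by apply: leq_mul; lia.
by apply: leq_trans (leq_add h1 h2) _; rewrite -!mulnDl.
Qed.

Lemma size_lab_gt0 T : (0 < size_lab T)%N.
Proof. by rewrite /size_lab; have := root_in T; case: (labels T). Qed.

Lemma mu_bound T : (mu T < 2 * size_lab T * scale_cst (size_lab T))%N.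
Proof.
elim: T => [v|T ihT X ihX|Y ihY y T ihT] //.
  have := scale_cst_sum (size_lab_gt0 T) (size_lab_gt0 X).
  have := size_lab_gt0 T; have := size_lab_gt0 X; move: ihT ihX.
  rewrite /= /size_lab /= size_cat -!/(size_lab _).
  set a := size_lab T; set b := size_lab X; nia.
have := scale_cst_sum (size_lab_gt0 Y) (size_lab_gt0 T).
have := size_lab_gt0 T; have := size_lab_gt0 Y; move: ihT ihY.
rewrite /= /size_lab /= size_cat -!/(size_lab _).
set a := size_lab T; set b := size_lab Y; nia.
Qed.

Lemma size_labV v : size_lab (RV v) = 1%N.
Proof. by []. Qed.

Lemma size_labB T X : size_lab (RB T X) = (size_lab T + size_lab X)%N.
Proof. exact: size_cat. Qed.

Lemma size_labR Y y T : size_lab (RR Y y T) = (size_lab Y + size_lab T)%N.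
Proof. exact: size_cat. Qed.

Lemma mu_ltBB T X T' X' : size_lab (RB T X) = size_lab (RB T' X') ->
  (size_lab X < size_lab X')%N -> (mu (RB T X) < mu (RB T' X'))%N.
Proof.
have := scale_cst_sum (size_lab_gt0 T) (size_lab_gt0 X).
have := mu_bound T; have := mu_bound X; rewrite /= !size_labB => hX hT hs <-.
by set c := scale_cst (size_lab T + _) in hs *; nia.
Qed.

Lemma mu_sumBB T X T' X' : size_lab (RB T X) = size_lab (RB T' X') ->
  size_lab X = size_lab X' -> (mu T + mu X < mu T' + mu X')%N ->
  (mu (RB T X) < mu (RB T' X'))%N.
Proof. by move=> /= -> ->; rewrite ltn_add2l. Qed.

Lemma mu_sumRR Y y T Y' y' T' : size_lab (RR Y y T) = size_lab (RR Y' y' T') ->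
  size_lab T = size_lab T' -> (mu Y + mu T < mu Y' + mu T')%N ->
  (mu (RR Y y T) < mu (RR Y' y' T'))%N.
Proof. by move=> /= -> ->; rewrite ltn_add2l. Qed.

Lemma mu_ltRR Y y T Y' y' T' : size_lab (RR Y y T) = size_lab (RR Y' y' T') ->
  (size_lab T < size_lab T')%N -> (mu (RR Y y T) < mu (RR Y' y' T'))%N.
Proof.
have := scale_cst_sum (size_lab_gt0 Y) (size_lab_gt0 T).
have := mu_bound Y; have := mu_bound T; rewrite /= !size_labR => hX hT hs <-.
by set c := scale_cst (size_lab Y + _) in hs *; nia.
Qed.

Lemma mu_ltRB Y y T T' X' : size_lab (RR Y y T) = size_lab (RB T' X') ->
  (mu (RR Y y T) < mu (RB T' X'))%N.
Proof.
have := scale_cst_sum (size_lab_gt0 Y) (size_lab_gt0 T).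
have := mu_bound Y; have := mu_bound T; have := size_lab_gt0 Y.
rewrite /= size_labB size_labR => hY hX hT hs <-.
by set c := scale_cst (size_lab Y + _) in hs *; nia.
Qed.

Lemma size_labE T : normal T -> size_lab T = #|lab T|.
Proof. by case/andP => _ uT; rewrite /size_lab -(card_uniqP uT); apply: eq_card => i; rewrite inE. Qed.

Lemma lab_size T T' : normal T -> normal T' -> lab T = lab T' ->
  size_lab T = size_lab T'.
Proof. by move=> nT nT' e; rewrite !size_labE // e. Qed.

Lemma root_max_eq T T' : lab T = lab T' -> root_max T -> root_max T' ->
  root T = root T'.
Proof.
move=> eL /allP mT /allP mT'; apply/val_inj/eqP; rewrite eqn_leq /=.
rewrite mT' ?mT //; first by have := rootE T'; rewrite -eL inE.
by have := rootE T; rewrite eL inE.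
Qed.

Lemma normalB_max T X : normal (RB T X) -> root_max T.
Proof. by case/andP => /and5P[]. Qed.

Lemma normalR_max Y y T : normal (RR Y y T) ->
  forall i, i \in lab (RR Y y T) -> (i <= root T)%N.
Proof.
case/andP => /and5P[_ _ /allP mT /allP mY _] _ i.
by rewrite labR !inE => /orP[/mY /ltnW|/mT].
Qed.

Lemma lab_cut (A B A' B' : {set 'I_n}) : [disjoint A & B] -> [disjoint A' & B'] ->
  A :|: B = A' :|: B' -> B = B' -> A = A'.
Proof.
move=> d d' eU eB; apply/setP => i; move/setP/(_ i): eU; rewrite !in_setU -eB.
case iB: (i \in B); last by rewrite !orbF.
by rewrite (disjointFl d iB) -eB in d' *; rewrite (disjointFl d' iB).
Qed.

(** The edges of [rgraph T'] inside a subtree of [btree T] connect its labels. For two blue cuts, X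
    misses the common root, hence the cut edge of the second tree, so it lies inside or outside X';
    a shared label puts it inside. For two red cuts, the cut edge of the second tree is a red edge
    at the largest label, which [root_edge_blue] forbids within the lower part of the first, so this
    part lies in the lower part of the second. A strict inclusion lowers [mu], an equality passes to
    both parts. *)
Theorem triangular T T' : normal T -> normal T' -> lab T = lab T' ->
  compat (rgraph T') (btree T) -> T = T' \/ (mu T < mu T')%N.
Proof.
elim: T T' => [v|T ihT X ihX|Y ihY y T ihT] T' nT nT' eL.
- have := lab_size nT nT' eL.
  case: T' nT' eL => [v'|T' X'|Y' y' T'] nT' eL.
  + by move=> _ _; left; have := set11 v; have/setP/(_ v) := eL;
       rewrite !inE eqxx => /esym/eqP ->.
  + rewrite size_labB; have := size_lab_gt0 T'; have := size_lab_gt0 X'.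
    by rewrite size_labV; lia.
  + rewrite size_labR; have := size_lab_gt0 T'; have := size_lab_gt0 Y'.
    by rewrite size_labV; lia.
- have es := lab_size nT nT' eL; have mT := normal_root_maxB nT.
  have [nT1 nX d] := normalB nT.
  case: T' nT' eL es => [v'|T' X'|Y' y' T'] nT' eL es.
  + move: es; rewrite size_labB; have := size_lab_gt0 T; have := size_lab_gt0 X.
    by rewrite size_labV; lia.
  + have [nT1' nX' d'] := normalB nT'.
    have mT' := normal_root_maxB nT'; have eR := root_max_eq eL mT mT'.
    have [e1 e2 _ _] := parent_edgeB nT'.
    case/compat_node => _ cT cX.
    have rX : root T' \notin lab X by rewrite -[root T']eR (disjointFr d (rootE T)).
    have cl := compat_closed (S := mem (lab X')) cX.
    have {}cl : {in lset (btree X) &, forall i j, (i \in lab X') = (j \in lab X')}.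
      apply: cl => e eE we; rewrite !inE.
      move: eE; rewrite inE mem_cat => /or3P[/eqP ee|eT|eX].
      - by move: we; rewrite ee lset_btree // /within /= (negPf rX).
      - case/andP: (allP (rgraph_within nT1') e eT) => f1 f2.
        by have := disjointFr d' f1; have := disjointFr d' f2; rewrite !inE => -> ->.
      - case/andP: (allP (rgraph_within nX') e eX) => f1 f2.
        by move: f1 f2; rewrite !inE => -> ->.
    rewrite lset_btree // in cl.
    (* Both X and X' hold the largest label other than the root: were neither witness shared, each
       would exceed the other. *)
    have [u uX uX'] : exists2 u, u \in lab X & u \in lab X'.
      case/andP: (nT) => /and5P[_ _ _ _ /hasP[u uX /allP hu]] _.
      case/andP: (nT') => /and5P[_ _ _ _ /hasP[u' uX' /allP hu']] _.
      have uX2 : u \in lab X by rewrite inE.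
      have uX2' : u' \in lab X' by rewrite inE.
      case uX'2 : (u \in lab X'); first by exists u.
      case u'X : (u' \in lab X); first by exists u'.
      have uT' : u \in labels T'.
        have : u \in lab (RB T X) by rewrite labB in_setU uX2 orbT.
        by rewrite eL labB in_setU uX'2 orbF inE.
      have u'T : u' \in labels T.
        have : u' \in lab (RB T' X') by rewrite labB in_setU uX2' orbT.
        by rewrite -eL labB in_setU u'X orbF inE.
      have lt1 : (u < u')%N.
        have /orP[/eqP eu|//] := hu' _ uT'.
        by rewrite -eu uX2 in rX.
      have lt2 : (u' < u)%N.
        have /orP[/eqP eu|//] := hu _ u'T.
        have := rootE T'; rewrite -[root T']eR [root _]/= -eu.
        by rewrite (disjointFl d' uX2').
      by have := ltn_trans lt1 lt2; rewrite ltnn.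
    have XX' : lab X \subset lab X'.
      by apply/subsetP => i iX; rewrite (cl _ _ iX uX).
    case: (ltnP (size_lab X) (size_lab X')) => [lt|ge]; first by right; apply: mu_ltBB.
    have eX : lab X = lab X'.
      by apply/eqP; rewrite eqEcard XX' -!size_labE.
    have eT : lab T = lab T' by apply: (lab_cut d d') => //; rewrite -!labB.
    rewrite (compatBl nT') ?lset_btree // in cT.
    rewrite (compatBr nT') ?lset_btree // in cX.
    have sX := lab_size nX nX' eX.
    case: (ihT _ nT1 nT1' eT cT) (ihX _ nX nX' eX cX) => [eqT|ltT] [eqX|ltX].
    * by left; rewrite eqT eqX.
    * by right; apply: mu_sumBB => //; rewrite eqT ltn_add2l.
    * by right; apply: mu_sumBB => //; rewrite eqX ltn_add2r.
    * by right; apply: mu_sumBB => //; rewrite -addSn leq_add // ltnW.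
  + move=> cT; have [e1 e2 e3 e4] := parent_edgeR nT'.
    have eR : root T' = root T.
      apply/val_inj/eqP; rewrite eqn_leq /=; apply/andP; split.
        apply: (allP mT); have : root T' \in lab (RB T X).
          by rewrite eL labR in_setU rootE orbT.
        by rewrite inE.
      apply: (normalR_max nT'); rewrite -eL labB in_setU; by rewrite rootE.
    (* A blue cut against a red cut is impossible: the red edge above the largest label would have
       to be blue. *)
    have : (parent_edge y' (root T')).1.1 = blue.
      apply: (root_edge_blue nT mT cT); first by rewrite mem_head.
      + rewrite eL; apply: crosses_within e3; by rewrite labR ?subsetUl ?subsetUr.
      + apply: contraTneq e3 => /= ->; rewrite /crosses /=.
        have [_ _ d'] := normalR nT'.
        by rewrite (disjointFl d' (rootE T')) andbF.
      + by rewrite /= eR eqxx orbT.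
    by rewrite e4.
- have es := lab_size nT nT' eL.
  have [nY nT1 d] := normalR nT.
  have yY : y \in labels Y by case/andP: (nT) => /and5P[].
  have yY' : y \in leaves (btree Y) by rewrite (perm_mem (perm_leaves_btree nY)).
  case: T' nT' eL es => [v'|T' X'|Y' y' T'] nT' eL es.
  + move: es; rewrite size_labR; have := size_lab_gt0 T; have := size_lab_gt0 Y.
    by rewrite size_labV; lia.
  + by right; apply: mu_ltRB.
  move=> cT; have [nY' nT1' d'] := normalR nT'.
  have mT : root_max T by case/andP: (nT) => /and5P[].
  have [e1 e2 e3 e4] := parent_edgeR nT'.
  have eR : root T' = root T.
    apply/val_inj/eqP; rewrite eqn_leq /=; apply/andP; split.
      by apply: (normalR_max nT); rewrite eL labR in_setU rootE orbT.
    by apply: (normalR_max nT'); rewrite -eL labR in_setU rootE orbT.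
  have /andP[cy cW] := compat_graft_sub yY' (uniq_btree nY) cT.
  have cl := compat_closed (S := mem (lab T')) cW.
  have {}cl : {in lset (btree T) &, forall i j, (i \in lab T') = (j \in lab T')}.
    apply: cl => e eE we; rewrite !inE.
    move: (eE); rewrite inE mem_cat => /or3P[/eqP ee|eY|eT].
    - have : e.1.1 = blue.
        apply: (root_edge_blue nT1 mT cW eE); first by rewrite -lset_btree.
          apply: contraTneq e3; rewrite ee /= => ->; rewrite /crosses /=.
          by rewrite (disjointFl d' (rootE T')) andbF.
        by rewrite ee /= eR eqxx orbT.
      by rewrite ee e4.
    - case/andP: (allP (rgraph_within nY') e eY) => f1 f2.
      by have := disjointFr d' f1; have := disjointFr d' f2; rewrite !inE => -> ->.
    - case/andP: (allP (rgraph_within nT1') e eT) => f1 f2.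
      by move: f1 f2; rewrite !inE => -> ->.
  rewrite lset_btree // in cl.
  have TT' : lab T \subset lab T'.
    by apply/subsetP => i iT; rewrite (cl _ _ iT (rootE T)) -eR rootE.
  case: (ltnP (size_lab T) (size_lab T')) => [lt|ge]; first by right; apply: mu_ltRR.
  have eT : lab T = lab T' by apply/eqP; rewrite eqEcard TT' -!size_labE.
  have eY : lab Y = lab Y'.
    by apply: (lab_cut d d') => //; rewrite -(labR Y y) -(labR Y' y').
  (* The graft asks for an edge between y and the lower part, and the only such edge of the second
     tree starts at y'. *)
  have ey : y = y'.
    case/cross_oneP: cy => e eE [ce _]; rewrite lset_btree // in ce.
    case/orP: ce => /andP[]; rewrite in_set1.
      move=> /eqP ee f2; rewrite -ee.
      apply: (parent_edge_end nT' eE (or_intror erefl)); first by rewrite -eT.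
      by rewrite ee -eY inE.
    move=> f1 /eqP ee; rewrite -ee.
    apply: (parent_edge_end nT' eE (or_introl erefl)); first by rewrite -eT.
    by rewrite ee -eY inE.
  move: cT; rewrite [btree _]/= compat_graft ?uniq_btree //; last first.
    by rewrite !lset_btree // eT eY ey; apply: parent_edge_end.
  case/and3P => cY _ _.
  rewrite (compatRl nT') ?lset_btree // in cY.
  rewrite (compatRr nT') ?lset_btree // in cW.
  have sT := lab_size nT1 nT1' eT.
  case: (ihY _ nY nY' eY cY) (ihT _ nT1 nT1' eT cW) => [eqY|ltY] [eqT|ltT].
  * by left; rewrite eqT eqY ey.
  * by right; apply: mu_sumRR => //; rewrite eqY ltn_add2l.
  * by right; apply: mu_sumRR => //; rewrite eqT ltn_add2r.
  * by right; apply: mu_sumRR => //; rewrite -addSn leq_add // ltnW.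
Qed.

End Triangular.

(** * Normal trees span the Lie side *)

Section LieSpan.
Variables (R : comPzRingType) (n : nat) (V : lmodType R) (B : two_lie V).
Variable mon : tree n -> V.
Hypothesis monN : forall c l r, mon (Node c l r) = B c (mon l) (mon r).
(** The substitution of a red bracket for the generator y. Its linearity allows a red cut to be
    removed, the rest to be expanded, and the cut to be put back in each term. *)
Hypothesis mon_graft : forall y s, exists2 f : V -> V, linear f &
  forall t, f (mon t) = mon (graft t y s).
Implicit Types (s t l r : tree n) (T X Y W : rtree n) (A : {set 'I_n}) (v : 'I_n).

Definition normal_mon A (x : V) : Prop :=
  exists T, [/\ normal T, lab T = A & x = mon (btree T)].
Definition normal_mon_max A (x : V) : Prop :=
  exists T, [/\ normal T, lab T = A, root_max T & x = mon (btree T)].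

Lemma span_normal T : normal T -> mon (btree T) \in span (normal_mon (lab T)).
Proof. by move=> nT; apply: mem_span; exists T. Qed.

Lemma span_normal_max A x : x \in span (normal_mon_max A) ->
  x \in span (normal_mon A).
Proof.
by apply: span_trans => y [T [nT <- _ ->]]; apply: span_normal.
Qed.

Lemma span_brkr (S : V -> Prop) (K : submodClosed V) c x z :
  (forall w, S w -> B c x w \in K) -> z \in span S -> B c x z \in K.
Proof. by move=> h; apply: span_linear => //; apply: brk_linr. Qed.

Lemma span_brkl (S : V -> Prop) (K : submodClosed V) c x z :
  (forall w, S w -> B c w x \in K) -> z \in span S -> B c z x \in K.
Proof. by move=> h; apply: (span_linear (brk_linl B c x)). Qed.

Lemma exists_max T : exists2 u, u \in labels T & forall a, a \in labels T -> (a <= u)%N.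
Proof.
case: (@arg_maxnP _ (root T) (mem (labels T)) val); first exact: root_in.
by move=> u uT hu; exists u.
Qed.

Lemma root_maxP T v : root_max T -> v \in lab T ->
  (forall i, i \in lab T -> (i <= v)%N) -> root T = v.
Proof.
move=> /allP mT vT hv; apply/val_inj/eqP; rewrite eqn_leq /=.
by rewrite hv ?rootE // mT //; rewrite inE in vT.
Qed.

Lemma normal_consB T X : normal T -> normal X -> [disjoint lab T & lab X] ->
    root_max T -> (forall i, i \in lab X -> (i < root T)%N) ->
    (exists2 u, u \in lab X & forall a, a \in lab T -> a != root T -> (a < u)%N) ->
  normal (RB T X).
Proof.
move=> /andP[gT uT] /andP[gX uX] d mT lt [u uX' hu].
apply/andP; split; last first.
  rewrite /= cat_uniq uT uX andbT /=; apply/hasPn => i iX; apply/negP => iT.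
  by have := disjointFr d (x := i); rewrite !inE iT iX => /(_ isT).
rewrite /= gT gX mT /=; apply/andP; split.
  by apply/allP => i iX; apply: lt; rewrite inE.
apply/hasP; exists u; first by rewrite inE in uX'.
apply/allP => a aT; case: eqP => //= /eqP ne; apply: hu => //; by rewrite inE.
Qed.

Lemma normal_consR Y y T : normal Y -> normal T -> [disjoint lab Y & lab T] ->
    root_max T -> (forall i, i \in lab Y -> (i < root T)%N) -> y \in lab Y ->
  normal (RR Y y T).
Proof.
move=> /andP[gY uY] /andP[gT uT] d mT lt yY.
apply/andP; split; last first.
  rewrite /= cat_uniq uT uY andbT /=; apply/hasPn => i iT; apply/negP => iY.
  by have := disjointFr d (x := i); rewrite !inE iY iT => /(_ isT).
rewrite /= gT gY mT /=; apply/andP; split; last by rewrite inE in yY.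
by apply/allP => i iY; apply: lt; rewrite inE.
Qed.

Lemma normalB_lt T X : normal (RB T X) -> forall i, i \in lab X -> (i < root T)%N.
Proof. by case/andP => /and5P[_ _ _ /allP h _] _ i; rewrite inE; apply: h. Qed.

Lemma normalB_sorted T X : normal (RB T X) -> exists2 u, u \in lab X &
  (forall a, a \in lab X -> (a <= u)%N) /\
  (forall a, a \in lab T -> a != root T -> (a < u)%N).
Proof.
case/andP => /and5P[_ _ _ _ /hasP[u uX /allP hu]] _.
have [m mX hm] := exists_max X; exists m; rewrite ?inE //; split=> a.
  by rewrite inE; apply: hm.
rewrite inE => /hu + /negPf ne; rewrite ne /= => /leq_trans; apply; exact: hm.
Qed.

Section Step.
Variable N : nat.
Hypothesis IH : forall s, uniq (leaves s) -> (#|lset s| < N)%N ->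
  mon s \in span (normal_mon (lset s)).

Lemma card_lt_disjoint A1 A2 v : [disjoint A1 & A2] -> v \in A1 ->
  (#|A1 :|: A2| <= N)%N -> (#|A2| < N)%N.
Proof.
move=> d vA /(leq_trans _); apply; apply: proper_card.
apply/properP; split; first exact: subsetUr.
by exists v; rewrite ?inE ?vA // (disjointFr d vA).
Qed.

Lemma uniq_node c l r : uniq (leaves l) -> uniq (leaves r) ->
  [disjoint lset l & lset r] -> uniq (leaves (Node c l r)).
Proof.
move=> ul ur d; rewrite /= cat_uniq ul ur andbT /=; apply/hasPn => i ir.
by apply/negP => il; have := disjointFr d (x := i); rewrite !inE il ir => /(_ isT).
Qed.

Lemma disjointUr (A A1 A2 : {set 'I_n}) :
  [disjoint A & A1 :|: A2] = [disjoint A & A1] && [disjoint A & A2].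
Proof. by rewrite -!setI_eq0 setIUr setU_eq0. Qed.

Lemma disjointUl (A A1 A2 : {set 'I_n}) :
  [disjoint A1 :|: A2 & A] = [disjoint A1 & A] && [disjoint A2 & A].
Proof. by rewrite -!setI_eq0 setIUl setU_eq0. Qed.

(** Insertion sort of the branches of a blue comb by their largest labels. If X, from the expansion
    of s, has a larger label than the last branch X0, it is appended. Otherwise Jacobi joins X to X0
    into one branch, or moves X inside past X0. The stronger conclusion that the root stays the
    largest label lets X0 be put back at the end. *)
Lemma span_blue T s : normal T -> root_max T -> uniq (leaves s) ->
    [disjoint lab T & lset s] -> (forall i, i \in lset s -> (i < root T)%N) ->
    (#|lab T :|: lset s| <= N)%N ->
  B blue (mon (btree T)) (mon s) \in span (normal_mon_max (lab T :|: lset s)).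
Proof.
elim: T s => [v|T0 ih0 X0 _|Y _ y T _] s nT mT us d lt card; last first.
- by have := root_maxR nT; rewrite mT.
- have := IH us (card_lt_disjoint d (rootE _) card).
  apply: span_brkr => _ [X [nX eX ->]]; rewrite -eX in d lt card *.
  have [nT0 nX0 d0] := normalB nT.
  have [u uX0 [hu1 hu2]] := normalB_sorted nT.
  have [m mX hm] := exists_max X.
  have mT0 := normalB_max nT.
  have mX' : m \in lab X by rewrite inE.
  have [ltum|leum] := ltnP u m.
    apply: mem_span; exists (RB (RB T0 X0) X); split; rewrite ?labB //.
    + apply: normal_consB => //; exists m => // a; rewrite labB in_setU.
      case/orP => [aT0 ne|aX0 _]; first exact: ltn_trans (hu2 _ aT0 ne) ltum.
      exact: leq_ltn_trans (hu1 _ aX0) ltum.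
    + rewrite /root_max /= all_cat [X in X && _]mT /=; apply/allP => i iX.
      by apply/ltnW/lt; rewrite inE.
    + by rewrite /= !monN.
  move: d card; rewrite labB disjointUl => /andP[dT0X dX0X] card.
  rewrite [mon _]/= monN brk_derivation; apply: rpredD.
    rewrite -monN -setUA -{1}(lset_btree nX0) -{1}(lset_btree nX).
    rewrite -(lset_node blue); apply: ih0 => //.
    - apply: uniq_node; rewrite ?uniq_btree // !lset_btree //.
    - by rewrite lset_node !lset_btree // disjointUr d0.
    - move=> i; rewrite lset_node !lset_btree // in_setU => /orP[|].
        exact: normalB_lt nT _.
      exact: lt.
    - by rewrite lset_node !lset_btree // setUA.
  rewrite -brkC; have : B blue (mon (btree T0)) (mon (btree X)) \in
      span (normal_mon_max (lab T0 :|: lset (btree X))).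
    apply: ih0 => //; rewrite ?uniq_btree // ?lset_btree //.
    apply: leq_trans (subset_leq_card _) card; rewrite -setUA setUS //.
    exact: subsetUr.
  apply: span_brkl => _ [T' [nT' eT' mT' ->]]; rewrite lset_btree // in eT'.
  have rT' : root T' = root T0.
    apply: root_maxP => //; first by rewrite eT' in_setU rootE.
    move=> i; rewrite eT' in_setU => /orP[iT0|/lt/ltnW//].
    by apply: (allP mT0); rewrite inE in iT0.
  have eL : lab T' :|: lab X0 = lab T0 :|: lab X0 :|: lab X.
    by rewrite eT' setUAC.
  have nB : normal (RB T' X0).
    apply: normal_consB => //.
    - by rewrite eT' disjointUl d0 disjoint_sym.
    - by move=> i iX0; rewrite rT'; apply: normalB_lt nT _ iX0.
    - exists u => // a; rewrite eT' rT' in_setU => /orP[aT0|aX _]; first exact: hu2.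
      have am : (a <= m)%N by apply: hm; rewrite inE in aX.
      rewrite ltn_neqAle (leq_trans am leum) andbT.
      apply: contraTneq aX => /val_inj ->; by rewrite (disjointFr dX0X uX0).
  apply: mem_span; exists (RB T' X0); split=> //; first by rewrite labB.
    exact: normal_root_maxB.
  by rewrite /= !monN.
- have := IH us (card_lt_disjoint d (rootE _) card).
  apply: span_brkr => _ [X [nX eX ->]]; rewrite -eX in d lt card *.
  have nB : normal (RB (RV v) X).
    apply: normal_consB => //; exists (root X); first exact: rootE.
    by move=> a; rewrite !inE => ->.
  apply: mem_span; exists (RB (RV v) X); split=> //; first exact: labB.
    exact: normal_root_maxB.
  by rewrite /= !monN.
Qed.

(** Since y is no leaf of s, bracketing with s commutes with the substitution at y. The bracket of s
    with Y has fewer labels, is expanded by [IH], and grafting T restores normal trees. *)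
Lemma span_graft c s Y y T : uniq (leaves s) -> normal (RR Y y T) ->
    [disjoint lset s & lab (RR Y y T)] ->
    (forall i, i \in lset s -> (i < root T)%N) ->
    (#|lset s :|: lab (RR Y y T)| <= N)%N ->
  B c (mon s) (mon (btree (RR Y y T)))
    \in span (normal_mon (lset s :|: lab (RR Y y T))).
Proof.
move=> us nT d lt card; have [nY nT1 dYT] := normalR nT.
have yY : y \in lab Y by case/andP: (nT) => /and5P[_ _ _ _ yY] _; rewrite inE.
move: d; rewrite labR disjointUr => /andP[dsY dsT].
have ys : y \notin leaves s.
  by apply/negP => ys; have := disjointFr dsY (x := y); rewrite yY inE ys => /(_ isT).
have [f f_lin f_mon] := mon_graft y (btree T).
have -> : B c (mon s) (mon (btree (RR Y y T))) = f (mon (Node c s (btree Y))).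
  by rewrite f_mon /= (graft_notin _ ys) monN.
have := IH (s := Node c s (btree Y)); rewrite lset_node lset_btree // => h.
have {}h : mon (Node c s (btree Y)) \in span (normal_mon (lset s :|: lab Y)).
  apply: h; first by apply: uniq_node; rewrite ?uniq_btree ?lset_btree.
  apply: leq_trans card; apply: proper_card; rewrite labR setUA.
  apply/properP; split; first exact: subsetUl.
  exists (root T); first by rewrite in_setU rootE orbT.
  by rewrite in_setU (disjointFl dsT (rootE T)) (disjointFl dYT (rootE T)).
apply: span_linear f_lin _ h => _ [Y' [nY' eY' ->]]; rewrite f_mon.
rewrite -/(btree (RR Y' y T)) setUA -eY' -(labR Y' y); apply: span_normal.
apply: normal_consR => //.
- by rewrite eY' disjointUl dsT.
- by case/andP: (nT) => /and5P[].
- move=> i; rewrite eY' in_setU => /orP[/lt //|iY].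
  by case/andP: (nT) => /and5P[_ _ _ /allP h _] _; apply: h; rewrite inE in iY.
- by rewrite eY' in_setU yY orbT.
Qed.

(** Singled out because [span_brk_max] consumes it inside the induction on s that proves it. *)
Definition red_spans s := forall T, normal T -> root_max T ->
  [disjoint lset s & lab T] -> (forall i, i \in lset s -> (i < root T)%N) ->
  (#|lset s :|: lab T| <= N)%N ->
  B red (mon s) (mon (btree T)) \in span (normal_mon (lset s :|: lab T)).

Lemma span_brk_max c s A v z : uniq (leaves s) -> red_spans s ->
    [disjoint lset s & A] -> v \in A -> (forall i, i \in A -> (i <= v)%N) ->
    (forall i, i \in lset s -> (i < v)%N) -> (#|lset s :|: A| <= N)%N ->
  z \in span (normal_mon A) -> B c (mon s) z \in span (normal_mon (lset s :|: A)).
Proof.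
move=> us rs d vA hv lt card; apply: span_brkr => _ [T [nT eA ->]].
rewrite -{A}eA in d vA hv card *.
case mT : (root_max T).
  have rT : root T = v by apply: root_maxP.
  rewrite -rT in lt; case: c; last exact: rs.
  rewrite brkC spanN setUC; apply/span_normal_max/span_blue => //.
    by rewrite disjoint_sym.
  by rewrite setUC.
case: T nT d vA hv card mT => [x|T X|Y y T] nT d vA hv card mT.
- by rewrite /root_max /= leqnn in mT.
- by rewrite normal_root_maxB in mT.
apply: span_graft => // i /lt iv; apply: leq_trans iv _.
exact: normalR_max nT _ vA.
Qed.

(** For a leaf the bracket is already the monomial of a red cut. A bracket of s1 and s2 acts through
    the successive actions of s1 and s2; if it is blue, the compatibility relation also leaves a
    blue bracket with T, covered by [span_blue]. *)
Lemma span_red s : uniq (leaves s) -> red_spans s.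
Proof.
elim: s => [y|c s1 ih1 s2 ih2] us T nT mT d lt card.
  have ey : lset (Leaf y) = lab (RV y) by apply/setP => i; rewrite !inE.
  rewrite ey in d lt *; rewrite -(labR _ y) -monN.
  have -> : Node red (Leaf y) (btree T) = btree (RR (RV y) y T).
    by rewrite /= eqxx.
  by apply: span_normal; apply: normal_consR => //; rewrite !inE.
have [us1 us2 d12] := uniq_disjoint us.
move: d; rewrite lset_node disjointUl => /andP[d1 d2].
have lt1 i : i \in lset s1 -> (i < root T)%N.
  by move=> i1; apply: lt; rewrite lset_node in_setU i1.
have lt2 i : i \in lset s2 -> (i < root T)%N.
  by move=> i2; apply: lt; rewrite lset_node in_setU i2 orbT.
rewrite lset_node in card.
have card1 : (#|lset s1 :|: lab T| <= N)%N.
  by apply: leq_trans (subset_leq_card _) card; rewrite setSU // subsetUl.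
have card2 : (#|lset s2 :|: lab T| <= N)%N.
  by apply: leq_trans (subset_leq_card _) card; rewrite setSU // subsetUr.
have rT := rootE T.
have maxT i : i \in lab T -> (i <= root T)%N by rewrite inE => /(allP mT).
have max2 sx i : (forall i, i \in lset sx -> (i < root T)%N) ->
    i \in lset sx :|: lab T -> (i <= root T)%N.
  by move=> l; rewrite in_setU => /orP[/l/ltnW|/maxT].
have e1 : lset s1 :|: lset s2 :|: lab T = lset s1 :|: (lset s2 :|: lab T).
  by rewrite setUA.
have e2 : lset s1 :|: lset s2 :|: lab T = lset s2 :|: (lset s1 :|: lab T).
  by rewrite setUCA setUA.
have step1 b z : z \in span (normal_mon (lset s2 :|: lab T)) ->
    B b (mon s1) z \in span (normal_mon (lset s1 :|: lset s2 :|: lab T)).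
  rewrite e1; apply: span_brk_max (ih1 us1) _ _ _ lt1 _ => //.
  - by rewrite disjointUr d12.
  - by rewrite in_setU rT orbT.
  - by move=> i; apply: max2.
  - by rewrite -e1.
have step2 b z : z \in span (normal_mon (lset s1 :|: lab T)) ->
    B b (mon s2) z \in span (normal_mon (lset s1 :|: lset s2 :|: lab T)).
  rewrite e2; apply: span_brk_max (ih2 us2) _ _ _ lt2 _ => //.
  - by rewrite disjointUr d2 disjoint_sym d12.
  - by rewrite in_setU rT orbT.
  - by move=> i; apply: max2.
  - by rewrite -e2.
have blue_in sx : uniq (leaves sx) -> [disjoint lset sx & lab T] ->
    (forall i, i \in lset sx -> (i < root T)%N) -> (#|lset sx :|: lab T| <= N)%N ->
    B blue (mon sx) (mon (btree T)) \in span (normal_mon (lset sx :|: lab T)).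
  move=> usx dx ltx cx; rewrite brkC spanN setUC.
  apply/span_normal_max/span_blue => //; first by rewrite disjoint_sym.
  by rewrite setUC.
have r1 := step1 _ _ (ih2 us2 T nT mT d2 lt2 card2).
have r2 := step2 _ _ (ih1 us1 T nT mT d1 lt1 card1).
have b1 := step1 red _ (blue_in _ us2 d2 lt2 card2).
have b2 := step2 red _ (blue_in _ us1 d1 lt1 card1).
rewrite monN; case: c us lt => us lt; last first.
  by rewrite brk_derivation; apply: rpredD; rewrite ?spanN.
rewrite brk_derivation2; do 4?[apply: rpredD]; rewrite ?spanN //.
rewrite -monN -(lset_node red); apply: blue_in => //.
- by rewrite lset_node disjointUl d1.
- by rewrite lset_node.
Qed.

(** Only the child containing the largest label v is expanded; antisymmetry puts it second, and the
    other child then acts on it by [span_brk_max]. *)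
Lemma span_step s v : uniq (leaves s) -> v \in lset s ->
    (forall i, i \in lset s -> (i <= v)%N) -> (#|lset s| <= N)%N ->
  mon s \in span (normal_mon (lset s)).
Proof.
elim: s => [y|c l ihl r ihr] us.
  move=> _ _ _; have -> : lset (Leaf y) = lab (RV y) by apply/setP => i; rewrite !inE.
  by apply: (span_normal (T := RV y)).
have [ul ur d] := uniq_disjoint us; rewrite lset_node => vs hv card.
have max_l i : i \in lset l -> (i <= v)%N by move=> il; apply: hv; rewrite in_setU il.
have max_r i : i \in lset r -> (i <= v)%N.
  by move=> ir; apply: hv; rewrite in_setU ir orbT.
have card_l : (#|lset l| <= N)%N := leq_trans (subset_leq_card (subsetUl _ _)) card.
have card_r : (#|lset r| <= N)%N := leq_trans (subset_leq_card (subsetUr _ _)) card.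
rewrite monN; move: vs; rewrite in_setU => /orP[vl|vr].
  rewrite brkC spanN setUC.
  apply: (span_brk_max c ur (span_red ur) _ vl max_l _ _ (ihl ul vl max_l card_l)).
  - by rewrite disjoint_sym.
  - move=> i ir; rewrite ltn_neqAle max_r // andbT.
    by apply: contraTneq ir => /val_inj ->; rewrite (disjointFr d vl).
  - by rewrite setUC.
apply: (span_brk_max c ul (span_red ul) d vr max_r _ card (ihr ur vr max_r card_r)).
move=> i il; rewrite ltn_neqAle max_l // andbT.
by apply: contraTneq il => /val_inj ->; rewrite (disjointFl d vr).
Qed.

End Step.

Lemma normal_mon_span s : uniq (leaves s) -> mon s \in span (normal_mon (lset s)).
Proof.
have [N sN] := ubnP #|lset s|; elim: N s sN => // N IH s sN us.
have [i il] : exists i, i \in lset s.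
  clear; elim: s => [i|c l [i il] r _]; first by exists i; rewrite !inE.
  by exists i; rewrite lset_node in_setU il.
case: (@arg_maxnP _ i (mem (lset s)) val) => // v vs hv.
apply: (span_step (N := N) _ (v := v)) => // s' us' s'N.
exact: IH.
Qed.

End LieSpan.

(** * Normal trees span the graph side *)

Lemma count_cons (T : Type) (a : pred T) x s : count a (x :: s) = (a x + count a s)%N.
Proof. by []. Qed.

Lemma count_nil (T : Type) (a : pred T) : count a [::] = 0%N.
Proof. by []. Qed.

(* Closes a perm_eq goal that follows from perm_eq hypotheses by counting. *)
Ltac perm_lia :=
  let a := fresh "a" in apply/permP => a;
  repeat match goal with
  | H : is_true (@perm_eq _ _ _) |- _ =>
      first [move/permP/(_ a): H => H | clear H]
  end;
  repeat match goal with
  | H : count a _ = count a _ |- _ => rewrite ?(count_cat, count_cons, count_nil) in H; revert H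
  end;
  rewrite ?(count_cat, count_cons, count_nil);
  repeat match goal with
  | |- context [count a ?s] => let x := fresh "x" in
      set x := (count a s); clearbody x
  end;
  repeat match goal with
  | |- context [nat_of_bool (a ?e)] => let x := fresh "x" in
      set x := (nat_of_bool (a e)); clearbody x
  end;
  clear; lia.

Section RootedEdges.
Variable n : nat.
Implicit Types (A S W X Y : seq 'I_n) (E F : seq (rawedge n)) (c : color).
Implicit Types (i j p r v x y : 'I_n).

(** Trees as the closure of single vertices under joining by an edge, up to reordering the lists:
    this supplies an induction without any notion of path. *)
Inductive tree_on : seq 'I_n -> seq (rawedge n) -> Prop :=
| tree_on1 i : tree_on [:: i] [::]
| tree_on_join c i j A1 A2 E1 E2 : tree_on A1 E1 -> tree_on A2 E2 ->
    i \in A1 -> j \in A2 -> tree_on (A1 ++ A2) ((c, i, j) :: E1 ++ E2)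
| tree_on_perm A A' E E' : perm_eq A A' -> perm_eq E E' ->
    tree_on A E -> tree_on A' E'.

(* A tree_on in which every edge is parent_edge p x, with p the parent of x. *)
Inductive rooted : seq 'I_n -> 'I_n -> seq (rawedge n) -> Prop :=
| rooted1 r : rooted [:: r] r [::]
| rooted_join A1 r E1 A2 x E2 p : rooted A1 r E1 -> rooted A2 x E2 ->
    p \in A1 -> rooted (A1 ++ A2) r (parent_edge p x :: E1 ++ E2)
| rooted_perm A A' r E E' : perm_eq A A' -> perm_eq E E' ->
    rooted A r E -> rooted A' r E'.

Lemma rooted_root A r E : rooted A r E -> r \in A.
Proof.
elim=> [i|A1 r1 E1 A2 x E2 p _ r1A _ _ _|A1 A2 r1 E1 E2 pA _ _ rA].
- exact: mem_head.
- by rewrite mem_cat r1A.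
- by rewrite -(perm_mem pA).
Qed.

Lemma rooted_tree_on A r E : rooted A r E -> tree_on A E.
Proof.
elim=> [i|A1 r1 E1 A2 x E2 p _ t1 r2 t2 pA|A1 A2 r1 E1 E2 pA pE _ t].
- exact: tree_on1.
- by apply: tree_on_join => //; apply: rooted_root r2.
- exact: tree_on_perm pA pE t.
Qed.

Lemma tree_on_join_sym c i j A1 A2 E1 E2 : tree_on A1 E1 -> tree_on A2 E2 ->
  i \in A1 -> j \in A2 -> tree_on (A1 ++ A2) ((c, j, i) :: E1 ++ E2).
Proof.
move=> t1 t2 i1 j2; apply: tree_on_perm (tree_on_join c t2 t1 j2 i1).
  by rewrite perm_catC.
by rewrite perm_cons perm_catC.
Qed.

Lemma rooted_split A r E x : rooted A r E -> x \in A -> x != r ->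
  exists A1 E1 A2 E2 p, [/\ rooted A1 r E1, rooted A2 x E2, p \in A1,
    perm_eq A (A1 ++ A2) & perm_eq E (parent_edge p x :: E1 ++ E2)].
Proof.
elim=> [i|A1 r1 E1 A2 x2 E2 p h1 ih1 h2 ih2 pA|A1 A2 r1 E1 E2 pA pE h ih].
- by rewrite inE => ->.
- rewrite mem_cat; have [x1 _ ne|nx1 /= xA2 ne] := boolP (x \in A1).
    have [B1 [F1 [B2 [F2 [q [g1 g2 qB pB pF]]]]]] := ih1 x1 ne.
    have : p \in B1 ++ B2 by rewrite -(perm_mem pB).
    rewrite mem_cat => /orP[pB1|pB2].
      exists (B1 ++ A2), (parent_edge p x2 :: F1 ++ E2), B2, F2, q.
      split=> //; first exact: rooted_join; first by rewrite mem_cat qB.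
      + perm_lia.
      + perm_lia.
    exists B1, F1, (B2 ++ A2), (parent_edge p x2 :: F2 ++ E2), q.
    split=> //; first exact: rooted_join.
    + perm_lia.
    + perm_lia.
  have [ex|nex] := eqVneq x x2.
    by exists A1, E1, A2, E2, p; split; rewrite // ex.
  have [B1 [F1 [B2 [F2 [q [g1 g2 qB pB pF]]]]]] := ih2 xA2 nex.
  exists (A1 ++ B1), (parent_edge p x2 :: E1 ++ F1), B2, F2, q.
  split=> //; first exact: rooted_join; first by rewrite mem_cat qB orbT.
  + perm_lia.
  + perm_lia.
- rewrite -(perm_mem pA) => /ih{}ih /ih[B1 [F1 [B2 [F2 [q [g1 g2 qB pB pF]]]]]].
  exists B1, F1, B2, F2, q; split=> //.
    by rewrite -(permPl pA).
  by rewrite -(permPl pE).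
Qed.

(** The number counts the edges from the root r down to x; it is the inner measure when a blue
    branch is absorbed. *)
Inductive rooted_depth : nat -> seq 'I_n -> 'I_n -> 'I_n -> seq (rawedge n) -> Prop :=
| depth0 A r E : rooted A r E -> rooted_depth 0 A r r E
| depthS d A1 r p E1 A2 x E2 A E : rooted_depth d A1 r p E1 -> rooted A2 x E2 ->
    perm_eq A (A1 ++ A2) -> perm_eq E (parent_edge p x :: E1 ++ E2) ->
    rooted_depth d.+1 A r x E.

Lemma rooted_depth_in d A r x E : rooted_depth d A r x E -> rooted A r E /\ x \in A.
Proof.
elim=> [A1 r1 E1 h|e A1 r1 p E1 A2 x1 E2 A' E' _ [h1 pA] h2 pA' pE'].
  by split; rewrite // (rooted_root h).
split; last by rewrite (perm_mem pA') mem_cat (rooted_root h2) orbT.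
apply: rooted_perm (rooted_join h1 h2 pA); by rewrite perm_sym.
Qed.

Lemma rooted_depth_add d A r p E A2 x E2 : rooted_depth d A r p E ->
  rooted A2 x E2 -> rooted_depth d (A ++ A2) r p (parent_edge p x :: E ++ E2).
Proof.
move=> h h2; case: h h2 => [A1 r1 E1 h|e A1 r1 q E1 A3 p3 E3 A' E' h1 h3 pA pE] h2.
  by apply: depth0; apply: rooted_join => //; apply: rooted_root h.
have h32 := rooted_join h3 h2 (rooted_root h3).
apply: depthS h1 h32 _ _.
  perm_lia.
perm_lia.
Qed.

Lemma rooted_size A r E : rooted A r E -> (0 < size A)%N.
Proof. by move/rooted_root; case: A. Qed.

Lemma rooted_depth_exists A r E x : rooted A r E -> x \in A ->
  exists d, rooted_depth d A r x E.
Proof.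
have [N sN] := ubnP (size A); elim: N A E x sN => // N IH A E x sN h xA.
have [->|ne] := eqVneq x r; first by exists 0; apply: depth0.
have [A1 [E1 [A2 [E2 [p [h1 h2 pA1 pA pE]]]]]] := rooted_split h xA ne.
have sA1 : (size A1 < N)%N.
  apply: leq_trans (_ : size A <= N)%N => //.
  by rewrite (perm_size pA) size_cat -addn1 leq_add2l (rooted_size h2).
have [d hd] := IH _ _ _ sA1 h1 pA1.
by exists d.+1; apply: depthS hd h2 pA pE.
Qed.

(** A tree seen from v, with v itself left out of the list: each branch hangs from v by a single
    edge of arbitrary color and direction. *)
Inductive star v : seq 'I_n -> seq (rawedge n) -> Prop :=
| star0 : star v [::] [::]
| starS c x e X EX S ES : tree_on X EX -> x \in X ->
    e = (c, v, x) \/ e = (c, x, v) -> star v S ES ->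
    star v (X ++ S) (e :: EX ++ ES).

Lemma star_attach v S ES i A E j c e : star v S ES -> i \in S -> tree_on A E ->
    j \in A -> e = (c, i, j) \/ e = (c, j, i) ->
  exists S' ES', [/\ star v S' ES', perm_eq S' (S ++ A) & perm_eq ES' (e :: ES ++ E)].
Proof.
move=> + + tA jA he; elim=> // c1 x f X EX S1 ES1 tX xX hf hs ih.
rewrite mem_cat; have [iX _|_ /= /ih] := boolP (i \in X).
  have tXA : tree_on (X ++ A) (e :: EX ++ E).
    by case: he => ->; [apply: tree_on_join|apply: tree_on_join_sym].
  exists ((X ++ A) ++ S1), (f :: (e :: EX ++ E) ++ ES1); split.
  + by apply: starS tXA _ hf hs; rewrite mem_cat xX.
  + perm_lia.
  + perm_lia.
move=> [S' [ES' [hs' pS pE]]]; exists (X ++ S'), (f :: EX ++ ES'); split.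
+ exact: starS tX xX hf hs'.
+ perm_lia.
+ perm_lia.
Qed.

Lemma tree_on_star A E v : tree_on A E -> v \in A ->
  exists S ES, [/\ star v S ES, perm_eq A (v :: S) & perm_eq E ES].
Proof.
elim=> [i|c i j A1 A2 E1 E2 t1 ih1 t2 ih2 iA jA|A1 A2 E1 E2 pA pE t ih].
- by rewrite inE => /eqP ->; exists [::], [::]; split=> //; apply: star0.
- have half : forall i j A1 A2 E1 E2 e, e = (c, i, j) \/ e = (c, j, i) ->
      tree_on A2 E2 -> i \in A1 -> j \in A2 ->
      (exists S ES, [/\ star v S ES, perm_eq A1 (v :: S) & perm_eq E1 ES]) ->
      exists S ES, [/\ star v S ES, perm_eq (A1 ++ A2) (v :: S)
        & perm_eq (e :: E1 ++ E2) ES].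
    clear; move=> i j A1 A2 E1 E2 e he t2 iA jA [S [ES [hs pA pE]]].
    have : i \in v :: S by rewrite -(perm_mem pA).
    rewrite inE => /orP[/eqP ei|iS].
      exists (A2 ++ S), (e :: E2 ++ ES); split.
      + by apply: starS t2 jA _ hs; rewrite -ei; exact: he.
      + perm_lia.
      + perm_lia.
    have [S' [ES' [hs' pS' pE']]] := star_attach hs iS t2 jA he.
    exists S', ES'; split=> //.
      perm_lia.
    perm_lia.
  rewrite mem_cat => /orP[vA|vA].
    exact: (half i j A1 A2 E1 E2 _ (or_introl erefl) t2 iA jA (ih1 vA)).
  have [S [ES [hs pA pE]]] := half j i A2 A1 E2 E1 (c, i, j) (or_intror erefl)
    t1 jA iA (ih2 vA).
  exists S, ES; split=> //.
    by rewrite -(permPr pA) perm_catC.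
  by rewrite -(permPr pE) perm_cons perm_catC.
- rewrite -(perm_mem pA) => /ih[S [ES [hs pS pES]]]; exists S, ES; split=> //.
    by rewrite -(permPl pA).
  by rewrite -(permPl pE).
Qed.

End RootedEdges.

(** * Rewriting trees into rooted trees modulo the relations *)

Section EilSpan.
Variables (R : comPzRingType) (n : nat) (V : lmodType R).
Variables (q : seq (rawedge n) -> V) (K : submodClosed V).
Implicit Types (A S W X Y : seq 'I_n) (E F : seq (rawedge n)) (c : color).
Implicit Types (i j k p r v x y : 'I_n).

Hypothesis q_perm : forall E E', perm_eq E E' -> q E = q E'.
Hypothesis q_flip : forall c i j E, i != j ->
  q ((c, i, j) :: E) = - q ((c, j, i) :: E).
Hypothesis q_cyc : forall c i j k E, i != j -> j != k -> k != i ->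
  q ((c, i, j) :: (c, j, k) :: E) + q ((c, j, k) :: (c, k, i) :: E)
  + q ((c, k, i) :: (c, i, j) :: E) = 0.
Hypothesis q_mixed : forall i j k E, i != j -> j != k -> k != i ->
  (q ((blue, i, j) :: (red, j, k) :: E) + q ((red, i, j) :: (blue, j, k) :: E))
  + (q ((blue, j, k) :: (red, k, i) :: E) + q ((red, j, k) :: (blue, k, i) :: E))
  + (q ((blue, k, i) :: (red, i, j) :: E) + q ((red, k, i) :: (blue, i, j) :: E))
  = 0.

(** Here q plays the class of an edge list and K the span of the rooted trees. Working with
    membership turns each relation into a rule that deduces one term from the others, and signs
    disappear. *)
Let qK E := q E \in K.

Lemma qK_perm E E' : perm_eq E E' -> qK E -> qK E'.
Proof. by move=> EE'; rewrite /qK (q_perm EE'). Qed.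

Let memN u : (- u \in K) = (u \in K).
Proof.
have h w : w \in K -> - w \in K by move=> hw; rewrite -scaleN1r; apply: rpredZ.
by apply/idP/idP => /h; rewrite ?opprK.
Qed.

Let sum_mem (u w : V) : u + w = 0 -> w \in K -> u \in K.
Proof.
by move=> uw wK; have /eqP -> : u == - w; rewrite ?memN // -addr_eq0 uw.
Qed.

Lemma qK_flip c i j E : i != j -> qK ((c, i, j) :: E) -> qK ((c, j, i) :: E).
Proof. by move=> ij; rewrite /qK q_flip // memN. Qed.

Lemma qK_flip2 e c i j E : i != j ->
  qK (e :: (c, i, j) :: E) -> qK (e :: (c, j, i) :: E).
Proof.
move=> ij h; apply: (qK_perm (E := (c, j, i) :: e :: E)); first by perm_lia.
by apply: qK_flip => //; apply: qK_perm h; perm_lia.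
Qed.

Lemma qK_cyc c i j k E : i != j -> j != k -> k != i ->
  qK ((c, j, k) :: (c, k, i) :: E) -> qK ((c, k, i) :: (c, i, j) :: E) ->
  qK ((c, i, j) :: (c, j, k) :: E).
Proof.
move=> ij jk ki h1 h2; apply: (sum_mem _ (rpredD h1 h2)).
by rewrite addrA q_cyc.
Qed.

Lemma qK_mixed i j k E : i != j -> j != k -> k != i ->
  qK ((red, i, j) :: (blue, j, k) :: E) ->
  qK ((blue, j, k) :: (red, k, i) :: E) -> qK ((red, j, k) :: (blue, k, i) :: E) ->
  qK ((blue, k, i) :: (red, i, j) :: E) -> qK ((red, k, i) :: (blue, i, j) :: E) ->
  qK ((blue, i, j) :: (red, j, k) :: E).
Proof.
move=> ij jk ki h1 h2 h3 h4 h5.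
apply: (sum_mem _ (rpredD (rpredD h1 (rpredD h2 h3)) (rpredD h4 h5))).
by rewrite !addrA -(q_mixed E ij jk ki) !addrA.
Qed.

Lemma parent_edge_red p v : (p < v)%N -> parent_edge p v = (red, p, v).
Proof. by rewrite /parent_edge => ->. Qed.

Lemma parent_edge_blue p v : (v < p)%N -> parent_edge p v = (blue, p, v).
Proof. by rewrite /parent_edge => vp; rewrite ltnNge (ltnW vp). Qed.

Lemma ltn_neq p v : (p < v)%N -> p != v.
Proof. by apply: contraTneq => ->; rewrite ltnn. Qed.

Lemma gtn_neq p v : (p < v)%N -> v != p.
Proof. by rewrite eq_sym; apply: ltn_neq. Qed.

(** A red edge at the largest vertex v leads to its parent, so a rooted tree cannot have two. The
    one-color relation keeps one of them and joins x and y instead. *)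
Lemma qK_red2 v x y E : (x < v)%N -> (y < v)%N -> x != y ->
  qK ((red, x, v) :: (red, x, y) :: E) -> qK ((red, y, v) :: (red, x, y) :: E) ->
  qK ((red, x, v) :: (red, y, v) :: E).
Proof.
move=> xv yv xy h1 h2; have [nx ny] := (ltn_neq xv, ltn_neq yv).
have [nx' ny'] := (gtn_neq xv, gtn_neq yv); have xy' : y != x by rewrite eq_sym.
apply: qK_flip2 => //; apply: qK_cyc => //.
  by apply: qK_flip => //; apply: qK_flip2 h2.
apply: (qK_perm (E := (red, x, v) :: (red, y, x) :: E)); first by perm_lia.
exact: qK_flip2 h1.
Qed.

(* In a rooted tree the edge from p to x is red iff p < x; the next two lemmas
   rewrite a graph in which x hangs below both p and the largest vertex v. *)
Lemma qK_two_parents_blue v p x E : (x < v)%N -> (p < v)%N -> (x < p)%N ->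
  qK ((blue, v, p) :: (blue, p, x) :: E) -> qK ((blue, v, x) :: (blue, v, p) :: E) ->
  qK ((blue, v, x) :: (blue, p, x) :: E).
Proof.
move=> xv pv xp h1 h2; have [nx np] := (ltn_neq xv, ltn_neq pv).
have [nx' np'] := (gtn_neq xv, gtn_neq pv).
have [nxp nxp'] := (ltn_neq xp, gtn_neq xp).
apply: qK_flip2 => //; apply: qK_cyc => //.
  apply: (qK_perm (E := (blue, p, v) :: (blue, x, p) :: E)); first by perm_lia.
  by apply: qK_flip => //; apply: qK_flip2 h1.
by apply: (qK_flip (i := v)) => //; apply: qK_perm h2; perm_lia.
Qed.

Lemma qK_two_parents_red v p x E : (x < v)%N -> (p < v)%N -> (p < x)%N ->
  qK ((red, x, v) :: (blue, x, p) :: E) -> qK ((red, p, v) :: (blue, v, x) :: E) ->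
  qK ((red, x, v) :: (blue, v, p) :: E) -> qK ((blue, v, p) :: (red, p, x) :: E) ->
  qK ((red, p, v) :: (blue, x, p) :: E) ->
  qK ((blue, v, x) :: (red, p, x) :: E).
Proof.
move=> xv pv px h1 h2 h3 h4 h5.
have [nx np] := (ltn_neq xv, ltn_neq pv).
have [nx' np'] := (gtn_neq xv, gtn_neq pv).
have [npx npx'] := (ltn_neq px, gtn_neq px).
apply: qK_flip2 => //; apply: qK_mixed => //.
- exact: qK_flip h1.
- by apply: qK_perm h5; perm_lia.
- apply: (qK_perm (E := (blue, p, v) :: (red, x, p) :: E)); first by perm_lia.
  by apply: qK_flip => //; apply: qK_flip2 h4.
- apply: (qK_perm (E := (red, v, x) :: (blue, p, v) :: E)); first by perm_lia.
  by apply: qK_flip => //; apply: qK_flip2 h3.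
Qed.

(* At most one branch, which contains the parent of v. *)
Inductive red_part v : seq 'I_n -> seq (rawedge n) -> Prop :=
| red_part0 : red_part v [::] [::]
| red_part1 Y r EY y : rooted Y r EY -> y \in Y ->
    red_part v Y ((red, y, v) :: EY).

Section StarAbsorb.
Variables (A : seq 'I_n) (v : 'I_n) (F : seq (rawedge n)).
Hypotheses (A_uniq : uniq A) (v_max : forall x, x \in A -> x != v -> (x < v)%N).
(** The outer induction hypothesis on the number of vertices: a proper part of the tree may be taken
    to be rooted, whatever the remaining edges G. *)
Hypothesis renormalize : forall X EX G, (size X < size A)%N -> uniq X ->
  tree_on X EX -> (forall r E', rooted X r E' -> qK (E' ++ G)) -> qK (EX ++ G).
Hypothesis rooted_qK : forall r E', rooted A r E' -> qK (E' ++ F).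

(* W is rooted at v, Y is the branch that contains the parent of v, and the
   branches in S still have to be made part of W or Y. *)
Let absorbed m := forall W Y S EW EY ES, (size S < m)%N ->
  rooted W v EW -> red_part v Y EY -> star v S ES ->
  perm_eq (W ++ Y ++ S) A -> qK (EW ++ EY ++ ES ++ F).

Let lt_max W EW X B x : rooted W v EW -> perm_eq (W ++ X ++ B) A ->
  x \in X -> (x < v)%N.
Proof.
move=> /rooted_root vW pA xX; apply: v_max.
  by rewrite -(perm_mem pA) !mem_cat xX orbT.
have := A_uniq; rewrite -(perm_uniq pA) cat_uniq has_cat negb_or.
case/and3P=> _ /andP[/hasPn /(_ x xX)] /= xW _ _.
by apply: contraNneq xW => ->.
Qed.

Let part_small W EW X B : rooted W v EW -> perm_eq (W ++ X ++ B) A ->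
  (size X < size A)%N /\ uniq X.
Proof.
move=> /rooted_size W0 pA; rewrite -(perm_size pA) !size_cat; split.
  by move: (size W) (size X) (size B) W0; clear; lia.
have := A_uniq; rewrite -(perm_uniq pA) cat_uniq => /and3P[_ _].
by rewrite cat_uniq => /and3P[].
Qed.

(** If v has no parent branch yet, X becomes one. Otherwise [qK_red2] joins X to Y, and the union,
    which misses v, is renormalized into a single rooted branch. *)
Lemma red_absorb m W Y S X EW EY ES EX x : absorbed m -> (size S < m)%N ->
  rooted W v EW -> red_part v Y EY -> star v S ES -> tree_on X EX -> x \in X ->
  perm_eq (W ++ (X ++ Y) ++ S) A ->
  qK ((red, x, v) :: EX ++ EW ++ EY ++ ES ++ F).
Proof.
move=> ihm sS hW; case=> [|Y0 r EY0 y hY yY] hS tX xX pA.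
  rewrite cats0 in pA; have [sX uX] := part_small hW pA.
  apply: (qK_perm (E := EX ++ ((red, x, v) :: EW ++ ES ++ F))); first by perm_lia.
  apply: (renormalize sX uX tX) => r E' hX.
  apply: (qK_perm (E := EW ++ ((red, x, v) :: E') ++ ES ++ F)); first by perm_lia.
  exact: ihm sS hW (red_part1 _ hX xX) hS pA.
have [sX uX] := part_small hW pA.
have xXY : x \in X ++ Y0 by rewrite mem_cat xX.
have yXY : y \in X ++ Y0 by rewrite mem_cat yY orbT.
have key z : z \in X ++ Y0 ->
  qK ((red, z, v) :: (red, x, y) :: EX ++ EW ++ EY0 ++ ES ++ F).
  move=> zXY.
  apply: (qK_perm (E := ((red, x, y) :: EX ++ EY0) ++ ((red, z, v) :: EW ++ ES ++ F))).
    by perm_lia.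
  have tXY := tree_on_join red tX (rooted_tree_on hY) xX yY.
  apply: (renormalize sX uX tXY) => r' E' hX.
  apply: (qK_perm (E := EW ++ ((red, z, v) :: E') ++ ES ++ F)); first by perm_lia.
  exact: ihm sS hW (red_part1 _ hX zXY) hS pA.
apply: (qK_perm (E := (red, x, v) :: (red, y, v) :: EX ++ EW ++ EY0 ++ ES ++ F)).
  by perm_lia.
apply: qK_red2; try exact: key.
- exact: lt_max hW pA xXY.
- exact: lt_max hW pA yXY.
- have := uX; rewrite cat_uniq => /and3P[_ /hasPn /(_ y yY) yX _].
  by apply: contraNneq yX => <-.
Qed.

(** At depth 0 the branch becomes a child of v in W. Otherwise x hangs below both v and its parent p
    in X, and the relation on v, p, x gives terms in which the blue edge ends at p, one level
    higher, terms in which X splits at the edge p x, and red terms for [red_absorb]. The bound on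
    [size X + size S] leaves a star smaller than m once the lower piece A2 has gone to W or Y. *)
Lemma blue_absorb d m W Y S X EW EY ES EX r x : absorbed m ->
  (size X + size S <= m)%N ->
  rooted W v EW -> red_part v Y EY -> star v S ES -> rooted_depth d X r x EX ->
  perm_eq (W ++ (X ++ Y) ++ S) A ->
  qK ((blue, v, x) :: EX ++ EW ++ EY ++ ES ++ F).
Proof.
move=> ihm; elim: d W X EW EX x => [|d ihd] W X EW EX x sm hW hY hS hX pA.
  inversion hX; subst; have xX := rooted_root H.
  have xv : (x < v)%N by apply: lt_max hW pA _; rewrite mem_cat xX.
  have := rooted_join hW H (rooted_root hW); rewrite parent_edge_blue // => hWX.
  apply: (qK_perm (E := ((blue, v, x) :: EW ++ EX) ++ EY ++ ES ++ F)); first by perm_lia.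
  apply: ihm hWX hY hS _; last by perm_lia.
  by move: (rooted_size H) sm; lia.
have hXr := (rooted_depth_in hX).
inversion hX as [|d' A1 r' p E1 A2 x' E2 A' E' h1 h2 pX pE]; subst.
have [hr1 p1] := rooted_depth_in h1.
have [_ xX] := hXr.
have x2 := rooted_root h2.
have pX' : p \in X by rewrite (perm_mem pX) mem_cat p1.
have xv : (x < v)%N by apply: lt_max hW pA _; rewrite mem_cat xX.
have pv : (p < v)%N by apply: lt_max hW pA _; rewrite mem_cat pX'.
have px : p != x.
  have [_] := part_small hW pA; rewrite cat_uniq (perm_uniq pX) cat_uniq.
  by case/and3P=> /and3P[_ /hasPn /(_ x x2) /= xA1 _] _ _; apply: contraNneq xA1 => <-.
have s12 : size X = (size A1 + size A2)%N by rewrite (perm_size pX) size_cat.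
have hWA2 : rooted (W ++ A2) v ((blue, v, x) :: EW ++ E2).
  by have := rooted_join hW h2 (rooted_root hW); rewrite parent_edge_blue.
have t1 := rooted_tree_on hr1; have t2 := rooted_tree_on h2.
have s1 := rooted_size hr1; have s2 := rooted_size h2.
have hSp : star v (A1 ++ S) ((blue, v, p) :: E1 ++ ES).
  by apply: starS hS; [exact: t1 | exact: p1 | left].
have hdeep : qK ((blue, v, p) :: parent_edge p x :: E1 ++ E2 ++ EW ++ EY ++ ES ++ F).
  have := rooted_depth_add h1 h2 => h12.
  apply: (qK_perm (E := (blue, v, p) :: (parent_edge p x :: E1 ++ E2) ++ EW ++ EY ++ ES ++ F)).
    by perm_lia.
  apply: ihd hW hY hS h12 _; first by rewrite size_cat; lia.
  by perm_lia.
apply: (qK_perm (E := (blue, v, x) :: parent_edge p x :: E1 ++ E2 ++ EW ++ EY ++ ES ++ F)).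
  by perm_lia.
have [xp|lt_px|/val_inj exp] := ltngtP x p; last by rewrite exp eqxx in px.
  rewrite parent_edge_blue // in hdeep *; apply: qK_two_parents_blue => //.
  apply: (qK_perm (E := ((blue, v, x) :: EW ++ E2) ++ EY ++ ((blue, v, p) :: E1 ++ ES) ++ F)).
    by perm_lia.
  apply: ihm hWA2 hY hSp _; first by rewrite size_cat; lia.
  by perm_lia.
rewrite parent_edge_red // in hdeep *; apply: qK_two_parents_red => //.
- apply: (qK_perm (E := (red, x, v) :: ((blue, x, p) :: E1 ++ E2) ++ EW ++ EY ++ ES ++ F)).
    by perm_lia.
  have t12 := tree_on_join_sym blue t1 t2 p1 x2.
  apply: red_absorb ihm _ hW hY hS t12 _ _; first by lia.
    by rewrite mem_cat x2 orbT.
  by perm_lia.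
- apply: (qK_perm (E := (red, p, v) :: E1 ++ ((blue, v, x) :: EW ++ E2) ++ EY ++ ES ++ F)).
    by perm_lia.
  apply: red_absorb ihm _ hWA2 hY hS t1 p1 _; first by lia.
  by perm_lia.
- apply: (qK_perm (E := (red, x, v) :: E2 ++ EW ++ EY ++ ((blue, v, p) :: E1 ++ ES) ++ F)).
    by perm_lia.
  apply: red_absorb ihm _ hW hY hSp t2 x2 _; first by rewrite size_cat; lia.
  by perm_lia.
- apply: (qK_perm (E := (red, p, v) :: ((blue, x, p) :: E1 ++ E2) ++ EW ++ EY ++ ES ++ F)).
    by perm_lia.
  have t12 := tree_on_join_sym blue t1 t2 p1 x2.
  apply: red_absorb ihm _ hW hY hS t12 _ _; first by lia.
    by rewrite mem_cat p1.
  by perm_lia.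
Qed.

Lemma star_absorb m : absorbed m.
Proof.
elim: m => // m ihm W Y S EW EY ES sS hW hY hS pA.
case: hS sS pA => [|c x e X EX S' ES' tX xX he hS'] sS pA.
  (* No branch is left. Either v is the root, or W hangs below y by a red edge; both graphs are
     rooted trees on A. *)
  case: hY pA => [|Y0 r EY0 y hY yY] pA.
    apply: rooted_qK; apply: rooted_perm (perm_refl _) hW.
    by rewrite !cats0 in pA.
  have yv : (y < v)%N by apply: lt_max hW pA yY.
  have := rooted_join hY hW yY; rewrite parent_edge_red // => hYW.
  apply: (qK_perm (E := ((red, y, v) :: EY0 ++ EW) ++ F)); first by perm_lia.
  apply: rooted_qK; apply: rooted_perm (perm_refl _) hYW.
  by perm_lia.
have pA' : perm_eq (W ++ (X ++ Y) ++ S') A by perm_lia.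
have xv : (x < v)%N by apply: lt_max hW pA' _; rewrite mem_cat xX.
have sX : (0 < size X)%N by case: (X) xX.
rewrite size_cat in sS.
apply: (qK_perm (E := e :: EX ++ EW ++ EY ++ ES' ++ F)); first by perm_lia.
case: c he => he.
- suff h : qK ((blue, v, x) :: EX ++ EW ++ EY ++ ES' ++ F).
    by case: he => -> //; apply: qK_flip h; apply: gtn_neq.
  have pX : perm_eq (W ++ X ++ (Y ++ S')) A by perm_lia.
  have [sXA uX] := part_small hW pX.
  apply: (qK_perm (E := EX ++ ((blue, v, x) :: EW ++ EY ++ ES' ++ F))).
    by perm_lia.
  apply: (renormalize sXA uX tX) => r E' hX; have [d hd] := rooted_depth_exists hX xX.
  apply: (qK_perm (E := (blue, v, x) :: E' ++ EW ++ EY ++ ES' ++ F)).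
    by perm_lia.
  by apply: (blue_absorb ihm _ hW hY hS' hd pA'); lia.
suff h : qK ((red, x, v) :: EX ++ EW ++ EY ++ ES' ++ F).
  by case: he => -> //; apply: qK_flip h; apply: ltn_neq.
by apply: (red_absorb ihm _ hW hY hS' tX xX pA'); lia.
Qed.

End StarAbsorb.

Lemma tree_on_in A E : tree_on A E -> exists a, a \in A.
Proof.
elim=> [i|c i j A1 A2 E1 E2 _ _ _ _ iA _|A1 A2 E1 E2 pA _ _ [a aA]].
- by exists i; apply: mem_head.
- by exists i; rewrite mem_cat iA.
- by exists a; rewrite -(perm_mem pA).
Qed.

(* Induction on the size of A, absorbing the branches at the largest vertex. *)
Lemma tree_on_rooted_span A E F : uniq A -> tree_on A E ->
  (forall r E', rooted A r E' -> qK (E' ++ F)) -> qK (E ++ F).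
Proof.
have [N] := ubnP (size A); elim: N A E F => // N IH A E F sN uA tA hA.
have [a aA] := tree_on_in tA.
have [v vA vmax] : exists2 v, v \in A & forall x, x \in A -> (x <= v)%N.
  by case: (@arg_maxnP _ a (mem A) val aA) => v; exists v.
have [S [ES [hS pA pE]]] := tree_on_star tA vA.
apply: (qK_perm (E := [::] ++ [::] ++ ES ++ F)); first by perm_lia.
apply: (@star_absorb A v F uA _ _ hA (size S).+1 [:: v] [::] S) => //.
- move=> x xA xv; have := vmax x xA; rewrite leq_eqVlt => /orP[/eqP/val_inj e|//].
  by rewrite e eqxx in xv.
- by move=> X EX G sX uX tX hX; apply: IH uX tX hX; apply: leq_trans sX _.
- exact: rooted1.
- exact: red_part0.
- by rewrite perm_sym.
Qed.

(** * Cycles and disconnected graphs *)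

Hypothesis q_multi : forall c d i j E, i != j -> q ((c, i, j) :: (d, i, j) :: E) = 0.

Let qK0 E : q E = 0 -> qK E.
Proof. by move=> qE; rewrite /qK qE; apply: (@rpred0 _ K). Qed.

Let same_or_opposite (c d : color) : d = c \/ d = ~~ c.
Proof. by case: c d => [] []; [left | right | right | left]. Qed.

(** In the two-color relation on j, i, x only two of the six terms avoid the edge x j, and these two
    differ by exchanging colors. *)
Let swap_colors c i j x E : i != j -> i != x -> x != j ->
  (forall d d', qK ((d, i, x) :: (d', x, j) :: E)) ->
  (forall d d', qK ((d, x, j) :: (d', j, i) :: E)) ->
  qK ((~~ c, j, i) :: (c, i, x) :: E) -> qK ((c, j, i) :: (~~ c, i, x) :: E).
Proof.
move=> ij ix xj h h' h1; have ji : j != i by rewrite eq_sym.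
case: c h1 => h1; first exact: qK_mixed.
have := q_mixed E ji ix xj; rewrite -addrA [q _ + q _ in X in X -> _]addrC -addrA.
move/sum_mem; apply; apply: rpredD; first exact: h1.
by apply: rpredD; apply: rpredD; first [exact: h | exact: h'].
Qed.

Lemma star_cons v S ES j : star v S ES -> j \in S ->
  exists c x e X EX S' ES', [/\ tree_on X EX, x \in X, j \in X &
    [/\ e = (c, v, x) \/ e = (c, x, v), star v S' ES', perm_eq S (X ++ S')
     & perm_eq ES (e :: EX ++ ES')]].
Proof.
elim=> // c x e X EX S1 ES1 tX xX he hS ih; rewrite mem_cat.
have [jX _|_ /= /ih] := boolP (j \in X).
  by exists c, x, e, X, EX, S1, ES1; split.
move=> [c' [x' [e' [X' [EX' [S' [ES' [tX' xX' jX' [he' hS' pS pE]]]]]]]]].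
exists c', x', e', X', EX', (X ++ S'), (e :: EX ++ ES'); split=> //; split=> //.
- exact: starS tX xX he hS'.
- perm_lia.
- perm_lia.
Qed.

(** Induction on the tree that the edge j i closes to a cycle. With x the neighbour of i towards j,
    the relation on j, i, x replaces an edge by x j, which closes a shorter cycle in X. This
    suffices if the edges j i and i x have one color. If not, the next edge x y, towards j, is used:
    it agrees in color with i x, or does so once the colors of j i and i x are exchanged. *)
Lemma cycle_qK c i j A E F : uniq A -> tree_on A E -> i \in A -> j \in A ->
  i != j -> qK ((c, j, i) :: E ++ F).
Proof.
have [N] := ubnP (size A); elim: N c i j A E F => // N IH c i j A E F sN uA tA iA jA ij.
have [S [ES [hS pA pE]]] := tree_on_star tA iA.
have jS : j \in S.
  by move: jA; rewrite (perm_mem pA) inE eq_sym (negPf ij).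
have [d [x [e [X [EX [S' [ES' [tX xX jX [he hS' pS pES]]]]]]]]] := star_cons hS jS.
have ji : j != i by rewrite eq_sym.
have : uniq (i :: X ++ S') by rewrite -(perm_uniq (s1 := A)) //; perm_lia.
rewrite cons_uniq cat_uniq mem_cat negb_or => /andP[/andP[iX _] /andP[uX _]].
have ix : i != x by apply: contraNneq iX => ->.
have sA : (size X < size A)%N.
  rewrite (perm_size pA) /= (perm_size pS) size_cat ltnS; exact: leq_addr.
suff : qK ((c, j, i) :: (d, i, x) :: EX ++ ES' ++ F).
  have xi : x != i by rewrite eq_sym.
  case: he pES => -> pES h.
    by apply: qK_perm h; perm_lia.
  by apply: (qK_perm (E := (c, j, i) :: (d, x, i) :: EX ++ ES' ++ F));
    [perm_lia | apply: qK_flip2].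
move: {ES' S' hS' pS pES he e hS pE ES S pA jS} (ES' ++ F) => {}F.
have [<-|xj] := eqVneq x j.
  by apply: qK_flip2; rewrite 1?eq_sym //; apply: qK0; apply: q_multi; rewrite eq_sym.
have inX d1 G : qK ((d1, x, j) :: EX ++ G).
  by apply: IH tX jX xX _; [exact: leq_trans sA _|exact: uX|rewrite eq_sym].
have [S [ES [hS pX pEX]]] := tree_on_star tX xX.
have jS : j \in S.
  by move: jX; rewrite (perm_mem pX) inE eq_sym (negPf xj).
have [d2 [y [e [Y [EY [S' [ES' [tY yY jY [he hS' pS pES]]]]]]]]] := star_cons hS jS.
have : uniq (x :: Y ++ S') by rewrite -(perm_uniq (s1 := X)) //; perm_lia.
rewrite cons_uniq cat_uniq mem_cat negb_or => /andP[/andP[xY _] /andP[uY _]].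
have sX : (size Y < size X)%N.
  rewrite (perm_size pX) /= (perm_size pS) size_cat ltnS; exact: leq_addr.
have iY : i \notin Y.
  apply: contraNN iX => iY; rewrite (perm_mem pX) inE.
  by rewrite (perm_mem pS) mem_cat iY orbT.
have iy : i != y by apply: contraNneq iY => ->.
have xy : x != y by apply: contraNneq xY => ->.
have yx : y != x by rewrite eq_sym.
(* With i x and x y of one color, the relation on i, x, y leaves terms with the edge y i; there the
   cycle skips x. *)
have same c1 d1 : d1 = d2 -> qK ((c1, j, i) :: (d1, i, x) :: EX ++ F).
  move=> ->.
  suff : qK ((d2, i, x) :: (d2, x, y) :: (c1, j, i) :: EY ++ ES' ++ F).
    case: he pES => -> pES h.
      by apply: qK_perm h; perm_lia.
    apply: (qK_perm (E := (d2, i, x) :: (d2, y, x) :: (c1, j, i) :: EY ++ ES' ++ F)).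
      by perm_lia.
    exact: qK_flip2.
  have shorter e' : qK ((c1, j, i) :: ((d2, y, i) :: EY) ++ e' :: ES' ++ F).
    have tiY : tree_on (Y ++ [:: i]) ((d2, y, i) :: EY).
      by have := tree_on_join d2 tY (tree_on1 i) yY (mem_head _ _); rewrite cats0.
    apply: IH tiY _ _ ij.
    - by rewrite size_cat addn1; apply: leq_ltn_trans sX (leq_trans sA _).
    - by rewrite cat_uniq uY /= orbF iY.
    - by rewrite mem_cat mem_head orbT.
    - by rewrite mem_cat jY.
  apply: qK_cyc => //; first by rewrite eq_sym.
    by apply: qK_perm (shorter (d2, x, y)); perm_lia.
  by apply: qK_perm (shorter (d2, i, x)); perm_lia.
have [dc|dc] := same_or_opposite c d.
  rewrite dc; apply: qK_cyc => //.
    by apply: qK_perm (inX c ((c, i, x) :: F)); perm_lia.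
  by apply: qK_perm (inX c ((c, j, i) :: F)); perm_lia.
have [e2|e2] := same_or_opposite c d2; last by apply: same; rewrite dc e2.
rewrite dc; apply: swap_colors => //; last by apply: same.
- by move=> a b; apply: qK_perm (inX b ((a, i, x) :: F)); perm_lia.
- by move=> a b; apply: qK_perm (inX a ((b, j, i) :: F)); perm_lia.
Qed.

(** Every vertex is separated from some other one. For n = 0 this asks nothing, in accordance with
    the graph without vertices being disconnected. *)
Hypothesis q_disc : forall E,
  (forall i, exists (P : pred 'I_n) j,
    [/\ P i, ~~ P j & {in E, forall e, P e.1.2 = P e.2}]) -> q E = 0.
Hypothesis q_rooted : forall A r E, perm_eq A (enum 'I_n) -> rooted A r E -> qK E.

Inductive forest : nat -> seq 'I_n -> seq (rawedge n) -> Prop :=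
| forest0 : forest 0 [::] [::]
| forestS (k : nat) A1 E1 A2 E2 : tree_on A1 E1 -> forest k A2 E2 ->
    forest k.+1 (A1 ++ A2) (E1 ++ E2).

Lemma forest_component (k : nat) A E i : forest k A E -> i \in A ->
  exists (k' : nat) A1 E1 A2 E2, [/\ k = k'.+1, tree_on A1 E1, i \in A1,
    forest k' A2 E2 & perm_eq A (A1 ++ A2) /\ perm_eq E (E1 ++ E2)].
Proof.
elim=> // k0 A1 E1 A2 E2 t1 f2 ih; rewrite mem_cat.
have [i1 _|_ /= /ih] := boolP (i \in A1); first by exists k0, A1, E1, A2, E2.
move=> [k' [B1 [F1 [B2 [F2 [ek tB iB fB [pA pE]]]]]]].
exists k'.+1, B1, F1, (A1 ++ B2), (E1 ++ F2); split=> //; first by rewrite ek.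
  exact: forestS.
by split; perm_lia.
Qed.

Lemma tree_on_endpoints A E : tree_on A E -> {in E, forall e, e.1.2 \in A /\ e.2 \in A}.
Proof.
elim=> // [c i j A1 A2 E1 E2 _ ih1 _ ih2 iA jA|A1 A2 E1 E2 pA pE _ ih] e.
  rewrite inE mem_cat !mem_cat => /or3P[/eqP -> /=|/ih1[-> ->]|/ih2[-> ->]] //.
    by rewrite iA jA orbT.
  by rewrite !orbT.
by rewrite -(perm_mem pE) -!(perm_mem pA) => /ih.
Qed.

Lemma forest_endpoints (k : nat) A E : forest k A E ->
  {in E, forall e, e.1.2 \in A /\ e.2 \in A}.
Proof.
elim=> // k0 A1 E1 A2 E2 /tree_on_endpoints h1 _ ih e.
by rewrite !mem_cat => /orP[/h1[-> ->]|/ih[-> ->]] //; rewrite !orbT.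
Qed.

Lemma singletons_forest A : exists k : nat, forest k A [::].
Proof.
elim: A => [|i A [k hk]]; first by exists 0; apply: forest0.
by exists k.+1; apply: (forestS (tree_on1 i) hk).
Qed.

(** Adding an edge either merges two components or closes a cycle inside one. In the second case no
    further edges can leave K, which the quantifier over F records. *)
Lemma acyclic_or_qK E : all (fun e => e.1.2 != e.2) E ->
  (forall F, qK (E ++ F)) \/ exists (k : nat) A E',
    [/\ forest k A E', perm_eq A (enum 'I_n) & perm_eq E E'].
Proof.
elim: E => [_|[[c i] j] E ih /= /andP[ij /ih]].
  by right; have [k hk] := singletons_forest (enum 'I_n); exists k, (enum 'I_n), [::].
case=> [h|[k [A [E' [hf pA pE]]]]].
  left=> F; apply: (qK_perm (E := E ++ (c, i, j) :: F)); last exact: h.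
  by perm_lia.
have uA : uniq A by rewrite (perm_uniq pA) enum_uniq.
have iA : i \in A by rewrite (perm_mem pA) mem_enum.
have jA : j \in A by rewrite (perm_mem pA) mem_enum.
have [k1 [A1 [E1 [A2 [E2 [_ t1 i1 f2 [pA1 pE1]]]]]]] := forest_component hf iA.
have [j1|j1] := boolP (j \in A1).
  left=> F; apply: (qK_perm (E := (c, i, j) :: E1 ++ (E2 ++ F))); first by perm_lia.
  apply: cycle_qK t1 j1 i1 _; last by rewrite eq_sym.
  by move: uA; rewrite (perm_uniq pA1) cat_uniq => /andP[].
have j2 : j \in A2.
  by move: jA; rewrite (perm_mem pA1) mem_cat (negPf j1).
have [k2 [A3 [E3 [A4 [E4 [_ t3 j3 f4 [pA2 pE2]]]]]]] := forest_component f2 j2.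
right; exists k2.+1, ((A1 ++ A3) ++ A4), (((c, i, j) :: E1 ++ E3) ++ E4); split.
- by apply: forestS f4; apply: tree_on_join.
- perm_lia.
- perm_lia.
Qed.

Lemma loopless_qK E : all (fun e => e.1.2 != e.2) E -> qK E.
Proof.
move=> /acyclic_or_qK[/(_ [::])|]; first by rewrite cats0.
move=> [k [A [E' [hf pA pE]]]]; apply: (qK_perm (E := E')); first by rewrite perm_sym.
have uA : uniq A by rewrite (perm_uniq pA) enum_uniq.
have iA i : i \in A by rewrite (perm_mem pA) mem_enum.
have [ek|nk] := eqVneq k 1.
  case: hf ek uA pA {iA pE E} => // k0 A1 E1 A2 E2 t1 f2 [k00].
  rewrite {}k00 in f2; inversion f2; rewrite cats0 => u1 p1.
  apply: tree_on_rooted_span u1 t1 _ => r E'' hr; rewrite cats0.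
  exact: q_rooted p1 hr.
(* A number of trees other than 1: either there are no vertices at all, or another tree contains a
   vertex separated from i. *)
apply: qK0; apply: q_disc => i.
have [k1 [A1 [E1 [A2 [E2 [ek t1 i1 f2 [pA1 pE1]]]]]]] := forest_component hf (iA i).
have [j j2] : exists j, j \in A2.
  rewrite ek in nk; case: f2 nk => // k2 A3 E3 A4 E4 t3 _ _.
  have [j j3] := tree_on_in t3; exists j; by rewrite mem_cat j3.
exists (mem A1), j; rewrite /= i1.
have : uniq (A1 ++ A2) by rewrite -(perm_uniq pA1).
rewrite cat_uniq => /and3P[_ /hasPn d12 _].
split=> //; first exact: d12.
move=> e; rewrite (perm_mem pE1) mem_cat => /orP[/(tree_on_endpoints t1)[-> ->] //|].
by move=> /(forest_endpoints f2)[/d12/negPf -> /d12/negPf ->].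
Qed.

End EilSpan.

(** * The cuts of a rooted tree at its largest label *)

Section NormalForm.
Variable n : nat.
Implicit Types (A : seq 'I_n) (E : seq (rawedge n)) (r u v x : 'I_n).

Lemma rooted_split_child A r E u : rooted A r E -> u \in A -> u != r ->
  exists x A1 E1 A2 E2, [/\ rooted A1 r E1, rooted A2 x E2, u \in A2,
    perm_eq A (A1 ++ A2) & perm_eq E (parent_edge r x :: E1 ++ E2)].
Proof.
have [N] := ubnP (size A); elim: N A E u => // N IH A E u sN hA uA ur.
have [A1 [E1 [A2 [E2 [p [h1 h2 p1 pA pE]]]]]] := rooted_split hA uA ur.
have [ep|pr] := eqVneq p r.
  by exists u, A1, E1, A2, E2; split; rewrite -?ep ?(rooted_root h2) // ep.
have s1 : (size A1 < N)%N.
  move: sN; rewrite ltnS (perm_size pA) size_cat; apply: leq_trans.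
  by rewrite -addn1 leq_add2l (rooted_size h2).
have [x [B1 [F1 [B2 [F2 [g1 g2 pB2 pB pF]]]]]] := IH _ _ _ s1 h1 p1 pr.
exists x, B1, F1, (B2 ++ A2), (parent_edge p u :: F2 ++ E2); split=> //.
- exact: rooted_join.
- by rewrite mem_cat (rooted_root h2) orbT.
- perm_lia.
- perm_lia.
Qed.

Lemma rooted_size_edges A r E : rooted A r E -> size A = (size E).+1.
Proof.
elim=> // [A1 r1 E1 A2 x E2 p _ e1 _ e2 _|A1 A2 r1 E1 E2 pA pE _ e].
  by rewrite /= !size_cat e1 e2 addnS.
by rewrite -(perm_size pA) -(perm_size pE).
Qed.

Lemma disjoint_labels (T X : rtree n) A1 A2 : uniq (A1 ++ A2) ->
  perm_eq (labels T) A1 -> perm_eq (labels X) A2 -> [disjoint lab T & lab X].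
Proof.
rewrite cat_uniq => /and3P[_ /hasPn d _] pT pX; rewrite disjoint_sym.
apply/pred0Pn => -[i /andP[]]; rewrite !inE (perm_mem pT) (perm_mem pX).
by move=> /d/negP.
Qed.

Lemma max_of A a : a \in A ->
  exists2 v, v \in A & forall x, x \in A -> x != v -> (x < v)%N.
Proof.
move=> aA; case: (@arg_maxnP _ a (mem A) val aA) => v vA hv; exists v => // x xA xv.
have xv' : (x <= v)%N := hv x xA; rewrite ltn_neqAle xv' andbT.
by apply: contraNneq xv => /val_inj ->.
Qed.

(** Cut above the largest vertex if it is not the root; otherwise cut the branch with the largest
    remaining vertex. These are exactly the choices that [good] requires. *)
Lemma rooted_normal A r E : uniq A -> rooted A r E -> exists T : rtree n,
  [/\ normal T, perm_eq (labels T) A, root T = r & perm_eq (rgraph T) E].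
Proof.
have [N] := ubnP (size A); elim: N A r E => // N IH A r E sN uA hA.
have rA := rooted_root hA.
have IHl A1 A2 r1 E1 : perm_eq A (A1 ++ A2) -> (0 < size A1)%N -> (0 < size A2)%N ->
    rooted A1 r1 E1 -> exists T : rtree n,
    [/\ normal T, perm_eq (labels T) A1, root T = r1 & perm_eq (rgraph T) E1].
  move=> pA s1 s2; apply: IH.
    move: sN; rewrite ltnS (perm_size pA) size_cat; apply: leq_trans.
    by rewrite -addn1 leq_add2l.
  by move: uA; rewrite (perm_uniq pA) cat_uniq => /andP[].
have [v vA vmax] := max_of rA.
have [er|vr] := eqVneq v r; last first.
  have [A1 [E1 [A2 [E2 [p [h1 h2 p1 pA pE]]]]]] := rooted_split hA vA vr.
  have [s1 s2] := (rooted_size h1, rooted_size h2).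
  have [Y [nY lY rY eY]] := IHl _ _ _ _ pA s1 s2 h1.
  have pA' : perm_eq A (A2 ++ A1) by rewrite perm_sym perm_catC perm_sym.
  have [T [nT lT rT eT]] := IHl _ _ _ _ pA' s2 s1 h2.
  have u12 : uniq (A1 ++ A2) by rewrite -(perm_uniq pA).
  have dYT := disjoint_labels u12 lY lT.
  have inA i : i \in A = (i \in lab Y) || (i \in lab T).
    by rewrite (perm_mem pA) mem_cat !inE (perm_mem lY) (perm_mem lT).
  have vT : v \in lab T by rewrite -rT rootE.
  exists (RR Y p T); split=> //=.
  - apply: normal_consR => //.
    + apply/allP => i iT; rewrite rT.
      have [->//|iv] := eqVneq i v; apply/ltnW/vmax => //.
      by rewrite inA !inE iT orbT.
    + move=> i iY; rewrite rT; apply: vmax; first by rewrite inA iY.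
      by apply: contraTneq iY => ->; rewrite (disjointFl dYT vT).
    + by rewrite inE (perm_mem lY).
  - perm_lia.
  - rewrite rT; perm_lia.
rewrite {v}er in vA vmax.
have [/hasP[u1 u1A u1r]|/hasPn none] := boolP (has (fun u => u != r) A); last first.
  have pA : perm_eq A [:: r].
    apply: uniq_perm => // i; rewrite inE; apply/idP/eqP => [/none/negPn/eqP //|->//].
  have := rooted_size_edges hA; rewrite (perm_size pA) => -[/esym/size0nil ->].
  by exists (RV r); split; rewrite // perm_sym.
have [u] : exists2 u, u \in filter (predC1 r) A &
    forall x, x \in filter (predC1 r) A -> x != u -> (x < u)%N.
  by apply: (@max_of _ u1); rewrite mem_filter /= u1r.
rewrite mem_filter /= => /andP[ur uIn] umax.
have [x [A1 [E1 [A2 [E2 [h1 h2 u2 pA pE]]]]]] := rooted_split_child hA uIn ur.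
have [s1 s2] := (rooted_size h1, rooted_size h2).
have [T [nT lT rT eT]] := IHl _ _ _ _ pA s1 s2 h1.
have pA' : perm_eq A (A2 ++ A1) by rewrite perm_sym perm_catC perm_sym.
have [X [nX lX rX eX]] := IHl _ _ _ _ pA' s2 s1 h2.
have u12 : uniq (A1 ++ A2) by rewrite -(perm_uniq pA).
have dTX := disjoint_labels u12 lT lX.
have inA i : i \in A = (i \in lab T) || (i \in lab X).
  by rewrite (perm_mem pA) mem_cat !inE (perm_mem lT) (perm_mem lX).
have rlT : r \in lab T by rewrite -rT rootE.
exists (RB T X); split=> //=.
- apply: normal_consB => //.
  + apply/allP => i iT; rewrite rT.
    have [->//|iv] := eqVneq i r; apply/ltnW/vmax => //.
    by rewrite inA !inE iT.
  + move=> i iX; rewrite rT; apply: vmax; first by rewrite inA iX orbT.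
    by apply: contraTneq iX => ->; rewrite (disjointFr dTX rlT).
  + have uX : u \in lab X by rewrite inE (perm_mem lX).
    exists u => // a aT; rewrite rT => ar; apply: umax.
      by rewrite mem_filter /= ar inA aT.
    by apply: contraTneq aT => ->; rewrite (disjointFl dTX uX).
- perm_lia.
- rewrite rT rX; perm_lia.
Qed.

End NormalForm.

(** * Perfectness *)

Section RawGraph.
Variable n : nat.
Implicit Types (E : seq (rawedge n)) (G : graph n) (i j : 'I_n) (c : color).

(** A loop in E is not the image of any edge and is silently dropped; hence the loopless hypotheses
    below. *)
Definition raw_graph E : graph n := [ffun e => count_mem (raw e) E].

Lemma raw_graph_perm E E' : perm_eq E E' -> raw_graph E = raw_graph E'.
Proof. by move/permP => EE'; apply/ffunP => e; rewrite !ffunE. Qed.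

Lemma raw_graph_cons c i j (ij : i != j) E :
  raw_graph ((c, i, j) :: E) = add_edge (raw_graph E) (arrow c ij).
Proof.
apply/ffunP => e; rewrite !ffunE /= addnC; congr (_ + _)%N.
by rewrite -(raw_arrow c ij) (inj_eq (@raw_inj n)) eq_sym.
Qed.

Lemma raw_edgesK G : raw_graph (raw_edges G) = G.
Proof.
apply/ffunP => e; rewrite ffunE count_map -[RHS]count_edges.
by apply: eq_count => f /=; rewrite (inj_eq (@raw_inj n)).
Qed.

Lemma raw_graphK E : all (fun e => e.1.2 != e.2) E ->
  perm_eq (raw_edges (raw_graph E)) E.
Proof.
elim: E => [_|[[c i] j] E ih /= /andP[ij /ih]].
  have -> : raw_graph [::] = [ffun=> 0%N] by apply/ffunP => e; rewrite !ffunE.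
  have : perm_eq (edges [ffun=> 0%N] : seq (edge n)) [::].
    by apply: perm_edges => e; rewrite ffunE.
  by rewrite /raw_edges => /perm_nilP ->.
move=> pE; rewrite (raw_graph_cons c ij) (permPl (perm_raw_add _ _)).
by rewrite raw_arrow perm_cons.
Qed.

Lemma raw_edges_loopless G : all (fun e => e.1.2 != e.2) (raw_edges G).
Proof. by apply/allP => _ /mapP[e _ ->]; apply: edge_loopless. Qed.

Lemma raw_graph_multiple c d i j E : i != j ->
  has_multiple_edge (raw_graph ((c, i, j) :: (d, i, j) :: E)).
Proof.
move=> ij; apply/existsP; exists i; apply/existsP; exists j.
rewrite !(raw_graph_cons _ ij) (permP (perm_add_edge _ _)) /=.
by rewrite (permP (perm_add_edge _ _)) /= /joins !eqxx.
Qed.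

Lemma raw_graph_disconnected E :
  (forall i, exists (P : pred 'I_n) j,
    [/\ P i, ~~ P j & {in E, forall e, P e.1.2 = P e.2}]) ->
  ~~ connected (raw_graph E).
Proof.
move=> cutE; apply/negP => /eqP /mem_card1[i hi].
set G := raw_graph E in hi; have sG := connect_adjacent_sym G.
have rooti k : fingraph.root (adjacent G) k = i.
  by apply/eqP; have := hi (fingraph.root (adjacent G) k); rewrite !inE roots_root.
have [P [j [Pi Pj hP]]] := cutE i.
have cP : closed (adjacent G) P.
  move=> k l /hasP[e]; rewrite -[e \in _]has_pred1 has_count count_edges ffunE.
  rewrite -has_count has_pred1 => /hP /= eP.
  by rewrite /joins !xpair_eqE => /orP[] /andP[/eqP <- /eqP <-].
have ij : connect (adjacent G) i j.
  by have := connect_root (adjacent G) j; rewrite sG rooti.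
by have := closed_connect cP ij; rewrite /in_mem /= Pi (negPf Pj).
Qed.

End RawGraph.

Section Monomials.
Variables (R : comPzRingType) (n : nat).

Lemma lie2_monomial_graft y (s : tree n) :
  exists2 f : lie2_alg R n -> lie2_alg R n, linear f &
    forall t, f (lie2_monomial R t) = lie2_monomial R (graft t y s).
Proof.
pose a i := lie2_monomial R (if i == y then Node red (Leaf y) s else Leaf i).
have [f fE] := lie2_subst (lie2_alg_two_lie R n) a.
exists f; first by move=> b u v; rewrite linearP.
move=> t; rewrite fE; elim: t => [i|c l ihl r ihr] //.
by rewrite [graft _ _ _]/= lie2_monomialN -ihl -ihr.
Qed.

(** [rtree] is not a finite type; this list contains at least all trees with at most k labels, and a
    normal tree has at most n. *)
Fixpoint small_rtrees k : seq (rtree n) :=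
  if k is k'.+1 then
    [seq RV v | v <- enum 'I_n]
    ++ [seq RB T X | T <- small_rtrees k', X <- small_rtrees k']
    ++ [seq RR Yy.1 Yy.2 T | Yy <- [seq (Y, y) | Y <- small_rtrees k', y <- enum 'I_n],
                             T <- small_rtrees k']
  else [::].

Lemma mem_small_rtrees k T : (size (labels T) <= k)%N -> T \in small_rtrees k.
Proof.
have lab0 (X : rtree n) : (0 < size (labels X))%N.
  by have := root_in X; case: (labels X).
elim: k T => [|k IH] T; first by have := lab0 T; case: (labels T).
rewrite [small_rtrees _]/= !mem_cat; case: T => [v|T X|Y y T] /=.
- by rewrite map_f // mem_enum.
- have := lab0 T; have := lab0 X; rewrite size_cat => X0 T0 sTX.
  by rewrite allpairs_f ?orbT // IH //; lia.
- have := lab0 Y; have := lab0 T; rewrite size_cat => T0 Y0 sYT.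
  have := allpairs_f (fun Yy T => RR Yy.1 Yy.2 T) (x := (Y, y)) (y := T).
  move=> ->; rewrite ?orbT ?IH ?allpairs_f ?IH ?mem_enum //; lia.
Qed.

Definition full_normal : seq (rtree n) :=
  [seq T <- small_rtrees n | normal T && (lab T == setT)].

Lemma mem_full_normal T : (T \in full_normal) = normal T && (lab T == setT).
Proof.
rewrite mem_filter; case nT: (normal T) => //=.
rewrite mem_small_rtrees ?andbT // -[X in (_ <= X)%N]card_ord.
case/andP: nT => _ uT; rewrite -(card_uniqP uT); exact: max_card.
Qed.

(** The default 0 is not reached for a normal tree with all labels, whose monomial is
    multilinear. *)
Definition rtree_monomial (T : rtree n) : Lie2 R n :=
  if insub (btree T) is Some t then Lie2_proj (gen R (t : mltree n)) else 0.

Lemma rtree_mltree T : normal T -> lab T = setT ->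
  exists2 t : mltree n, mltree_val t = btree T & rtree_monomial T = Lie2_proj (gen R t).
Proof.
move=> nT lT; have pT : perm_eq (leaves (btree T)) (enum 'I_n).
  apply: uniq_perm; rewrite ?uniq_btree ?enum_uniq // => i.
  have := lset_btree nT; rewrite lT => /setP /(_ i).
  by rewrite !inE mem_enum => ->.
by exists (MLTree pT); rewrite // /rtree_monomial insubT.
Qed.

Lemma rtree_monomial_span (y : Lie2 R n) :
  y \in span (fun x => exists2 T, T \in full_normal & x = rtree_monomial T).
Proof.
(* The spanning result lives in the whole algebra; a combination is lifted term by term and compared
   through the injective [Lie2_val]. *)
have [z zK zy] : exists2 z, z \in span
    (fun x => exists2 T, T \in full_normal & x = rtree_monomial T) &
    Lie2_val z = Lie2_val y; last by rewrite -(val_inj zy).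
have : Lie2_val y \in span (normal_mon (lie2_monomial R (n:=n)) setT).
  case: y => x /=; apply: span_trans => _ [t ->].
  have [ut ft] := mltreeP t; rewrite -ft.
  apply: (normal_mon_span (B := lie2_alg_two_lie R n)) => //.
    exact: lie2_monomialN.
  exact: lie2_monomial_graft.
move: (Lie2_val y) => x {y} /asboolP; elim=> [|a _ v [T [nT lT ->]] _ [z zK zv]].
  by exists 0; rewrite ?rpred0.
have [t tT monT] := rtree_mltree nT lT.
exists (a *: rtree_monomial T + z); last by rewrite Lie2_valP zv monT Lie2_proj_gen tT.
apply: rpredD => //; apply: rpredZ; apply: mem_span; exists T => //.
by rewrite mem_full_normal nT lT eqxx.
Qed.

End Monomials.

Lemma rgraph_loopless n (T : rtree n) : normal T ->
  all (fun e => e.1.2 != e.2) (rgraph T).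
Proof.
elim: T => [//|T ihT X ihX|Y ihY y T ihT] nT.
  have [nT1 nX d] := normalB nT; rewrite /= all_cat ihT ?ihX // !andbT.
  by apply/eqP => e; have := disjointFr d (rootE T); rewrite e rootE.
have [nY nT1 d] := normalR nT; rewrite /= all_cat ihY ?ihT // !andbT.
have yY : y \in lab Y by case/andP: (nT) => /and5P[_ _ _ _ yY] _; rewrite inE.
by apply/eqP => e; have := disjointFr d yY; rewrite e rootE.
Qed.

Section EilClasses.
Variables (R : comPzRingType) (n : nat).
Implicit Types (E : seq (rawedge n)) (i j k : 'I_n) (c d : color).

Definition eil2_class (G : graph n) : Eil2 R n := Eil2_proj (gen R G : Gamma R n).
Definition edge_class E : Eil2 R n := eil2_class (raw_graph E).

Lemma Eil2_proj_relation (u : Gamma R n) : eil2_relation u -> Eil2_proj u = 0.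
Proof.
move=> ru; rewrite -[RHS](raddf0 (@quotmod_pi R (Gamma R n) (span (@eil2_relation R n)))).
by apply/quotmod_piP; rewrite subr0; apply: mem_span.
Qed.

Lemma Eil2_projD (u v : Gamma R n) : Eil2_proj (u + v) = Eil2_proj u + Eil2_proj v.
Proof. by have := Eil2_projP 1 u v; rewrite !scale1r. Qed.

Lemma edge_class_perm E E' : perm_eq E E' -> edge_class E = edge_class E'.
Proof. by rewrite /edge_class => /raw_graph_perm ->. Qed.

Lemma edge_class_flip c i j E : i != j ->
  edge_class ((c, i, j) :: E) = - edge_class ((c, j, i) :: E).
Proof.
move=> ij; have ji : j != i by rewrite eq_sym.
apply/eqP; rewrite -addr_eq0 /edge_class (raw_graph_cons _ ij) (raw_graph_cons _ ji).
by rewrite -Eil2_projD Eil2_proj_relation //; apply: eil2_flip.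
Qed.

Lemma edge_class_cons2 c d i j k l E (ij : i != j) (kl : k != l) :
  edge_class ((c, i, j) :: (d, k, l) :: E)
  = eil2_class (add_edge (add_edge (raw_graph E) (arrow c ij)) (arrow d kl)).
Proof.
rewrite (edge_class_perm (E' := (d, k, l) :: (c, i, j) :: E)); last by perm_lia.
by rewrite /edge_class (raw_graph_cons _ kl) (raw_graph_cons _ ij).
Qed.

Lemma edge_class_cyc c i j k E : i != j -> j != k -> k != i ->
  edge_class ((c, i, j) :: (c, j, k) :: E) + edge_class ((c, j, k) :: (c, k, i) :: E)
  + edge_class ((c, k, i) :: (c, i, j) :: E) = 0.
Proof.
move=> ij jk ki; rewrite (edge_class_cons2 c c E ij jk) (edge_class_cons2 c c E jk ki).
rewrite (edge_class_cons2 c c E ki ij) -!Eil2_projD.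
by apply: Eil2_proj_relation; apply: eil2_arnold.
Qed.

Lemma edge_class_mixed i j k E : i != j -> j != k -> k != i ->
  (edge_class ((blue, i, j) :: (red, j, k) :: E)
    + edge_class ((red, i, j) :: (blue, j, k) :: E))
  + (edge_class ((blue, j, k) :: (red, k, i) :: E)
    + edge_class ((red, j, k) :: (blue, k, i) :: E))
  + (edge_class ((blue, k, i) :: (red, i, j) :: E)
    + edge_class ((red, k, i) :: (blue, i, j) :: E)) = 0.
Proof.
move=> ij jk ki; rewrite !(edge_class_cons2 _ _ E ij jk).
rewrite !(edge_class_cons2 _ _ E jk ki) !(edge_class_cons2 _ _ E ki ij) -!Eil2_projD.
by apply: Eil2_proj_relation; apply: eil2_mixed.
Qed.

Lemma edge_class_multiple c d i j E : i != j ->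
  edge_class ((c, i, j) :: (d, i, j) :: E) = 0.
Proof.
move=> ij; apply: Eil2_proj_relation; apply: eil2_multiple.
exact: raw_graph_multiple.
Qed.

Lemma edge_class_disconnected E :
  (forall i, exists (P : pred 'I_n) j,
    [/\ P i, ~~ P j & {in E, forall e, P e.1.2 = P e.2}]) -> edge_class E = 0.
Proof.
move=> cutE; apply: Eil2_proj_relation; apply: eil2_disconnected.
exact: raw_graph_disconnected.
Qed.

Lemma rgraph_class_span (x : Eil2 R n) :
  x \in span (fun u => exists2 T, T \in full_normal n & u = edge_class (rgraph T)).
Proof.
have [u ->] := Eil2_proj_surj x; elim/freemod_ind: u => [|a G u ih].
  have e0 : Eil2_proj (0 : Gamma R n) = 0.
    exact: (raddf0 (@quotmod_pi R (Gamma R n) (span (@eil2_relation R n)))).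
  by rewrite [Eil2_proj _]e0; apply: rpred0.
rewrite [Eil2_proj _](Eil2_projP a (gen R G)); apply: rpredD => //; apply: rpredZ.
rewrite -[Eil2_proj _]/(eil2_class G) -(raw_edgesK G) -/(edge_class _).
apply: (loopless_qK (K := span _) edge_class_perm edge_class_flip edge_class_cyc
  edge_class_mixed edge_class_multiple edge_class_disconnected);
  last exact: raw_edges_loopless.
move=> A r E pA hr; have uA : uniq A by rewrite (perm_uniq pA) enum_uniq.
have [T [nT lT _ eT]] := rooted_normal uA hr.
apply: mem_span; exists T; last by apply: edge_class_perm; rewrite perm_sym.
rewrite mem_full_normal nT; apply/eqP/setP => i.
by rewrite !inE (perm_mem lT) (perm_mem pA) mem_enum.
Qed.

End EilClasses.

Theorem theorem7p1 (R : comPzRingType) (n : nat) :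
  exists p : bilinear_pairing (Eil2 R n) (Lie2 R n),
    (forall (g : Gamma R n) (t : Theta R n),
        p (Eil2_proj g) (Lie2_proj t) = pairing_form g t)
    /\ perfect p.
Proof.
have [p pE] := graph_tree_pairing_exists R n; exists p; split=> //.
have pT T T' : T \in full_normal n -> T' \in full_normal n ->
    p (edge_class R (rgraph T)) (rtree_monomial R T') = tree_sgn R (rgraph T) (btree T').
  rewrite !mem_full_normal => /andP[nT /eqP lT] /andP[nT' /eqP lT'].
  have [t tT' ->] := rtree_mltree R nT' lT'.
  rewrite pE /pairing_form bilinext_gen graph_tree_pairingE tT'.
  exact/perm_tree_sgn/raw_graphK/rgraph_loopless.
apply: (@perfect_triangular R (Eil2 R n) (Lie2 R n) p _ (full_normal n)
  (fun T => edge_class R (rgraph T)) (@rtree_monomial R n) (@mu n)).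
- exact: rgraph_class_span.
- exact: rtree_monomial_span.
- move=> T sT; rewrite pT //; apply: tree_sgn_unit; apply: compat_self.
  by move: sT; rewrite mem_full_normal => /andP[].
move=> T T' sT sT' TT' le; rewrite pT //; apply: tree_sgn_compat0.
move: sT sT'; rewrite !mem_full_normal => /andP[nT /eqP lT] /andP[nT' /eqP lT'].
(* The graph comes from T and the monomial from T', so [triangular] gives equality or
   [mu T' < mu T]. *)
apply/negP => /(triangular nT' nT); rewrite lT lT' => /(_ erefl)[e|].
  by rewrite e eqxx in TT'.
by rewrite ltnNge le.
Qed.
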